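(* Restricted to unassuming arrangements, the operator $\Lambda_{\{2\},\{3\}}$ has degree two over $\mathbb{C}$ (a complex unassuming arrangement in its image generically has exactly two unassuming preimages), and it has an inverse on the space of real unassuming arrangements (a real unassuming arrangement has exactly one real unassuming preimage).
   Context: Work in $\mathbb{P}^2$. For a line arrangement $\mathcal{A}$, a $k$-point is a point where exactly $k$ lines meet; $\mathcal{P}_{\{k\}}(\mathcal{A})$ is the set of $k$-points. For a finite point set $P$, $\mathcal{L}_{\{k\}}(P)$ (resp. $\mathcal{L}_k(P)$) is the set of lines containing exactly (resp. at least) $k$ points of $P$. $\Lambda_{\{2\},\{3\}}(\mathcal{A})=\mathcal{L}_{\{3\}}(\mathcal{P}_{\{2\}}(\mathcal{A}))$. $\mathcal{D}$ is projective duality. An arrangement $\mathcal{C}$ of six lines is unassuming if its only singularities are $15$ double points and $\mathcal{L}_2(\mathcal{D}(\mathcal{C}))$ has exactly $27$ double points, $6$ triple points and $6$ five-fold points (no other singularities), the six $5$-points not on a conic. A real unassuming arrangement is one whose lines are defined over $\mathbb{R}$.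
   Formalization: Existence of a real unassuming preimage is claimed only outside one projective class, where it fails (the only real candidate preimage has 10 triple points); uniqueness holds for all. ''Generically'' means outside finitely many projective classes. *)

(* Defs.v *)
From HB Require Import structures.
From mathcomp Require Import all_boot all_order all_algebra.
From mathcomp Require Import complex.
From mathcomp Require Import boolp classical_sets functions cardinality reals.

Set Implicit Arguments.
Unset Strict Implicit.
Unset Printing Implicit Defensive.

Import Order.TTheory GRing.Theory Num.Theory.

Local Open Scope classical_set_scope.
Local Open Scope card_scope.
Local Open Scope ring_scope.

(* P^2(K) is the set of one-dimensional subspaces of K^3; its lines are the
   two-dimensional ones. *)
Definition P2point (K : numFieldType) : Type :=
  {p : {vspace 'rV[K]_3} | \dim p == 1%N}.

Definition P2line (K : numFieldType) : Type :=
  {l : {vspace 'rV[K]_3} | \dim l == 2%N}.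

Definition on_line (K : numFieldType) (p : P2point K) (l : P2line K) : bool :=
  (val p <= val l)%VS.

Definition points_exactly (K : numFieldType) (k : nat) (A : set (P2line K)) :
    set (P2point K) :=
  [set p | A `&` [set l | on_line p l] #= `I_k].

Definition points_atleast (K : numFieldType) (k : nat) (A : set (P2line K)) :
    set (P2point K) :=
  [set p | `I_k #<= A `&` [set l | on_line p l]].

Definition lines_exactly (K : numFieldType) (k : nat) (P : set (P2point K)) :
    set (P2line K) :=
  [set l | P `&` [set p | on_line p l] #= `I_k].

Definition lines_atleast (K : numFieldType) (k : nat) (P : set (P2point K)) :
    set (P2line K) :=
  [set l | `I_k #<= P `&` [set p | on_line p l]].

Definition Lambda23 (K : numFieldType) (A : set (P2line K)) : set (P2line K) :=
  lines_exactly 3 (points_exactly 2 A).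

(* The dual plane is identified with P^2(K) through dual coordinates: the line
   a x + b y + c z = 0 corresponds to the point (a : b : c). As the dimensions
   are 2 and 1, orthogonality of l and p means that p is the orthogonal
   complement of l. *)
Definition dual_pair (K : numFieldType) (l : P2line K) (p : P2point K) : Prop :=
  forall u v : 'rV[K]_3, u \in val l -> v \in val p -> u *m v^T = 0.

Definition dual_points (K : numFieldType) (A : set (P2line K)) :
    set (P2point K) :=
  [set p : P2point K | exists2 l : P2line K, A l & dual_pair l p].

(* A conic, possibly degenerate, is the zero locus of a nonzero quadratic
   form, here given by its symmetric Gram matrix. *)
Definition on_a_conic (K : numFieldType) (P : set (P2point K)) : Prop :=
  exists Q : 'M[K]_3, [/\ Q != 0, Q^T = Q &
    forall (p : P2point K) (v : 'rV[K]_3),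
      P p -> v \in val p -> v *m Q *m v^T = 0].

Definition unassuming (K : numFieldType) : set (set (P2line K)) :=
  [set C | [/\ C #= `I_6,
      points_exactly 2 C #= `I_15,
      points_atleast 2 C = points_exactly 2 C &
      let L := lines_atleast 2 (dual_points C) in
      [/\ points_exactly 2 L #= `I_27,
          points_exactly 3 L #= `I_6,
          points_exactly 5 L #= `I_6,
          points_atleast 2 L =
            points_exactly 2 L `|` points_exactly 3 L `|` points_exactly 5 L &
          ~ on_a_conic (points_exactly 5 L)]]].

Definition projectively_equivalent (K : numFieldType)
    (A B : set (P2line K)) : Prop :=
  exists2 g : 'M[K]_3, g \in unitmx &
    B = [set l' : P2line K | exists2 l : P2line K, A l &
           forall v : 'rV[K]_3, (v \in val l) = (v *m g \in val l')].

Definition finitely_many_classes (K : numFieldType)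
    (X : set (set (P2line K))) : Prop :=
  exists2 S : set (set (P2line K)), finite_set S &
    X `<=` [set B | exists2 A, S A & projectively_equivalent A B].

(* Unassuming arrangements modulo projective equivalence form a
   one-dimensional family, whose proper closed subsets are finite. *)
Definition generically (K : numFieldType)
    (X Q : set (set (P2line K))) : Prop :=
  ~ finitely_many_classes X /\ finitely_many_classes (X `\` Q).

Definition real_line (R : realType) (l : P2line R[i]) : Prop :=
  exists a : 'rV[R]_3, forall v : 'rV[R[i]]_3,
    (v \in val l) = (v *m (map_mx (real_complex R) a)^T == 0).

Definition real_unassuming (R : realType) : set (set (P2line R[i])) :=
  [set A | unassuming A /\ forall l, A l -> real_line l].

(* Main.v *)
Require Import Defs.
From mathcomp Require Import all_boot all_order all_algebra.
From mathcomp Require Import complex ring lra zify.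
From mathcomp Require Import boolp classical_sets functions cardinality reals.

Set Implicit Arguments.
Unset Strict Implicit.
Unset Printing Implicit Defensive.

Import Order.TTheory GRing.Theory Num.Theory.

Local Open Scope classical_set_scope.
Local Open Scope card_scope.
Local Open Scope ring_scope.

(* Dualize: an arrangement is given by six normal vectors v_0, .., v_5. A triple
   point of the 15 joining lines is a concurrent syntheme (a partition of the six
   indices into three pairs whose lines meet), and [Lambda23] sends the six
   normals to these triple points. By Pappus' theorem, if two synthemes of a
   bipartition 3+3 are concurrent, so is the third one of the same parity. A
   closed set of exactly six synthemes is then of one of two types:
   - the six perfect matchings of a K_{3,3}: this forces a primitive cube root of
     unity and a single projective class, which is never real;
   - the six synthemes other than a fixed one s that share a duad with s: in the
     triangle formed by the three lines of s, the points are
       (0 : 1 : +-p), (+-q : 0 : 1), (1 : +-r : 0).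
   In the second case [Lambda23] keeps the triangle and divides p, q, r by
   T = p q r. The triangle is recovered from the image B and its own image, since
   its sides are the lines containing two points of both. Hence the preimages of
   (p, q, r) are (p t, q t, r t) with t^2 = +-1/T, where t and -t give the same
   arrangement: two preimages over C, one over R. They are unassuming except when
   t^4 - 18 t^2 + 1 = 0, which is a single class, with T = 9 + 4 sqrt 5.
   There are infinitely many classes because the projective invariant
   [024][135] / ([012][345]) takes infinitely many values on the family. *)

(** * Brackets in K^3 *)

(** Rescaling the parameters by [t] replaces their product [T] by [T t^3], and [Lambda23] then
    returns [p / (T t^2)] and its analogues. An unordered arrangement only sees the squares of its
    parameters, so the condition on a preimage is [t^4 T^2 = 1]; the squared product of the preimage
    is then [t^2]. This is why a condition on preimages appears as a quartic in [t]. That quartic is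
    reciprocal in [t^2], and exchanging two vertices of the triangle inverts the product, so its
    roots give a single class. The main obstacle is that a bare set of six lines carries neither an
    order, nor scalars, nor a frame. Parameters of two arrangements can be compared only once both
    are written in the same triangle, and one has to prove that this triangle is intrinsic. For the
    real statement the classification is run over the small field and transported along a field
    morphism. The frame, the parameters and [t] are then real themselves, and [t^4] determines the
    nonnegative number [t^2]. *)

Section Vectors.
Variable K : fieldType.
Implicit Types (u v w x n : 'rV[K]_3) (M : 'M[K]_3) (a b c : K).

Definition i0 : 'I_3 := Ordinal (isT : (0 < 3)%N).
Definition i1 : 'I_3 := Ordinal (isT : (1 < 3)%N).
Definition i2 : 'I_3 := Ordinal (isT : (2 < 3)%N).

Definition row3 a b c : 'rV[K]_3 := \row_(j < 3) [:: a; b; c]`_j.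
Definition dot u v : K := u 0 i0 * v 0 i0 + u 0 i1 * v 0 i1 + u 0 i2 * v 0 i2.
Definition cross u v : 'rV[K]_3 :=
  row3 (u 0 i1 * v 0 i2 - u 0 i2 * v 0 i1) (u 0 i2 * v 0 i0 - u 0 i0 * v 0 i2)
       (u 0 i0 * v 0 i1 - u 0 i1 * v 0 i0).
(** The 3 by 3 determinant, zero exactly on collinear triples of projective points; [cross u v] is
    the line joining [u] and [v]. *)
Definition bracket u v w : K := dot (cross u v) w.

Lemma forall_I3 (P : 'I_3 -> Prop) : P i0 -> P i1 -> P i2 -> forall i, P i.
Proof.
move=> h0 h1 h2 [[|[|[|m]]] hm] //.
- by rewrite (_ : Ordinal hm = i0) //; apply: val_inj.
- by rewrite (_ : Ordinal hm = i1) //; apply: val_inj.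
- by rewrite (_ : Ordinal hm = i2) //; apply: val_inj.
Qed.

Lemma row3P u v : u 0 i0 = v 0 i0 -> u 0 i1 = v 0 i1 -> u 0 i2 = v 0 i2 -> u = v.
Proof. by move=> h0 h1 h2; apply/rowP; apply: forall_I3. Qed.

Lemma sum_I3 (F : 'I_3 -> K) : \sum_i F i = F i0 + F i1 + F i2.
Proof.
rewrite !big_ord_recl big_ord0 addr0 addrA.
by congr (F _ + F _ + F _); apply: val_inj.
Qed.

Lemma row3E0 a b c : row3 a b c 0 i0 = a. Proof. by rewrite mxE. Qed.
Lemma row3E1 a b c : row3 a b c 0 i1 = b. Proof. by rewrite mxE. Qed.
Lemma row3E2 a b c : row3 a b c 0 i2 = c. Proof. by rewrite mxE. Qed.
Definition row3E := (row3E0, row3E1, row3E2).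

Lemma mulmx3E v M j : (v *m M) 0 j = v 0 i0 * M i0 j + v 0 i1 * M i1 j + v 0 i2 * M i2 j.
Proof. by rewrite mxE sum_I3. Qed.

Lemma addvE u v j : (u + v) 0 j = u 0 j + v 0 j. Proof. by rewrite mxE. Qed.
Lemma oppvE u j : (- u) 0 j = - u 0 j. Proof. by rewrite mxE. Qed.
Lemma scalevE a u j : (a *: u) 0 j = a * u 0 j. Proof. by rewrite mxE. Qed.
Lemma zerovE j : (0 : 'rV[K]_3) 0 j = 0. Proof. by rewrite mxE. Qed.

Lemma rowvE i M j : (row i M) 0 j = M i j. Proof. by rewrite mxE. Qed.

Definition vecE := (addvE, oppvE, scalevE, zerovE, rowvE, row3E, mulmx3E).


(** The determinant of [M], kept as an explicit polynomial for [ring]. *)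
Definition row_bracket M : K := bracket (row i0 M) (row i1 M) (row i2 M).

Lemma bracket_mul u v w M : bracket (u *m M) (v *m M) (w *m M) = bracket u v w * row_bracket M.
Proof.
by rewrite /row_bracket /bracket /dot /cross !vecE; ring.
Qed.

Definition e0 := row3 1 0 0.
Definition e1 := row3 0 1 0.
Definition e2 := row3 0 0 1.

Lemma bracket_e : bracket e0 e1 e2 = 1.
Proof. by rewrite /bracket /dot /cross /e0 /e1 /e2 !vecE; ring. Qed.

Definition mx3 u v w : 'M[K]_3 :=
  \matrix_(i, j) (if i == i0 then u 0 j else if i == i1 then v 0 j else w 0 j).

Lemma mx3E u v w j :
  (mx3 u v w i0 j = u 0 j) * (mx3 u v w i1 j = v 0 j) * (mx3 u v w i2 j = w 0 j).
Proof. by rewrite !mxE. Qed.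

Lemma mx3_row u v w :
  (row i0 (mx3 u v w) = u) * (row i1 (mx3 u v w) = v) * (row i2 (mx3 u v w) = w).
Proof. by do 2?split; apply/rowP=> j; rewrite !mxE. Qed.

Lemma unit3P M : (M \in unitmx) = (row_bracket M != 0).
Proof.
apply/idP/idP => [uM|dM0].
  apply/eqP=> d0; have := bracket_e.
  by rewrite -[e0](mulmxKV uM) -[e1](mulmxKV uM) -[e2](mulmxKV uM) bracket_mul d0 mulr0 => /eqP; rewrite eq_sym oner_eq0.
(* The adjugate of [M]: its columns are the cross products of pairs of rows. *)
pose X := (mx3 (cross (row i1 M) (row i2 M)) (cross (row i2 M) (row i0 M)) (cross (row i0 M) (row i1 M)))^T.
have e : M *m X = (row_bracket M)%:M.
  apply/matrixP=> i j; rewrite mxE sum_I3 ![X _ _]mxE [RHS]mxE.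
  by move: i j; apply: forall_I3; apply: forall_I3;
     rewrite !mx3E /= ?mulr1n ?mulr0n /row_bracket /bracket /dot /cross !vecE; ring.
have : M *m ((row_bracket M)^-1 *: X) = 1%:M by rewrite -scalemxAr e scale_scalar_mx mulVf.
by case/mulmx1_unit.
Qed.

Lemma mul_mx3 n u v w : n *m mx3 u v w = n 0 i0 *: u + n 0 i1 *: v + n 0 i2 *: w.
Proof. by apply/rowP=> j; rewrite mulmx3E !vecE !mx3E. Qed.

Lemma dm_mx3 u v w : row_bracket (mx3 u v w) = bracket u v w.
Proof. by rewrite /row_bracket !mx3_row. Qed.

Ltac vring := rewrite /bracket /dot /cross !vecE; ring.

Lemma bracket_rot u v w : bracket u v w = bracket v w u. Proof. by vring. Qed.
Lemma bracket_swap u v w : bracket v u w = - bracket u v w. Proof. by vring. Qed.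
Lemma bracket_swap2 u v w : bracket u w v = - bracket u v w. Proof. by vring. Qed.
Lemma bracket_uvu u v : bracket u v u = 0. Proof. by vring. Qed.
Lemma bracket_uvv u v : bracket u v v = 0. Proof. by vring. Qed.
Lemma bracket_scale a b c u v w : bracket (a *: u) (b *: v) (c *: w) = a * b * c * bracket u v w.
Proof. by vring. Qed.
Lemma bracket_scale3 c u v w : bracket u v (c *: w) = c * bracket u v w.
Proof. by vring. Qed.
Lemma bracketD3 a b u v w x : bracket u v (a *: w + b *: x) = a * bracket u v w + b * bracket u v x.
Proof. by vring. Qed.

Lemma cramer u v w n : bracket u v w *: n = bracket n v w *: u + bracket u n w *: v + bracket u v n *: w.
Proof. by apply: row3P; vring. Qed.

Lemma cramer_dual u v w n :
  bracket u v w *: n = dot n u *: cross v w + dot n v *: cross w u + dot n w *: cross u v.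
Proof. by apply: row3P; vring. Qed.

(** Both equations put [n] on lines through [u]. These two lines are distinct, so they meet only in
    [u]; the factor comes from Cramer's rule. *)
Lemma meet_prop u v w n : bracket u v w != 0 -> bracket u v n = 0 -> bracket u w n = 0 ->
  n = (bracket n v w / bracket u v w) *: u.
Proof.
move=> h h1 h2; apply: (scalerI h); rewrite cramer h1 scale0r addr0.
by rewrite (bracket_swap2 u w n) h2 oppr0 scale0r addr0 scalerA [bracket u v w * _]mulrC divfK.
Qed.

Lemma dotC u v : dot u v = dot v u. Proof. by rewrite /dot; ring. Qed.
Lemma dotE u v : (u *m v^T) = (dot u v)%:M.
Proof. by apply/matrixP=> i j; rewrite !ord1 !mxE sum_I3 !mxE. Qed.
Lemma dot_eq0 u v : (u *m v^T == 0) = (dot u v == 0).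
Proof.
rewrite dotE; apply/eqP/eqP => [/matrixP/(_ 0 0)|->]; last by apply/matrixP=> i j; rewrite !ord1 !mxE mul0rn.
by rewrite !mxE eqxx.
Qed.
Lemma dot_scale a b u v : dot (a *: u) (b *: v) = a * b * dot u v.
Proof. by rewrite /dot !vecE; ring. Qed.

Lemma dotZl a u v : dot (a *: u) v = a * dot u v.
Proof. by rewrite /dot !vecE; ring. Qed.
Lemma vec_neq0 u : u != 0 -> [\/ u 0 i0 != 0, u 0 i1 != 0 | u 0 i2 != 0].
Proof.
move=> hu; case: (eqVneq (u 0 i0) 0) => [h0|]; last by constructor 1.
case: (eqVneq (u 0 i1) 0) => [h1|]; last by constructor 2.
constructor 3; apply: contra hu => /eqP h2; apply/eqP; apply: row3P; rewrite zerovE //.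
Qed.

Lemma cross_eq0 u v : u != 0 -> cross u v = 0 -> exists c, v = c *: u.
Proof.
move=> hu h; have E j : cross u v 0 j = 0 by rewrite h zerovE.
have := E i2; have := E i1; have := E i0; rewrite /cross !row3E => h0 h1 h2.
case: (vec_neq0 hu) => k; [exists (v 0 i0 / u 0 i0)|exists (v 0 i1 / u 0 i1)|exists (v 0 i2 / u 0 i2)];
  apply: row3P; rewrite !vecE; apply: (mulfI k);
  rewrite [RHS]mulrA [_ * (v 0 _ / _)]mulrC divfK //; try (by rewrite mulrC);
  apply/eqP; rewrite -subr_eq0; apply/eqP;
  by [rewrite -h0; ring | rewrite -h1; ring | rewrite -h2; ring
     | rewrite -oppr0 -h0; ring | rewrite -oppr0 -h1; ring | rewrite -oppr0 -h2; ring].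
Qed.

Lemma cross_of_on u v n : cross u v != 0 -> dot u n = 0 -> dot v n = 0 ->
  exists c, n = c *: cross u v.
Proof.
move=> h hu hv; apply: cross_eq0 => //.
have -> : cross (cross u v) n = dot u n *: v - dot v n *: u by apply: row3P; vring.
by rewrite hu hv !scale0r subr0.
Qed.
End Vectors.

(** * Points and lines of the projective plane *)

Section PointsLines.
Variable K : numFieldType.
Implicit Types (u v w x n a b : 'rV[K]_3) (p : P2point K) (l : P2line K).

Lemma e0_neq0 : e0 K != 0.
Proof. by apply/eqP => /rowP/(_ i0)/eqP; rewrite !vecE oner_eq0. Qed.

Lemma dim_line v : v != 0 -> \dim <[v]>%VS == 1%N.
Proof. by move=> hv; rewrite dim_vline hv. Qed.

Definition orth a : {vspace 'rV[K]_3} := lker (linfun (mulmxr a^T : 'rV[K]_3 -> 'M[K]_1)).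

Lemma mem_orth a v : (v \in orth a) = (dot v a == 0).
Proof. by rewrite memv_ker lfunE /= dot_eq0. Qed.

Lemma dim_orth a : a != 0 -> \dim (orth a) == 2%N.
Proof.
move=> ha; rewrite /orth; set f := linfun _.
have := limg_ker_dim f fullv; rewrite capfv dimvf /= /dim /= mul1n.
suff -> : \dim (f @: fullv) = 1%N by rewrite addn1 => -[->].
apply/eqP; rewrite eqn_leq; apply/andP; split.
  by apply: leq_trans (dimvS (subvf _)) _; rewrite dimvf.
rewrite lt0n dimv_eq0; apply: contra ha => /eqP h0.
have h v : dot v a = 0.
  apply/eqP; rewrite -mem_orth memv_ker -memv0 -/f -h0; apply: memv_img; exact: memvf.
apply/eqP; apply: row3P; rewrite zerovE.
- by rewrite -(h (e0 K)) /dot !vecE; ring.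
- by rewrite -(h (e1 K)) /dot !vecE; ring.
- by rewrite -(h (e2 K)) /dot !vecE; ring.
Qed.

(** [insubd] makes the map total: the zero vector gets a default point, so most later statements
    assume a nonzero vector. The same holds for [Ln]. *)
Definition Pt v : P2point K := insubd (exist _ <[e0 K]>%VS (dim_line e0_neq0) : P2point K) <[v]>%VS.
Definition Ln a : P2line K := insubd (exist _ (orth (e0 K)) (dim_orth e0_neq0) : P2line K) (orth a).

Lemma val_Pt v : v != 0 -> val (Pt v) = <[v]>%VS.
Proof. by move=> hv; rewrite /Pt val_insubd dim_line. Qed.
Lemma val_Ln a : a != 0 -> val (Ln a) = orth a.
Proof. by move=> hv; rewrite /Ln val_insubd dim_orth. Qed.

Lemma on_lineE v a : v != 0 -> a != 0 -> on_line (Pt v) (Ln a) = (dot v a == 0).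
Proof. by move=> hv ha; rewrite /on_line val_Pt // val_Ln // -memvE mem_orth. Qed.

Lemma PtP p : exists2 v, v != 0 & p = Pt v.
Proof.
have hp := valP p; exists (vpick (val p)).
  by rewrite vpick0 -dimv_eq0 (eqP hp).
have h0 : vpick (val p) != 0 by rewrite vpick0 -dimv_eq0 (eqP hp).
apply: val_inj; rewrite val_Pt //; apply/eqP.
by rewrite eq_sym eqEdim -memvE memv_pick (eqP hp) dim_vline h0.
Qed.

Lemma LnP l : exists2 a, a != 0 & l = Ln a.
Proof.
have /eqP hl := valP l.
have := vbasisP (val l); move: (vbasis (val l)); rewrite hl => s hs.
have [u [v es]] : exists u, exists v, s = [:: u; v] :> seq _.
  by case: s hs => -[|u [|v []]] // hs; exists u, v.
have f2 := basis_free hs; have := span_basis hs; rewrite es => sp.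
move: f2; rewrite es => f2.
have u0 : u != 0 by apply: (free_not0 f2); rewrite !inE eqxx.
have c0 : cross u v != 0.
  apply/eqP=> /(cross_eq0 u0) [c ec].
  have : v != 0 by apply: (free_not0 f2); rewrite !inE eqxx orbT.
  rewrite ec scaler_eq0 negb_or => /andP [c0 _].
  move: f2; rewrite free_cons span_seq1 ec.
  by case/andP=> /negP []; apply/vlineP; exists c^-1; rewrite scalerA mulVf // scale1r.
exists (cross u v) => //; apply: val_inj; rewrite val_Ln //; apply/eqP.
rewrite eqEdim (eqP (dim_orth c0)) hl leqnn andbT -sp.
apply/span_subvP => x; rewrite !inE => /orP [] /eqP ->; rewrite mem_orth /dot /cross !vecE; apply/eqP; ring.
Qed.

Lemma Pt_scale c v : c != 0 -> Pt (c *: v) = Pt v.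
Proof.
move=> hc; rewrite /Pt; congr insubd; apply/eqP; rewrite eqEsubv -!memvE.
apply/andP; split; apply/vlineP; first by exists c.
by exists c^-1; rewrite scalerA mulVf // scale1r.
Qed.

Lemma Ln_scale c a : c != 0 -> Ln (c *: a) = Ln a.
Proof.
move=> hc; rewrite /Ln; congr insubd; apply/vspaceP => x; rewrite !mem_orth.
by rewrite -[x in LHS]scale1r dot_scale mul1r mulf_eq0 (negPf hc).
Qed.

Lemma Pt_inj v w : v != 0 -> w != 0 -> Pt v = Pt w -> exists2 c, c != 0 & v = c *: w.
Proof.
move=> hv hw /(congr1 val); rewrite !val_Pt // => e.
have /vlineP [c ec] : v \in <[w]>%VS by rewrite -e memv_line.
by exists c => //; apply: contra hv => /eqP c0; rewrite ec c0 scale0r.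
Qed.

Lemma dot_cross_all a b : a != 0 ->
  (forall x, dot x a = 0 -> dot x b = 0) -> exists c, b = c *: a.
Proof.
move=> ha h; apply: cross_eq0 => //.
have hh n : dot (cross a n) b = 0.
  by apply: h; rewrite /dot /cross !vecE; ring.
apply: row3P; rewrite zerovE.
- by rewrite -[RHS]oppr0 -(hh (e0 K)) /dot /cross !vecE; ring.
- by rewrite -[RHS]oppr0 -(hh (e1 K)) /dot /cross !vecE; ring.
- by rewrite -[RHS]oppr0 -(hh (e2 K)) /dot /cross !vecE; ring.
Qed.

Lemma Ln_inj a b : a != 0 -> b != 0 -> Ln a = Ln b -> exists2 c, c != 0 & a = c *: b.
Proof.
move=> ha hb /(congr1 val); rewrite !val_Ln // => e.
have [|c ec] := @dot_cross_all b a hb.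
  by move=> x xb; apply/eqP; rewrite -mem_orth e mem_orth xb.
by exists c => //; apply: contra ha => /eqP c0; rewrite ec c0 scale0r.
Qed.

Lemma dual_pairE a v : a != 0 -> v != 0 -> dual_pair (Ln a) (Pt v) <-> Pt v = Pt a.
Proof.
move=> ha hv; split => [h|].
  have [|c ec] := @dot_cross_all a v ha.
    move=> x /eqP xa; apply/eqP; rewrite -dot_eq0; apply/eqP; apply: h.
      by rewrite val_Ln // mem_orth.
    by rewrite val_Pt // memv_line.
  rewrite ec Pt_scale //; apply: contra hv => /eqP c0; rewrite ec c0 scale0r //.
move=> e x y; rewrite e val_Ln // val_Pt // mem_orth => /eqP xa /vlineP [c ->].
by apply/eqP; rewrite dot_eq0 -[x]scale1r dot_scale xa mulr0.
Qed.

(** Most cardinalities below are reduced by this lemma to the size of an explicit duplicate-free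
    list, which can be computed. *)
Lemma card_seq (T : eqType) (U : Type) (s : seq T) (f : T -> U) (A : set U) (k : nat) :
  uniq s -> {in s &, injective f} -> (forall y, A y <-> exists2 i, i \in s & y = f i) ->
  ((A #= `I_k) = (size s == k)) * ((`I_k #<= A) = (k <= size s)%N).
Proof.
move=> us fi hA; have -> : A = f @` [set` s].
  apply/seteqP; split=> y; first by move/hA => [i si ->]; exists i.
  by case=> i si <-; apply/hA; exists i.
have h1 : f @` [set` s] #= `I_(size s).
  apply: (@card_eq_trans _ _ _ _ [set` s]).
    by apply: inj_card_eq => x y /set_mem hx /set_mem hy; apply: fi.
  case: s us {fi hA} => [|x0 s'] us.
    rewrite /= II0 card_eq0; apply/eqP/seteqP; split=> x //.
  set s := x0 :: s' in us *.
  have -> : [set` s] = nth x0 s @` `I_(size s).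
    apply/seteqP; split=> y.
      by move=> /= ys; exists (index y s); [rewrite /mkset index_mem | rewrite nth_index].
    by case=> i /= hi <-; apply: mem_nth.
  apply: inj_card_eq => i j /set_mem hi /set_mem hj e; apply/eqP.
  by rewrite -(nth_uniq x0 hi hj us) e.
split; first by rewrite (card_eql h1); apply/card_eq_II/eqP.
by rewrite (card_le_eqr h1) card_le_II.
Qed.

End PointsLines.

(** * Duads and synthemes at a point *)

Fixpoint bool_seqs n : seq (seq bool) :=
  if n is n'.+1 then [seq b :: s | b <- [:: true; false], s <- bool_seqs n'] else [:: [::]].

Lemma mem_bool_seqs (s : seq bool) : s \in bool_seqs (size s).
Proof.
elim: s => [//|b s IH]; apply/allpairsP; exists (b, s); split=> //.
by case: b; rewrite !inE eqxx ?orbT.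
Qed.

Definition duads : seq (nat * nat) :=
  [:: (0, 1); (0, 2); (0, 3); (0, 4); (0, 5); (1, 2); (1, 3); (1, 4); (1, 5);
      (2, 3); (2, 4); (2, 5); (3, 4); (3, 5); (4, 5)]%N.

Definition disjoint_duads (d e : nat * nat) : bool := uniq [:: d.1; d.2; e.1; e.2].

Definition pairwise_disjoint (f : seq (nat * nat)) : bool :=
  all (fun d => all (fun e => (d == e) || disjoint_duads d e) f) f.

Definition skew_pairs : seq (seq (nat * nat)) :=
  [seq [:: d; e] | d <- duads, e <- [seq e <- duads | (d.1 < e.1)%N && disjoint_duads d e]].

Definition synthemes : seq (seq (nat * nat)) :=
  flatten [seq [seq rcons s e | e <- duads & (all (disjoint_duads e) s) && ((nth (0, 0) s 1).1 < e.1)] | s <- skew_pairs]%N.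

Definition sub_duads (P : pred (nat * nat)) := [seq d <- duads | P d].

(** A predicate matters only through the mask that it cuts out of the fifteen duads, so a property
    of all predicates is decided on 2^15 masks. *)
Lemma sub_duads_check (Q : pred (seq (nat * nat))) :
  all (fun m => Q (mask m duads)) (bool_seqs 15) -> forall P, Q (sub_duads P).
Proof.
move=> /allP h P; rewrite /sub_duads filter_mask; apply: h.
by rewrite (_ : 15%N = size (map P duads)) // mem_bool_seqs.
Qed.

(** At a point other than the six, the duads form a partial matching: two of them are a skew pair,
    three are a syntheme. The last two clauses say that a syntheme inside the matching fills it, and
    that a skew pair inside it either fills it or extends to a syntheme. *)
Definition matching_cases (f : seq (nat * nat)) : bool :=
  if ~~ pairwise_disjoint f then true else
   [&& (size f <= 3)%N, (size f == 2) ==> (f \in skew_pairs), (size f == 3) ==> (f \in synthemes),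
     all (fun s => all (mem f) s ==> (f == s)) synthemes &
     all (fun s => all (mem f) s ==> ((f == s) || (f \in synthemes))) skew_pairs].

Lemma matching_casesP P : matching_cases (sub_duads P).
Proof. by apply: sub_duads_check; vm_compute. Qed.

Lemma disj_check : all (fun d => all (fun e =>
  [&& (d.1 < d.2)%N, (d.2 < 6)%N & [|| d == e, disjoint_duads d e, (d.1 == e.1) && (d.2 != e.2),
   (d.1 == e.2) && (d.2 != e.1), (d.2 == e.1) && (d.1 != e.2) | (d.2 == e.2) && (d.1 != e.1)]]) duads) duads.
Proof. by vm_compute. Qed.

Arguments skew_pairs : simpl never.
Arguments synthemes : simpl never.

Section Arrangements.
Variable K : numFieldType.
Implicit Types (v : nat -> 'rV[K]_3) (n : 'rV[K]_3).

Definition general_position v : Prop := forall i j k, (i < 6)%N -> (j < 6)%N -> (k < 6)%N ->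
  i != j -> i != k -> j != k -> bracket (v i) (v j) (v k) != 0.

Definition duads_at v n := sub_duads (fun d => bracket (v d.1) (v d.2) n == 0).

Definition arrangement v : set (P2line K) := [set Ln (v i) | i in `I_6].

(** The Grassmann-Cayley meet of two lines: the combination of the two points of [e] that lies on
    the line [d]. *)
Definition meet_point v (d e : nat * nat) : 'rV[K]_3 :=
  bracket (v d.1) (v d.2) (v e.2) *: v e.1 - bracket (v d.1) (v d.2) (v e.1) *: v e.2.

Definition concurrent v (s : seq (nat * nat)) : bool :=
  if s is [:: d; e; f] then bracket (v f.1) (v f.2) (meet_point v d e) == 0 else false.

Lemma duad_lt d : d \in duads -> (d.1 < 6)%N /\ (d.2 < 6)%N /\ d.1 != d.2.
Proof.
move=> hd; have /allP/(_ _ hd)/and3P[h1 h2 _] := allP disj_check _ hd.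
by rewrite neq_ltn h1 h2 (ltn_trans h1 h2).
Qed.

Lemma exists_third_index i j : exists2 k, (k < 6)%N & (i != k) && (j != k).
Proof.
have [] : [\/ [&& i != 0, j != 0 & true], (i != 1) && (j != 1) | (i != 2) && (j != 2)]%N.
  by case: i j => [|[|[|i]]] [|[|[|j]]]; by [constructor 1|constructor 2|constructor 3].
- by case/and3P=> h1 h2 _; exists 0%N; rewrite // h1.
- by exists 1%N.
- by exists 2%N.
Qed.

Lemma duadP i j : (i < 6)%N -> (j < 6)%N -> i != j -> ((i, j) \in duads) || ((j, i) \in duads).
Proof. by case: i => [|[|[|[|[|[|i]]]]]] // _; case: j => [|[|[|[|[|[|j]]]]]]. Qed.

Section GPv.
Variable v : nat -> 'rV[K]_3.
Hypothesis gp : general_position v.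

Lemma gp_neq0 i : (i < 6)%N -> v i != 0.
Proof.
move=> hi; have [j hj /andP [ij _]] := exists_third_index i i; have [k hk /andP [ik jk]] := exists_third_index i j.
apply: contra (gp hi hj hk ij ik jk) => /eqP ->.
by apply/eqP; rewrite /bracket /dot /cross !vecE; ring.
Qed.

Lemma gp_cross i j : (i < 6)%N -> (j < 6)%N -> i != j -> cross (v i) (v j) != 0.
Proof.
move=> hi hj ij; have [k hk /andP [ik jk]] := exists_third_index i j.
apply: contra (gp hi hj hk ij ik jk) => /eqP e.
by apply/eqP; rewrite /bracket e /dot !vecE; ring.
Qed.

Lemma gp_inj i j c : (i < 6)%N -> (j < 6)%N -> v i = c *: v j -> i = j.
Proof.
move=> hi hj e; apply/eqP; apply/negPn/negP => ij; have := gp_cross hi hj ij.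
by rewrite e => /eqP []; apply: row3P; rewrite /cross !vecE; ring.
Qed.

Lemma gp_br0 i j k : (i < 6)%N -> (j < 6)%N -> (k < 6)%N -> i != j ->
  (bracket (v i) (v j) (v k) == 0) = (k == i) || (k == j).
Proof.
move=> hi hj hk ij; case: (eqVneq k i) => [->|ki]; first by rewrite bracket_uvu eqxx.
case: (eqVneq k j) => [->|kj]; first by rewrite bracket_uvv eqxx.
by apply/negbTE/gp; rewrite // eq_sym.
Qed.

Lemma mem_D n d : (d \in duads_at v n) = (d \in duads) && (bracket (v d.1) (v d.2) n == 0).
Proof. by rewrite mem_filter andbC. Qed.

Lemma duads_at_scale c n : c != 0 -> duads_at v (c *: n) = duads_at v n.
Proof. by move=> hc; apply: eq_filter => d; rewrite bracket_scale3 mulf_eq0 (negPf hc). Qed.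

Lemma duads_at_v m : (m < 6)%N -> duads_at v (v m) = sub_duads (fun d => (m == d.1) || (m == d.2)).
Proof.
move=> hm; apply: eq_in_filter => d /duad_lt [h1 [h2 h3]].
by rewrite gp_br0.
Qed.

(** Two duads at [n] that share exactly one index put [n] on two distinct lines through the same
    vector of the family, and [n] is then proportional to it. *)
Lemma duads_at_cases n : (exists2 m, (m < 6)%N & exists c, n = c *: v m) \/ pairwise_disjoint (duads_at v n).
Proof.
have [h|h] := pselect (exists2 m, (m < 6)%N & exists c, n = c *: v m); [by left|right].
have key x y z : (x < 6)%N -> (y < 6)%N -> (z < 6)%N -> x != y -> x != z -> y != z ->
    bracket (v x) (v y) n = 0 -> bracket (v x) (v z) n = 0 -> False.
  move=> hx hy hz xy xz yz h1 h2; apply: h; exists x => //.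
  by eexists; apply: (meet_prop (gp hx hy hz xy xz yz)).
apply/allP => d; rewrite mem_D => /andP [hd /eqP bd].
apply/allP => e; rewrite mem_D => /andP [he /eqP be].
have /allP/(_ _ he)/and3P[_ _] := allP disj_check _ hd.
have [d1 [d2 d12]] := duad_lt hd; have [f1 [f2 f12]] := duad_lt he.
have d21 : d.2 != d.1 by rewrite eq_sym.
have f21 : e.2 != e.1 by rewrite eq_sym.
have bd' : bracket (v d.2) (v d.1) n = 0 by rewrite bracket_swap bd oppr0.
have be' : bracket (v e.2) (v e.1) n = 0 by rewrite bracket_swap be oppr0.
case/or4P => [-> //|-> //|/andP [/eqP s t]|]; first by rewrite orbT.
  by case: (key d.1 d.2 e.2) => //; rewrite s.
case/or3P => /andP [/eqP s t].
- by case: (key d.1 d.2 e.1) => //; rewrite s.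
- by case: (key d.2 d.1 e.2) => //; rewrite s.
- by case: (key d.2 d.1 e.1) => //; rewrite s.
Qed.

Lemma duads_at_pd n d e : n != 0 -> d \in duads_at v n -> e \in duads_at v n -> disjoint_duads d e -> pairwise_disjoint (duads_at v n).
Proof.
move=> n0 hd he de; case: (duads_at_cases n) => // -[m hm [c ec]].
have c0 : c != 0 by apply: contra n0 => /eqP c0; rewrite ec c0 scale0r.
move: hd he; rewrite ec duads_at_scale // duads_at_v // !mem_filter => /andP [hd _] /andP [he _].
move: de; rewrite /disjoint_duads /= !inE.
by case/orP: hd => /eqP <-; case/orP: he => /eqP <-; rewrite eqxx ?orbT ?andbF.
Qed.


Lemma disjP d e : disjoint_duads d e ->
  [/\ d.1 != d.2, d.1 != e.1, d.1 != e.2, d.2 != e.1 & [/\ d.2 != e.2 & e.1 != e.2]].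
Proof.
by rewrite /disjoint_duads /= !inE !negb_or !andbT => /and3P [/and3P [h1 h2 h3] /andP [h4 h5] h6].
Qed.

Lemma meet_point_on d e : bracket (v d.1) (v d.2) (meet_point v d e) = 0 /\ bracket (v e.1) (v e.2) (meet_point v d e) = 0.
Proof. by split; rewrite /meet_point /bracket /dot /cross !vecE; ring. Qed.

Lemma meet_point_neq0 d e : d \in duads -> e \in duads -> disjoint_duads d e -> meet_point v d e != 0.
Proof.
move=> /duad_lt [d1 [d2 _]] /duad_lt [f1 [f2 _]] /disjP [h1 h2 h3 h4 [h5 h6]].
apply/eqP=> e0; have := bracketD3 (bracket (v d.1) (v d.2) (v e.2)) (- bracket (v d.1) (v d.2) (v e.1)) (v d.1) (v e.1) (v e.1) (v e.2).
rewrite scaleNr -/(meet_point v d e) e0 bracket_uvv mulr0 add0r => /eqP.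
rewrite (_ : bracket _ _ 0 = 0); last by rewrite /bracket /dot !vecE; ring.
by rewrite eq_sym mulf_eq0 oppr_eq0 (negPf (gp _ _ _ _ _ _)) // (negPf (gp _ _ _ _ _ _)).
Qed.

Lemma meet_point_uniq n d e : d \in duads -> e \in duads -> disjoint_duads d e ->
  bracket (v d.1) (v d.2) n = 0 -> bracket (v e.1) (v e.2) n = 0 -> exists c, n = c *: meet_point v d e.
Proof.
move=> /duad_lt [d1 [d2 _]] /duad_lt [f1 [f2 _]] /disjP [h1 h2 h3 h4 [h5 h6]] bd be.
have g1 := gp d1 f1 f2 h2 h3 h6; have g2 := gp d1 d2 f1 h1 h2 h4.
set A := v d.1 in bd g1 g2 *; set D' := v d.2 in bd g2 *; set B := v e.1 in be g1 g2 *; set E := v e.2 in be g1 *.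
have c1 : bracket A B E *: n = bracket A n E *: B + bracket A B n *: E.
  by rewrite (cramer A B E n) -(bracket_rot n B E) in be *; rewrite (_ : bracket n B E = 0) ?scale0r ?add0r // -be bracket_rot.
have c2 : bracket A n E * bracket A D' B + bracket A B n * bracket A D' E = 0.
  by rewrite -bracketD3 -c1 bracket_scale3 bd mulr0.
exists (- (bracket A B n / bracket A D' B / bracket A B E)).
apply: (scalerI g1); rewrite c1 /meet_point -/A -/D' -/B -/E.
have -> : bracket A n E = - (bracket A B n * bracket A D' E / bracket A D' B).
  by apply: (mulIf g2); rewrite mulNr divfK //; apply/eqP; rewrite -addr_eq0; apply/eqP.
apply: row3P; rewrite !vecE; field; by rewrite g1 g2.
Qed.

Lemma duads_at_npt d e : d \in duads -> e \in duads -> disjoint_duads d e ->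
  [/\ d \in duads_at v (meet_point v d e), e \in duads_at v (meet_point v d e) & pairwise_disjoint (duads_at v (meet_point v d e))].
Proof.
move=> hd he de; have [n1 n2] := meet_point_on d e.
have h1 : d \in duads_at v (meet_point v d e) by rewrite mem_D hd n1 eqxx.
have h2 : e \in duads_at v (meet_point v d e) by rewrite mem_D he n2 eqxx.
by split=> //; apply: (duads_at_pd _ h1 h2) => //; apply: meet_point_neq0.
Qed.

Lemma pd_D_cases n : pairwise_disjoint (duads_at v n) ->
  [/\ (size (duads_at v n) <= 3)%N, (size (duads_at v n) == 2)%N -> duads_at v n \in skew_pairs,
    (size (duads_at v n) == 3)%N -> duads_at v n \in synthemes,
    forall s, s \in synthemes -> {subset s <= duads_at v n} -> duads_at v n = s &
    forall s, s \in skew_pairs -> {subset s <= duads_at v n} -> duads_at v n = s \/ duads_at v n \in synthemes].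
Proof.
move=> hp; have := matching_casesP (fun d => bracket (v d.1) (v d.2) n == 0).
rewrite /matching_cases -/(duads_at v n) hp => /and5P [h1 /implyP h2 /implyP h3 /allP h4 /allP h5]; split=> // s hs sub;
  have hsub : all (mem (duads_at v n)) s by apply/allP.
  by have := h4 _ hs; rewrite hsub => /eqP.
by have := h5 _ hs; rewrite hsub => /orP [/eqP|]; [left|right].
Qed.

Lemma synthemeP s : s \in synthemes -> exists d e f, [/\ s = [:: d; e; f],
   d \in duads, e \in duads, f \in duads & disjoint_duads d e /\ [:: d; e] \in skew_pairs].
Proof.
move=> hs; have /allP /(_ s hs) : all (fun s => [&& size s == 3, all (mem duads) s,
  disjoint_duads (nth (0,0) s 0) (nth (0,0) s 1) & [:: nth (0,0) s 0; nth (0,0) s 1] \in skew_pairs])%N synthemes by vm_compute.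
case: s {hs} => [|d [|e [|f [|g s]]]] //= /and3P [/and4P [hd he hf _] de sk].
by exists d, e, f; split.
Qed.

Lemma skew_pairP s : s \in skew_pairs -> exists d e, [/\ s = [:: d; e],
   d \in duads, e \in duads & disjoint_duads d e].
Proof.
move=> hs; have /allP /(_ s hs) : all (fun s => [&& size s == 2, all (mem duads) s &
  disjoint_duads (nth (0,0) s 0) (nth (0,0) s 1)])%N skew_pairs by vm_compute.
case: s {hs} => [|d [|e [|g s]]] //= /andP [/and3P [hd he _] de].
by exists d, e; split.
Qed.

(** Only the first two duads are read, so the same formula gives the node of a skew pair. *)
Definition syntheme_point (s : seq (nat * nat)) := meet_point v (nth (0, 0) s 0)%N (nth (0, 0) s 1)%N.

Lemma duads_at_syntheme s : s \in synthemes -> concurrent v s -> duads_at v (syntheme_point s) = s.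
Proof.
move=> hs; have [d [e [f [es hd he hf [de _]]]]] := synthemeP hs; move: (hs); rewrite es => hs' cs.
have [h1 h2 /pd_D_cases [_ _ _ h3 _]] := duads_at_npt hd he de.
apply: h3 => // x; rewrite !inE => /or3P [] /eqP -> //.
by rewrite mem_D hf.
Qed.

Lemma syntheme_point_syntheme n : n != 0 -> size (duads_at v n) = 3%N ->
  [/\ duads_at v n \in synthemes, concurrent v (duads_at v n) & exists2 c, c != 0 & n = c *: syntheme_point (duads_at v n)].
Proof.
move=> n0 sz.
have hp : pairwise_disjoint (duads_at v n).
  case: (duads_at_cases n) => // -[m hm [c ec]].
  have c0 : c != 0 by apply: contra n0 => /eqP c0; rewrite ec c0 scale0r.
  move: sz; rewrite ec duads_at_scale // duads_at_v //.
  by case: m hm {ec} => [|[|[|[|[|[|m]]]]]].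
have [_ _ /(_ (introT eqP sz)) hs _ _] := pd_D_cases hp.
have [d [e [f [es hd he hf [de _]]]]] := synthemeP hs.
have : d \in duads_at v n by rewrite es !inE eqxx.
have : e \in duads_at v n by rewrite es !inE eqxx orbT.
have : f \in duads_at v n by rewrite es !inE eqxx !orbT.
rewrite !mem_D => /andP [_ /eqP bf] /andP [_ /eqP be] /andP [_ /eqP bd].
have [c ec] := meet_point_uniq hd he de bd be.
have c0 : c != 0 by apply: contra n0 => /eqP c0; rewrite ec c0 scale0r.
split=> //; last by exists c => //; rewrite es.
by rewrite es /=; apply/eqP; apply: (mulfI c0); rewrite -bracket_scale3 -ec bf mulr0.
Qed.

(** A further line through the meeting point would complete [s] to a concurrent syntheme. *)
Lemma duads_at_skew_pair s : s \in skew_pairs ->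
  ~~ has (fun t => all (mem t) s) [seq t <- synthemes | concurrent v t] -> duads_at v (syntheme_point s) = s.
Proof.
move=> hs; have [d [e [es hd he de]]] := skew_pairP hs.
have [h1 h2 hp] := duads_at_npt hd he de.
have [_ _ _ _ /(_ _ hs)] := pd_D_cases hp.
have sD : all (mem (duads_at v (meet_point v d e))) s by rewrite es /=; apply/and3P.
case=> [x /(allP sD) //|eD _|hD]; first by rewrite /syntheme_point es /= eD es.
move/negP; case; apply/hasP; exists (duads_at v (meet_point v d e)) => //.
rewrite mem_filter hD andbT.
have n0 := meet_point_neq0 hd he de.
have [|//] := syntheme_point_syntheme n0.
by have [d' [e' [f' [-> _ _ _ _]]]] := synthemeP hD.
Qed.

(** For the middle conclusion: a concurrent syntheme containing both duads would have its triple
    point at [n], where only two lines pass. *)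
Lemma syntheme_point_skew_pair n : n != 0 -> size (duads_at v n) = 2%N ->
  [/\ duads_at v n \in skew_pairs,
   ~~ has (fun t => all (mem t) (duads_at v n)) [seq t <- synthemes | concurrent v t]
   & exists2 c, c != 0 & n = c *: syntheme_point (duads_at v n)].
Proof.
move=> n0 sz.
have hp : pairwise_disjoint (duads_at v n).
  case: (duads_at_cases n) => // -[m hm [c ec]].
  have c0 : c != 0 by apply: contra n0 => /eqP c0; rewrite ec c0 scale0r.
  move: sz; rewrite ec duads_at_scale // duads_at_v //.
  by case: m hm {ec} => [|[|[|[|[|[|m]]]]]].
have [_ /(_ (introT eqP sz)) hs _ _ _] := pd_D_cases hp.
have [d [e [es hd he de]]] := skew_pairP hs.
have : d \in duads_at v n by rewrite es !inE eqxx.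
have : e \in duads_at v n by rewrite es !inE eqxx orbT.
rewrite !mem_D => /andP [_ /eqP be] /andP [_ /eqP bd].
have [c ec] := meet_point_uniq hd he de bd be.
have c0 : c != 0 by apply: contra n0 => /eqP c0; rewrite ec c0 scale0r.
have [eD' ex] : duads_at v n \in skew_pairs /\ exists2 c, c != 0 & n = c *: syntheme_point (duads_at v n).
  by split=> //; exists c => //; rewrite es.
split=> //.
apply/hasPn => t; rewrite mem_filter => /andP [ct ht].
have Dt := duads_at_syntheme ht ct.
have [d' [e' [f' [et hd' he' hf' [de' _]]]]] := synthemeP ht.
apply/negP; rewrite es /= => /and3P [dt et' _].
have : d \in duads_at v (syntheme_point t) by rewrite Dt.
have : e \in duads_at v (syntheme_point t) by rewrite Dt.
rewrite !mem_D => /andP [_ /eqP b1] /andP [_ /eqP b2].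
have [c' ec'] := meet_point_uniq hd he de b2 b1.
have c'0 : c' != 0.
  by apply: contra (meet_point_neq0 hd' he' de') => /eqP c0'; move: ec'; rewrite c0' scale0r et /syntheme_point /= => ->.
have e1 : duads_at v n = duads_at v (meet_point v d e) by rewrite ec; apply: duads_at_scale.
have e2 : duads_at v (syntheme_point t) = duads_at v (meet_point v d e) by rewrite ec'; apply: duads_at_scale.
by move: sz; rewrite e1 -e2 Dt et.
Qed.

End GPv.
End Arrangements.

(** * Singularities of the fifteen joining lines *)

Section Counting.
Variable K : numFieldType.
Implicit Types (v : nat -> 'rV[K]_3) (n : 'rV[K]_3).

(** If the lines agree, the ends of [e] lie on the line [d], and general position makes them ends of
    [d]. *)
Lemma cross_inj_duads v d e : general_position v -> d \in duads -> e \in duads ->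
  (exists c, cross (v d.1) (v d.2) = c *: cross (v e.1) (v e.2)) -> d = e.
Proof.
move=> gp hd he [c ec]; have [d1 [d2 d12]] := duad_lt hd; have [f1 [f2 f12]] := duad_lt he.
have h n : bracket (v e.1) (v e.2) n = 0 -> bracket (v d.1) (v d.2) n = 0.
  by rewrite /bracket ec dotZl => ->; rewrite mulr0.
have : (e.1 == d.1) || (e.1 == d.2) by rewrite -(gp_br0 gp) // h // bracket_uvu.
have : (e.2 == d.1) || (e.2 == d.2) by rewrite -(gp_br0 gp) // h // bracket_uvv.
have /allP/(_ _ he)/and3P[l1 _ _] := allP disj_check _ hd.
have /allP/(_ _ hd)/and3P[l2 _ _] := allP disj_check _ he.
move: f12 l1 l2 {hd he h ec d1 d2 f1 f2}; case: d d12 => a b; case: e => a' b' /= ab ab' lt lt'.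
by move=> /orP [] /eqP e2 /orP [] /eqP e1; subst; rewrite ?eqxx // in ab ab' lt lt' *; lia.
Qed.

Lemma dual_pointsE v : (forall i, (i < 6)%N -> v i != 0) ->
  dual_points (arrangement v) = [set Pt (v i) | i in `I_6].
Proof.
move=> v0; apply/seteqP; split=> p.
  case=> l [i hi <-]; have [n n0 ->] := PtP p => /dual_pairE h.
  by exists i => //; rewrite h // v0.
by case=> i hi <-; exists (Ln (v i)); [exists i|apply/dual_pairE; rewrite ?v0].
Qed.


Lemma card_enum (T : Type) (x0 : T) m (A : set T) : A #= `I_m ->
  exists f : nat -> T, A = f @` `I_m /\ {in `I_m &, injective f}.
Proof.
elim: m A => [|m IH] A hA.
  exists (fun=> x0); split; last by move=> i j /set_mem.
  by move: hA; rewrite II0 card_eq0 image_set0 => /eqP.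
case/eq_cardSP: hA => x Ax /IH [f [eA fi]].
have nx i : (i < m)%N -> f i <> x.
  by move=> hi e; have : (A `\ x) (f i) by [rewrite eA; exists i]; case=> _; apply.
exists (fun i => if i == m then x else f i); split.
  apply/seteqP; split=> y.
    move=> Ay; have [->|yx] := pselect (y = x); first by exists m; rewrite /= ?eqxx.
    have : (A `\ x) y by [].
    rewrite eA => -[i hi <-]; exists i => /=; first exact: ltnW.
    by rewrite ltn_eqF.
  case=> i /=; rewrite ltnS leq_eqVlt; case: eqP => [_ _ <- //|_ /= hi <-].
  by have : (A `\ x) (f i) by [rewrite eA; exists i]; case.
move=> i j /set_mem /= hi /set_mem /= hj.
case: (eqVneq i m) => [->|im]; case: (eqVneq j m) => [-> //|jm] e.
- by case: (nx j) => //; rewrite ltn_neqAle jm.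
- by case: (nx i) => //; rewrite ltn_neqAle im.
- by apply: fi => //; apply/mem_set; rewrite /= ltn_neqAle ?im ?jm.
Qed.

Lemma card_le2P (T : Type) (A : set T) :
  `I_2 #<= A <-> exists x y, [/\ A x, A y & x <> y].
Proof.
split.
  move=> /card_leP[f].
  pose a : set_type `I_2 := SigSub (mem_set (isT : `I_2 0%N)).
  pose b : set_type `I_2 := SigSub (mem_set (isT : `I_2 1%N)).
  exists (val (f a)), (val (f b)); split; try by apply: set_mem; apply: valP.
  move/val_inj => e.
  have : a = b by apply: (@inj _ _ _ f) => //; apply: mem_set.
  by move/(congr1 val).
case=> x [y [ax ay xy]]; pose g (b : bool) := if b then x else y.
have sub : g @` setT `<=` A by move=> _ [[] _ <-].
apply: card_le_trans (subset_card_le sub).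
have [||_ ->] // := @card_seq _ _ [:: true; false] g (g @` setT) 2 isT.
  by move=> [] [] _ _ //= e; case: xy.
by move=> z; split => [[b _ <-]|[b _ ->]]; exists b; case: b.
Qed.

Section GPv.
Variable v : nat -> 'rV[K]_3.
Hypothesis gp : general_position v.

Let v0 i : (i < 6)%N -> v i != 0 := fun hi => gp_neq0 gp hi.

Definition join_line (d : nat * nat) := cross (v d.1) (v d.2).

Lemma cr_neq0 d : d \in duads -> join_line d != 0.
Proof. by case/duad_lt => h1 [h2 h3]; apply: gp_cross. Qed.

Let L := lines_atleast 2 (dual_points (arrangement v)).

Lemma linesE : L = [set Ln (join_line d) | d in [set` duads]].
Proof.
rewrite /L dual_pointsE //; apply/seteqP; split=> l.
  have [n n0 ->] := LnP l.
  case/card_le2P => p [q [[[i hi <-] pl] [[j hj <-] ql] pq]].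
  have ij : i != j by apply: contra_notN pq => /eqP ->.
  have [c ec] : exists c, n = c *: cross (v i) (v j).
    apply: cross_of_on; first exact: gp_cross.
      by apply/eqP; rewrite -on_lineE ?v0.
    by apply/eqP; rewrite -on_lineE ?v0.
  have c0 : c != 0 by apply: contra n0 => /eqP c0; rewrite ec c0 scale0r.
  have [h|h] := orP (duadP hi hj ij); first by exists (i, j) => //; rewrite ec Ln_scale.
  (* Reversing a duad changes the sign of the cross product, hence the factor -1. *)
  exists (j, i) => //; rewrite ec Ln_scale // -[in RHS](@Ln_scale _ (-1)) ?oppr_eq0 ?oner_eq0 //.
  congr Ln; rewrite /join_line; apply: row3P; rewrite /cross !vecE; ring.
case=> d hd <-; apply/card_le2P; have [d1 [d2 d12]] := duad_lt hd.
exists (Pt (v d.1)), (Pt (v d.2)); split.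
- by split; [exists d.1|rewrite /= on_lineE ?v0 ?cr_neq0 // dotC -/(bracket _ _ _) bracket_uvu].
- by split; [exists d.2|rewrite /= on_lineE ?v0 ?cr_neq0 // dotC -/(bracket _ _ _) bracket_uvv].
- by case/Pt_inj; rewrite ?v0 // => c _ /(gp_inj gp d1 d2) e; rewrite e eqxx in d12.
Qed.

Lemma Ln_cr_inj : {in duads &, injective (fun d => Ln (join_line d))}.
Proof.
move=> d e hd he /Ln_inj [||c _ ec]; rewrite ?cr_neq0 //.
by apply: (cross_inj_duads gp hd he); exists c.
Qed.
Lemma Pt_cr_inj : {in duads &, injective (fun d => Pt (join_line d))}.
Proof.
move=> d e hd he /Pt_inj [||c _ ec]; rewrite ?cr_neq0 //.
by apply: (cross_inj_duads gp hd he); exists c.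
Qed.

Lemma uniq_D n : uniq (duads_at v n).
Proof. by rewrite filter_uniq. Qed.

Lemma duads_at_duads n d : d \in duads_at v n -> d \in duads.
Proof. by rewrite mem_D => /andP []. Qed.

Lemma points_L n k : n != 0 -> (points_exactly k L (Pt n) <-> size (duads_at v n) = k)
   /\ (points_atleast k L (Pt n) <-> (k <= size (duads_at v n))%N).
Proof.
move=> n0; rewrite /points_exactly /points_atleast /=.
have [||h1 h2] := @card_seq _ _ (duads_at v n) (fun d => Ln (join_line d)) (L `&` [set l | on_line (Pt n) l]) k (uniq_D n).
- by move=> d e /duads_at_duads hd /duads_at_duads he; apply: Ln_cr_inj.
- move=> l; rewrite linesE; split.
    case=> -[d hd <-]; rewrite /= on_lineE ?cr_neq0 // dotC => h.
    by exists d => //; rewrite mem_D hd.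
  case=> d; rewrite mem_D => /andP [hd h] ->; split; first by exists d.
  by rewrite /= on_lineE ?cr_neq0 // dotC.
by rewrite h1 h2; split; split=> // /eqP.
Qed.

Definition lines_at n := [seq i <- iota 0 6 | dot (v i) n == 0].

End GPv.

Lemma points_arrangement v n k : (forall i, (i < 6)%N -> v i != 0) ->
  {in `I_6 &, injective (fun i => Ln (v i))} -> n != 0 ->
  (points_exactly k (arrangement v) (Pt n) <-> size (lines_at v n) = k)
   /\ (points_atleast k (arrangement v) (Pt n) <-> (k <= size (lines_at v n))%N).
Proof.
move=> v0 vi n0; rewrite /points_exactly /points_atleast /=.
have [|||h1 h2] := @card_seq _ _ (lines_at v n) (fun i => Ln (v i)) (arrangement v `&` [set l | on_line (Pt n) l]) k.
- by rewrite filter_uniq ?iota_uniq.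
- move=> i j; rewrite !mem_filter !mem_iota => /andP [_ hi] /andP [_ hj].
  by apply: vi; apply/mem_set.
- move=> l; split.
    case=> -[i hi <-]; rewrite /= on_lineE ?v0 // dotC => h.
    by exists i => //; rewrite mem_filter h mem_iota.
  case=> i; rewrite mem_filter mem_iota => /andP [h hi] ->; split; first by exists i.
  by rewrite /= on_lineE ?v0 // dotC.
by rewrite h1 h2; split; split=> // /eqP.
Qed.

Section GPw.
Variable v : nat -> 'rV[K]_3.
Hypothesis gp : general_position v.

Let v0 i : (i < 6)%N -> v i != 0 := fun hi => gp_neq0 gp hi.
Let L := lines_atleast 2 (dual_points (arrangement v)).
Notation join_line := (join_line v).

Lemma Ln_v_inj : {in `I_6 &, injective (fun i => Ln (v i))}.
Proof.
move=> i j /set_mem hi /set_mem hj /Ln_inj [||c _]; rewrite ?v0 //.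
exact: (gp_inj gp).
Qed.

Lemma Pt_v_inj : {in iota 0 6 &, injective (fun i => Pt (v i))}.
Proof.
move=> i j; rewrite !mem_iota => hi hj /Pt_inj [||c _]; rewrite ?v0 //.
exact: (gp_inj gp).
Qed.

Lemma lines_at_cr d : d \in duads -> size (lines_at v (join_line d)) = 2%N.
Proof.
move=> hd; have [d1 [d2 d12]] := duad_lt hd.
have -> : lines_at v (join_line d) = [seq i <- iota 0 6 | (i == d.1) || (i == d.2)].
  by apply: eq_in_filter => i; rewrite mem_iota => hi; rewrite dotC -/(bracket _ _ _) gp_br0.
by apply/eqP; move: d hd {d1 d2 d12}; apply/allP; vm_compute.
Qed.

Lemma lines_at_ge2 n : n != 0 -> (2 <= size (lines_at v n))%N ->
  exists2 d, d \in duads & exists2 c, c != 0 & n = c *: join_line d.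
Proof.
move=> n0; have uE : uniq (lines_at v n) by rewrite filter_uniq ?iota_uniq.
have mE i : i \in lines_at v n -> (i < 6)%N /\ dot (v i) n = 0.
  by rewrite mem_filter mem_iota => /andP [/eqP].
case eE : (lines_at v n) => [|i [|j s]] // _.
have [hi ni] : (i < 6)%N /\ dot (v i) n = 0 by apply: mE; rewrite eE inE eqxx.
have [hj nj] : (j < 6)%N /\ dot (v j) n = 0 by apply: mE; rewrite eE !inE eqxx orbT.
have ij : i != j by move: uE; rewrite eE /= inE negb_or => /andP [/andP []].
have key a b : dot (v a) n = 0 -> dot (v b) n = 0 -> (a, b) \in duads ->
    exists2 d, d \in duads & exists2 c, c != 0 & n = c *: join_line d.
  move=> ha hb hab; exists (a, b) => //.
  have [|c ec] := cross_of_on _ ha hb; first exact: (cr_neq0 gp hab).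
  by exists c => //; apply: contra n0 => /eqP c0; rewrite ec c0 scale0r.
by have [h|h] := orP (duadP hi hj ij); [apply: (key i j)|apply: (key j i)].
Qed.

Lemma double_points : points_exactly 2 (arrangement v) = [set Pt (join_line d) | d in [set` duads]].
Proof.
apply/seteqP; split=> p.
  have [n n0 ->] := PtP p; case: (points_arrangement 2 v0 Ln_v_inj n0) => h _ /h e.
  have [|d hd [c c0 ->]] := lines_at_ge2 n0; first by rewrite e.
  by exists d; rewrite ?Pt_scale.
case=> d hd <-; apply/(points_arrangement 2 v0 Ln_v_inj (cr_neq0 gp hd)).1.
exact: lines_at_cr.
Qed.

Lemma no_triple : points_atleast 2 (arrangement v) = points_exactly 2 (arrangement v).
Proof.
rewrite double_points; apply/seteqP; split=> p.
  have [n n0 ->] := PtP p; case: (points_arrangement 2 v0 Ln_v_inj n0) => _ h /h e.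
  have [//|d hd [c c0 ->]] := lines_at_ge2 n0.
  by exists d; rewrite ?Pt_scale.
case=> d hd <-; apply/(points_arrangement 2 v0 Ln_v_inj (cr_neq0 gp hd)).2.
by rewrite lines_at_cr.
Qed.

(** The double point of two lines of the arrangement and the line joining their normals have the
    same coordinates [join_line d]. So the double point lies on the line with normal [n] exactly
    when the joining line passes through the point [n]: [Lambda23] is dual to taking triple
    points. *)
Lemma mem_Lambda n : n != 0 -> Lambda23 (arrangement v) (Ln n) <-> size (duads_at v n) = 3%N.
Proof.
move=> n0; rewrite /Lambda23 /lines_exactly /=.
have [||h _] := @card_seq _ _ (duads_at v n) (fun d => Pt (join_line d))
   (points_exactly 2 (arrangement v) `&` [set p | on_line p (Ln n)]) 3 (uniq_D v n).
- by move=> d e /duads_at_duads hd /duads_at_duads he; apply: (Pt_cr_inj gp).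
- move=> l; rewrite double_points; split.
    case=> -[d hd <-]; rewrite /= on_lineE ?(cr_neq0 gp) // => h.
    by exists d => //; rewrite mem_D hd.
  case=> d; rewrite mem_D => /andP [hd h] ->; split; first by exists d.
  by rewrite /= on_lineE ?(cr_neq0 gp).
by rewrite h; split=> /eqP.
Qed.

Definition concurrent_synthemes := [seq s <- synthemes | concurrent v s].

Lemma syntheme_point_neq0 s : s \in synthemes -> syntheme_point v s != 0.
Proof.
by move=> /synthemeP [d [e [f [-> hd he _ [de _]]]]]; apply: (meet_point_neq0 gp hd he de).
Qed.

Lemma Lambda_arrangement : Lambda23 (arrangement v) = [set Ln (syntheme_point v s) | s in [set` concurrent_synthemes]].
Proof.
apply/seteqP; split=> l.
  have [n n0 ->] := LnP l; move/(mem_Lambda n0) => /(syntheme_point_syntheme gp n0) [h1 h2 [c c0 ec]].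
  exists (duads_at v n); first by rewrite /= mem_filter h2.
  by rewrite [in RHS]ec Ln_scale.
case=> s; rewrite /= mem_filter => /andP [cs hs] <-.
apply/mem_Lambda; rewrite ?syntheme_point_neq0 // duads_at_syntheme //.
by have [d [e [f [-> _ _ _ _]]]] := synthemeP hs.
Qed.

Lemma size_syntheme s : s \in synthemes -> size s = 3%N.
Proof. by case/synthemeP => d [e [f [-> _ _ _ _]]]. Qed.

Lemma triple_points : points_exactly 3 L = [set Pt (syntheme_point v s) | s in [set` concurrent_synthemes]].
Proof.
apply/seteqP; split=> l.
  have [n n0 ->] := PtP l; move/(points_L gp 3 n0).1 => /(syntheme_point_syntheme gp n0) [h1 h2 [c c0 ec]].
  exists (duads_at v n); first by rewrite /= mem_filter h2.
  by rewrite [in RHS]ec Pt_scale.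
case=> s; rewrite /= mem_filter => /andP [cs hs] <-.
apply/(points_L gp _ (syntheme_point_neq0 hs)).1; rewrite duads_at_syntheme //.
exact: size_syntheme.
Qed.

Lemma card_triple k : (points_exactly 3 L #= `I_k) = (size concurrent_synthemes == k).
Proof.
apply: (fun a b c d => (@card_seq _ _ concurrent_synthemes (fun s => Pt (syntheme_point v s)) _ k a b c).1) => //.
- by rewrite filter_uniq.
- move=> s t; rewrite !mem_filter => /andP [cs hs] /andP [ct ht].
  case/Pt_inj; rewrite ?syntheme_point_neq0 // => c c0 e.
  by rewrite -(duads_at_syntheme gp hs cs) e duads_at_scale // duads_at_syntheme.
- move=> p; rewrite triple_points; split; first by case=> s hs <-; exists s.
  by case=> s hs ->; exists s.
Qed.

(** There are 45 skew pairs. A concurrent syntheme absorbs three of them and distinct synthemes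
    share none, so six concurrent synthemes leave 27 nodes. *)
Definition node_pairs := [seq s <- skew_pairs | ~~ has (fun t => all (mem t) s) concurrent_synthemes].

Lemma syntheme_point_neq0' s : s \in skew_pairs -> syntheme_point v s != 0.
Proof.
by move=> /skew_pairP [d [e [-> hd he de]]]; apply: (meet_point_neq0 gp hd he de).
Qed.

Lemma card_nodes k : (points_exactly 2 L #= `I_k) = (size node_pairs == k).
Proof.
apply: (fun a b c => (@card_seq _ _ node_pairs (fun s => Pt (syntheme_point v s)) _ k a b c).1).
- by rewrite filter_uniq.
- move=> s t; rewrite !mem_filter => /andP [cs hs] /andP [ct ht].
  case/Pt_inj; rewrite ?syntheme_point_neq0' // => c c0 e.
  by rewrite -(duads_at_skew_pair gp hs cs) e duads_at_scale // duads_at_skew_pair.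
- move=> p; split.
    have [n n0 ->] := PtP p; move/(points_L gp 2 n0).1 => /(syntheme_point_skew_pair gp n0) [h1 h2 [c c0 ec]].
    exists (duads_at v n); first by rewrite mem_filter h2.
    by rewrite [in LHS]ec Pt_scale.
  case=> s; rewrite mem_filter => /andP [cs hs] ->.
  apply/(points_L gp _ (syntheme_point_neq0' hs)).1; rewrite duads_at_skew_pair //.
  by have [d [e [-> _ _ _]]] := skew_pairP hs.
Qed.

Lemma size_D_v m : (m < 6)%N -> size (duads_at v (v m)) = 5%N.
Proof. by move=> hm; rewrite duads_at_v //; case: m hm => [|[|[|[|[|[|m]]]]]]. Qed.

Lemma size_D n : (exists2 m, (m < 6)%N & exists2 c, c != 0 & n = c *: v m) \/ n = 0 \/ (size (duads_at v n) <= 3)%N.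
Proof.
have [->|n0] := eqVneq n 0; first by right; left.
case: (duads_at_cases gp n) => [[m hm [c ec]]|/(pd_D_cases) [h _ _ _ _]]; last by right; right.
by left; exists m => //; exists c => //; apply: contra n0 => /eqP c0; rewrite ec c0 scale0r.
Qed.

Lemma five_points : points_exactly 5 L = [set Pt (v i) | i in `I_6].
Proof.
apply/seteqP; split=> p.
  have [n n0 ->] := PtP p; move/(points_L gp 5 n0).1 => h.
  case: (size_D n) => [[m hm [c c0 ->]]|[e|]]; last by rewrite h.
    by exists m; rewrite ?Pt_scale.
  by rewrite e eqxx in n0.
case=> i hi <-; apply/(points_L gp _ (v0 hi)).1; exact: size_D_v.
Qed.

Lemma points_L_cases : points_atleast 2 L =
  points_exactly 2 L `|` points_exactly 3 L `|` points_exactly 5 L.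
Proof.
apply/seteqP; split=> p; have [n n0 ->] := PtP p.
  move/(points_L gp 2 n0).2 => h2.
  case: (size_D n) => [[m hm [c c0 e]]|[e|h3]].
  - by right; apply/(points_L gp _ n0).1; rewrite e duads_at_scale // size_D_v.
  - by rewrite e eqxx in n0.
  - left; have : size (duads_at v n) = 2%N \/ size (duads_at v n) = 3%N by lia.
    by case=> e; [left|right]; apply/(points_L gp _ n0).1.
move=> h; apply/(points_L gp 2 n0).2.
by case: h => [[|]|] /(points_L gp _ n0).1 ->.
Qed.

(** General position already gives the fifteen double points and makes the six dual points the
    5-points. What remains is the number of triple points, the number of nodes and the conic. *)
Lemma unassuming_arrangement : size concurrent_synthemes = 6%N -> size node_pairs = 27%N ->
  ~ on_a_conic [set Pt (v i) | i in `I_6] -> unassuming (arrangement v).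
Proof.
move=> h6 h27 nc; split.
- apply: inj_card_eq; exact: Ln_v_inj.
- have [||-> _] // := @card_seq _ _ duads (fun d => Pt (join_line d)) (points_exactly 2 (arrangement v)) 15 isT.
    exact: (Pt_cr_inj gp).
  by move=> p; rewrite double_points; split=> -[d hd]; [move=> <- | move=> ->]; exists d.
- exact: no_triple.
- split; rewrite -?/L.
  + by rewrite card_nodes h27.
  + by rewrite card_triple h6.
  + have [||-> _] // := @card_seq _ _ (iota 0 6) (fun d => Pt (v d)) (points_exactly 5 L) 6 (iota_uniq _ _).
      exact: Pt_v_inj.
    move=> p; rewrite five_points; split=> -[d hd]; [move=> <- | move=> ->]; exists d => //; first by rewrite mem_iota.
      by move: hd; rewrite mem_iota.
  + exact: points_L_cases.
  + by rewrite five_points.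
Qed.

End GPw.

(** A vanishing bracket would put three of the six lines through one point, although all
    singularities are double. In general position the triple points are then counted by the
    concurrent synthemes. *)
Lemma unassumingP (C : set (P2line K)) : unassuming C ->
  exists v, [/\ C = arrangement v, general_position v & size (concurrent_synthemes v) = 6%N].
Proof.
case=> c6 _ h2 hL.
have [f [eC fi]] := card_enum (Ln (e0 K)) c6.
pose v i := s2val (cid2 (LnP (f i))).
have v0 i : v i != 0 by exact: (s2valP (cid2 (LnP (f i)))).
have fv i : f i = Ln (v i) by exact: (s2valP' (cid2 (LnP (f i)))).
have eA : C = arrangement v.
  by rewrite eC; apply/seteqP; split=> l [i hi <-]; exists i; rewrite // fv.
have vi : {in `I_6 &, injective (fun i => Ln (v i))}.
  by move=> i j hi hj; rewrite -!fv; apply: fi.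
have gp : general_position v.
  move=> i j k hi hj hk ij ik jk; apply/eqP => b0.
  set n := cross (v i) (v j).
  have n0 : n != 0.
    apply/eqP => /(cross_eq0 (v0 i)) [c ec].
    have c0 : c != 0 by apply: contra (v0 j) => /eqP c0; rewrite ec c0 scale0r.
    have : j = i by apply: vi; rewrite ?inE // ec Ln_scale.
    by move/eqP: ij => ij e; apply: ij.
  have [P1 P2] := points_arrangement 2 (fun i _ => v0 i) vi n0.
  have s3 : {subset [:: i; j; k] <= lines_at v n}.
    move=> x; rewrite !inE mem_filter mem_iota.
    by case/or3P => /eqP ->; rewrite dotC -/(bracket _ _ _) ?bracket_uvu ?bracket_uvv ?b0 ?eqxx.
  have u3 : uniq [:: i; j; k] by rewrite /= !inE negb_or ij ik jk.
  have sz := uniq_leq_size u3 s3.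
  have : points_atleast 2 C (Pt n) by rewrite eA; apply/P2; apply: ltnW.
  by rewrite h2 eA => /P1 e; rewrite e in sz.
exists v; split=> //; apply/eqP.
by rewrite -(card_triple gp); case: hL => _ + _ _ _; rewrite eA.
Qed.

End Counting.

(** * Classification of the sets of concurrent synthemes *)

Definition sort_duad (d : nat * nat) : nat * nat := if (d.1 < d.2)%N then d else (d.2, d.1).
Definition sort_two (d e : nat * nat) := if (d.1 < e.1)%N then (d, e) else (e, d).

(** Relabelling spoils the order inside a syntheme. Each duad is sorted, then a network of three
    comparisons sorts the duads, so that the result can be looked up in [synthemes]. *)
Definition canon (s : seq (nat * nat)) : seq (nat * nat) :=
  if s is [:: d; e; f] then
    let: (d, e) := sort_two (sort_duad d) (sort_duad e) in let: (e, f) := sort_two e (sort_duad f) in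
    let: (d, e) := sort_two d e in [:: d; e; f]
  else s.

Definition relabel (p : seq nat) (d : nat * nat) := (nth 0 p d.1, nth 0 p d.2)%N.

Definition relabeled_indices (p : seq nat) : seq nat :=
  [seq index (canon (map (relabel p) s)) synthemes | s <- synthemes].

(** The three cyclic perfect matchings between [0, 1, 2] and [3, 4, 5], moved by [p] and stored as
    positions in [synthemes]. As [p] varies, every bipartition and both parities occur. *)
Definition pappus_triple (p : seq nat) : nat * nat * nat :=
  let r s := index (canon (map (relabel p) s)) synthemes in
  (r [:: (0, 3); (1, 4); (2, 5)], r [:: (0, 4); (1, 5); (2, 3)], r [:: (0, 5); (1, 3); (2, 4)])%N.

Definition perms6 := permutations (iota 0 6).

Definition two_imply (b : seq bool) (t : nat * nat * nat) : bool :=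
  let b1 := nth false b t.1.1 in let b2 := nth false b t.1.2 in let b3 := nth false b t.2 in
  [&& b1 && b2 ==> b3, b1 && b3 ==> b2 & b2 && b3 ==> b1].

(** The fixed syntheme is [01 | 23 | 45]; each of its three duads occurs twice. *)
Definition octa_synthemes : seq (seq (nat * nat)) :=
  [:: [:: (0, 1); (2, 4); (3, 5)]; [:: (0, 1); (2, 5); (3, 4)]; [:: (0, 2); (1, 3); (4, 5)];
      [:: (0, 3); (1, 2); (4, 5)]; [:: (0, 4); (1, 5); (2, 3)]; [:: (0, 5); (1, 4); (2, 3)]]%N.

Definition bip_synthemes : seq (seq (nat * nat)) :=
  [seq s <- synthemes | all (fun d => (d.1 < 3 <= d.2)%N) s].

Definition pappus_triples := undup [seq pappus_triple p | p <- perms6].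
Definition relabeled_tables := [seq relabeled_indices p | p <- perms6].
Definition octa_bits := [seq s \in octa_synthemes | s <- synthemes].
Definition bip_bits := [seq s \in bip_synthemes | s <- synthemes].

Definition two_types (b : seq bool) : bool :=
  has (fun x => let y := [seq nth false b i | i <- x] in (y == octa_bits) || (y == bip_bits)) relabeled_tables.

(* The 2^15 sets of synthemes are enumerated. *)
Lemma classify_check :
  all (fun b => if count id b == 6%N then if all (two_imply b) pappus_triples then two_types b
                else true else true) (bool_seqs 15).
Proof. by vm_compute. Qed.

Lemma classify_bits b : b \in bool_seqs 15 -> count id b = 6%N ->
  all (two_imply b) pappus_triples -> two_types b.
Proof. by move=> hb /eqP hc ha; have := allP classify_check b hb; rewrite hc ha. Qed.

Lemma sidx_check : all (fun p => all (fun s => canon (map (relabel p) s) \in synthemes) synthemes) perms6.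
Proof. by vm_compute. Qed.

Lemma pappus_check : all (fun p => all (fun s => canon (map (relabel p) s) \in synthemes)
  [:: [:: (0, 3); (1, 4); (2, 5)]; [:: (0, 4); (1, 5); (2, 3)]; [:: (0, 5); (1, 3); (2, 4)]]%N) perms6.
Proof. by vm_compute. Qed.

(** * Pappus' relation and the classification up to relabelling *)

Section Classify.
Variable K : numFieldType.
Implicit Types v : nat -> 'rV[K]_3.

(** The scalar whose vanishing [concurrent] tests. It is alternating in the three duads and in the
    two ends of each duad, so sorting a syntheme only changes its sign. *)
Definition concurrency v (d e f : nat * nat) : K := bracket (v f.1) (v f.2) (meet_point v d e).

Lemma concurrencyC12 v d e f : concurrency v e d f = - concurrency v d e f.
Proof. by rewrite /concurrency /meet_point /bracket /dot /cross !vecE; ring. Qed.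
Lemma concurrencyC23 v d e f : concurrency v d f e = - concurrency v d e f.
Proof. by rewrite /concurrency /meet_point /bracket /dot /cross !vecE; ring. Qed.
Lemma concurrency_sw1 v a b e f : concurrency v (b, a) e f = - concurrency v (a, b) e f.
Proof. by rewrite /concurrency /meet_point /bracket /dot /cross !vecE /=; ring. Qed.
Lemma concurrency_sw2 v a b d f : concurrency v d (b, a) f = - concurrency v d (a, b) f.
Proof. by rewrite /concurrency /meet_point /bracket /dot /cross !vecE /=; ring. Qed.
Lemma concurrency_sw3 v a b d e : concurrency v d e (b, a) = - concurrency v d e (a, b).
Proof. by rewrite /concurrency /meet_point /bracket /dot /cross !vecE /=; ring. Qed.

(** Pappus' theorem as a polynomial identity: since the three expressions sum to zero, any two
    vanishing ones force the third to vanish. *)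
Lemma pappus v a b c a' b' c' :
  concurrency v (a, a') (b, b') (c, c') + concurrency v (a, b') (b, c') (c, a') + concurrency v (a, c') (b, a') (c, b') = 0.
Proof. by rewrite /concurrency /meet_point /bracket /dot /cross !vecE /=; ring. Qed.

Lemma conc_canon v s : concurrent v (canon s) = concurrent v s.
Proof.
case: s => [|d [|e [|f [|g s]]]] //.
have swd x : sort_duad x = x \/ sort_duad x = (x.2, x.1) by rewrite /sort_duad; case: ifP; [left|right].
have h : (concurrency v (sort_duad d) (sort_duad e) (sort_duad f) == 0) = (concurrency v d e f == 0).
  have -> : (concurrency v (sort_duad d) (sort_duad e) (sort_duad f) == 0) = (concurrency v d (sort_duad e) (sort_duad f) == 0).
    by case: (swd d) => -> //; case: d => a b; rewrite concurrency_sw1 oppr_eq0.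
  have -> : (concurrency v d (sort_duad e) (sort_duad f) == 0) = (concurrency v d e (sort_duad f) == 0).
    by case: (swd e) => -> //; case: e => a b; rewrite concurrency_sw2 oppr_eq0.
  by case: (swd f) => -> //; case: f => a b; rewrite concurrency_sw3 oppr_eq0.
rewrite [RHS](_ : _ = (concurrency v d e f == 0)) // -h /canon.
move: (sort_duad d) (sort_duad e) (sort_duad f) => {h swd d e f} d e f.
have C12 x y z : concurrent v [:: y; x; z] = concurrent v [:: x; y; z].
  by rewrite /concurrent -/(concurrency v y x z) concurrencyC12 oppr_eq0.
have C23 x y z : concurrent v [:: x; z; y] = concurrent v [:: x; y; z].
  by rewrite /concurrent -/(concurrency v x z y) concurrencyC23 oppr_eq0.
have C31 : concurrent v [:: e; f; d] = concurrent v [:: d; e; f] by rewrite C23 C12.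
have C13 : concurrent v [:: f; d; e] = concurrent v [:: d; e; f] by rewrite C12 C23.
have C321 : concurrent v [:: f; e; d] = concurrent v [:: d; e; f] by rewrite C12 C31.
by rewrite /sort_two; case: ifP => _; case: ifP => _; case: ifP => _;
  by [apply: C31|apply: C13|apply: C321|apply: C12|apply: C23|].
Qed.

Lemma conc_relab v p s : s \in synthemes -> concurrent (fun i => v (nth 0%N p i)) s = concurrent v (map (relabel p) s).
Proof. by case/synthemeP => d [e [f [-> _ _ _ _]]]. Qed.

Lemma nth_perms6 p i : p \in perms6 -> (i < 6)%N -> (nth 0 p i < 6)%N.
Proof.
rewrite mem_permutations => pp hi; have sp := perm_size pp.
by have := perm_mem pp (nth 0%N p i); rewrite mem_nth ?sp // mem_iota => /esym.
Qed.

Lemma arrangement_perm v p : p \in perms6 -> arrangement (fun i => v (nth 0%N p i)) = arrangement v.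
Proof.
move=> hp; apply/seteqP; split=> l [i hi <-]; first by exists (nth 0 p i)%N => //; apply: nth_perms6.
move: hp; rewrite mem_permutations => pp; have sp := perm_size pp.
have : i \in p by rewrite (perm_mem pp) mem_iota.
by move=> ip; exists (index i p); rewrite ?nth_index //=; move: ip; rewrite -index_mem sp.
Qed.

Lemma general_position_perm v p : p \in perms6 -> general_position v -> general_position (fun i => v (nth 0%N p i)).
Proof.
move=> hp gp i j k hi hj hk ij ik jk.
have u : uniq p by move: hp; rewrite mem_permutations => /perm_uniq ->.
have sp : size p = 6%N by move: hp; rewrite mem_permutations => /perm_size.
by apply: gp; rewrite ?nth_perms6 // nth_uniq ?sp.
Qed.

Lemma classify v : general_position v -> size (concurrent_synthemes v) = 6%N ->
  exists w, [/\ arrangement w = arrangement v, general_position w &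
    (forall s, s \in synthemes -> concurrent w s = (s \in octa_synthemes)) \/
    (forall s, s \in synthemes -> concurrent w s = (s \in bip_synthemes))].
Proof.
move=> gp h6; pose b := [seq concurrent v s | s <- synthemes].
have nb t : t \in synthemes -> nth false b (index t synthemes) = concurrent v t.
  by move=> ht; rewrite (nth_map [::]) ?index_mem // nth_index.
have hb : b \in bool_seqs 15 by rewrite (_ : 15%N = size b) ?size_map // mem_bool_seqs.
have cb : count id b = 6%N by rewrite /b count_map -h6 size_filter.
have : two_types b.
  apply: (classify_bits hb cb).
  (* Every Pappus triple is the basic one moved by some [p], so the identity is applied to the
     permuted points. *)
  apply/allP => t; rewrite mem_undup => /mapP [p hp ->].
  have /and4P [c1 c2 c3 _] := allP pappus_check _ hp.
  have n1 := nb _ c1; have n2 := nb _ c2; have n3 := nb _ c3.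
  rewrite /two_imply /pappus_triple /fst /snd n1 n2 n3 !conc_canon.
  rewrite [concurrent v _]/(concurrency v _ _ _ == 0) [concurrent v [:: relabel p (0, 4)%N; _; _]]/(concurrency v _ _ _ == 0).
  rewrite [concurrent v _]/(concurrency v _ _ _ == 0).
  have := pappus v (nth 0 p 0)%N (nth 0 p 1)%N (nth 0 p 2)%N (nth 0 p 3)%N (nth 0 p 4)%N (nth 0 p 5)%N.
  set x := concurrency _ _ _ _; set y := concurrency _ _ _ _; set z := concurrency _ _ _ _ => e.
  by apply/and3P; split; apply/implyP => /andP [/eqP e1 /eqP e2]; apply/eqP; move: e;
    rewrite e1 e2 ?addr0 ?add0r.
rewrite /two_types; case/hasP => x /mapP [p hp ->] hy.
exists (fun i => v (nth 0%N p i)); split; [exact: arrangement_perm|exact: general_position_perm|].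
have ey : [seq nth false b i | i <- relabeled_indices p] = [seq concurrent (fun i => v (nth 0%N p i)) s | s <- synthemes].
  rewrite -map_comp; apply/eq_in_map => s hs; rewrite [LHS]/comp.
  rewrite nb ?(allP (allP sidx_check _ hp)) // conc_canon -conc_relab //.
move: hy; rewrite ey => /orP [] /eqP /eq_in_map h; [left|right]; exact: h.
Qed.
End Classify.

(** * Normal forms *)

Section Frames.
Variable K : numFieldType.
Implicit Types (v c : nat -> 'rV[K]_3) (M : 'M[K]_3).

(** For invertible [M], equality of the two families of projective points after a change of
    coordinates; each vector may be rescaled separately. *)
Definition framed v c M : Prop :=
  forall i, (i < 6)%N -> exists2 k, k != 0 & v i = k *: (c i *m M).

Lemma concurrencyE v d e f : concurrency v d e f =
  bracket (v d.1) (v d.2) (v e.2) * bracket (v f.1) (v f.2) (v e.1)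
  - bracket (v d.1) (v d.2) (v e.1) * bracket (v f.1) (v f.2) (v e.2).
Proof. by rewrite /concurrency /meet_point -scaleNr bracketD3 mulNr. Qed.

Lemma framed_br v c M i j k : framed v c M -> M \in unitmx ->
  (i < 6)%N -> (j < 6)%N -> (k < 6)%N ->
  (bracket (v i) (v j) (v k) == 0) = (bracket (c i) (c j) (c k) == 0).
Proof.
move=> fr; rewrite unit3P => M0 /fr [a a0 ->] /fr [b b0 ->] /fr [d d0 ->].
by rewrite bracket_scale bracket_mul !mulf_eq0 (negPf M0) (negPf a0) (negPf b0) (negPf d0) /= orbF.
Qed.

Lemma framed_general_position v c M : framed v c M -> M \in unitmx -> general_position v <-> general_position c.
Proof.
by move=> fr uM; split=> gp i j k hi hj hk ij ik jk; have := gp i j k hi hj hk ij ik jk;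
  rewrite (framed_br fr uM).
Qed.

Lemma framed_spt v c M s : framed v c M -> M \in unitmx -> s \in synthemes ->
  exists2 k, k != 0 & syntheme_point v s = k *: (syntheme_point c s *m M).
Proof.
move=> fr; rewrite unit3P => M0 /synthemeP [d [e [f [-> /duad_lt [d1 [d2 _]] /duad_lt [f1 [f2 _]] _ _]]]].
rewrite /syntheme_point /= /meet_point; have [a a0 ->] := fr _ d1; have [b b0 ->] := fr _ d2.
have [a' a'0 ->] := fr _ f1; have [b' b'0 ->] := fr _ f2.
exists (a * b * a' * b' * row_bracket M); first by rewrite !mulf_neq0.
rewrite !bracket_scale !bracket_mul mulmxBl -!scalemxAl scalerBr !scalerA.
by congr (_ *: _ - _ *: _); ring.
Qed.

Lemma framed_conc v c M s : framed v c M -> M \in unitmx -> s \in synthemes ->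
  concurrent v s = concurrent c s.
Proof.
move=> fr uM hs; have [k k0] := framed_spt fr uM hs.
have [d [e [f [-> _ _ /duad_lt [f1 [f2 _]] _]]]] := synthemeP hs.
rewrite /syntheme_point /= => ->; move: uM; rewrite unit3P => M0.
have [a a0 ->] := fr _ f1; have [b b0 ->] := fr _ f2.
by rewrite bracket_scale bracket_mul !mulf_eq0 (negPf M0) (negPf a0) (negPf b0) (negPf k0) /= orbF.
Qed.

Lemma framed_arrangement v c M : framed v c M -> arrangement v = arrangement (fun i => c i *m M).
Proof.
move=> fr; apply/seteqP; split=> l [i hi <-]; have [k k0 e] := fr i hi; exists i => //.
  by rewrite e Ln_scale.
by rewrite e Ln_scale.
Qed.

Definition nth_vector (s : seq 'rV[K]_3) (i : nat) : 'rV[K]_3 := nth 0 s i.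

Lemma lt6P (P : nat -> Prop) : P 0%N -> P 1%N -> P 2%N -> P 3%N -> P 4%N -> P 5%N ->
  forall i, (i < 6)%N -> P i.
Proof. by move=> ? ? ? ? ? ? [|[|[|[|[|[|i]]]]]]. Qed.

(** Two points on each of the sides [x = 0], [y = 0] and [z = 0] of the coordinate triangle, in this
    order. *)
Definition gen6 (p p' q q' r r' : K) := nth_vector [:: row3 0 1 p; row3 0 1 p'; row3 q 0 1;
  row3 q' 0 1; row3 1 r 0; row3 1 r' 0].
Definition std_points p q r := gen6 p (- p) q (- q) r (- r).

Lemma coplanar (n u v w : 'rV[K]_3) : n != 0 -> dot n u = 0 -> dot n v = 0 -> dot n w = 0 ->
  bracket u v w = 0.
Proof.
move=> n0 hu hv hw; apply/eqP; have := cramer_dual u v w n.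
by rewrite hu hv hw !scale0r !addr0 => /eqP; rewrite scaler_eq0 (negPf n0) orbF.
Qed.

Lemma side_coord (X Y Z a : 'rV[K]_3) (h : bracket X Y Z != 0) : bracket a Y Z = 0 ->
  a = (bracket X a Z / bracket X Y Z) *: Y + (bracket X Y a / bracket X Y Z) *: Z.
Proof.
move=> h0; apply: (scalerI h); rewrite cramer h0 scale0r add0r scalerDr !scalerA.
by rewrite ![bracket X Y Z * _]mulrC !divfK.
Qed.

(** A line through [Z] and a line through [Y] both miss [a], so [a] is neither vertex and both of
    its coordinates on the side [YZ] are nonzero. *)
Lemma side_coord_neq0 (X Y Z a x y x' y' : 'rV[K]_3) : bracket X Y Z != 0 -> bracket a Y Z = 0 ->
  bracket x y Z = 0 -> bracket x y a != 0 -> bracket x' y' Y = 0 -> bracket x' y' a != 0 ->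
  exists k p, [/\ k != 0, p != 0 & a = k *: (Y + p *: Z)].
Proof.
move=> h h0 hZ ha hY ha'; have e := side_coord h h0.
set k := _ / _ in e; set m := _ / _ in e.
have k0 : k != 0.
  by apply: contra ha => /eqP k0; rewrite e k0 scale0r add0r bracket_scale3 hZ mulr0.
have m0 : m != 0.
  by apply: contra ha' => /eqP m0; rewrite e m0 scale0r addr0 bracket_scale3 hY mulr0.
exists k, (m / k); split=> //; first by rewrite mulf_neq0 ?invr_neq0.
by rewrite scalerDr scalerA mulrC divfK.
Qed.

Lemma bracket_two (u v w : 'rV[K]_3) x1 x2 y1 y2 :
  bracket (x1 *: u - x2 *: v) (y1 *: u - y2 *: v) w = (x2 * y1 - x1 * y2) * bracket u v w.
Proof. by rewrite /bracket /dot /cross !vecE; ring. Qed.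

(* A Pluecker relation: both sides express the concurrency of ab, cd, ef. *)
Lemma six_brackets (a b c d e f : 'rV[K]_3) :
  bracket c d e * bracket a b f - bracket c d f * bracket a b e = bracket a b c * bracket e f d - bracket a b d * bracket e f c.
Proof. by rewrite /bracket /dot /cross !vecE; ring. Qed.

(** The right-hand side is minus the square of the concurrency expression of [01 | 23 | 45]: three
    lines that do not concur have non-collinear meeting points, which can serve as a frame. *)
Lemma bracket_npt v :
  bracket (meet_point v (2, 3) (4, 5)) (meet_point v (0, 1) (4, 5)) (meet_point v (0, 1) (2, 3))%N =
  - bracket (v 4%N) (v 5%N) (meet_point v (0, 1) (2, 3))%N ^+ 2.
Proof.
rewrite [X in bracket X]/meet_point [X in bracket _ X]/meet_point /= bracket_two.
have := concurrencyE v (0, 1)%N (2, 3)%N (4, 5)%N; rewrite /concurrency /= => ->.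
by rewrite (six_brackets (v 0%N) (v 1%N)); ring.
Qed.

Lemma side_pair (X Y Z a b c d e f : 'rV[K]_3) : bracket X Y Z != 0 ->
  bracket a b Y = 0 -> bracket a b Z = 0 -> bracket c d Z = 0 -> bracket e f Y = 0 ->
  bracket a b c != 0 -> bracket c d a != 0 -> bracket c d b != 0 -> bracket e f a != 0 -> bracket e f b != 0 ->
  exists k p k' p', [/\ k != 0, p != 0, a = k *: (Y + p *: Z) &
    [/\ k' != 0, p' != 0 & b = k' *: (Y + p' *: Z)]].
Proof.
move=> h aY aZ cZ eY abc ca cb ea eb.
have ab0 : cross a b != 0.
  by apply: contra abc => /eqP e0; rewrite /bracket e0 /dot !vecE !mul0r !addr0.
have hs x : dot (cross a b) x = 0 -> bracket x Y Z = 0 by move=> hx; apply: (coplanar ab0).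
have [k [p [k0 p0 ea']]] := side_coord_neq0 h (hs a (bracket_uvu a b)) cZ ca eY ea.
have [k' [p' [k'0 p'0 eb']]] := side_coord_neq0 h (hs b (bracket_uvv a b)) cZ cb eY eb.
by exists k, p, k', p'.
Qed.

Lemma gen6_brs p p' q q' r r' : let v := gen6 p p' q q' r r' in
  [/\ bracket (v 0%N) (v 1%N) (v 2%N) = q * (p' - p), bracket (v 2%N) (v 3%N) (v 4%N) = r * (q' - q)
   & bracket (v 4%N) (v 5%N) (v 0%N) = p * (r' - r)] .
Proof. by split; rewrite /gen6 /nth_vector /= /bracket /dot /cross !vecE; ring. Qed.

Lemma gen6_ccs p p' q q' r r' : let v := gen6 p p' q q' r r' in
  [/\ concurrency v (0, 1)%N (2, 4)%N (3, 5)%N = (p' - p) * (q' * r' - q * r),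
   concurrency v (0, 1)%N (2, 5)%N (3, 4)%N = (p' - p) * (q' * r - q * r') &
   concurrency v (0, 4)%N (1, 5)%N (2, 3)%N = (q' - q) * (r' * p' - r * p)].
Proof. by split; rewrite concurrencyE /gen6 /nth_vector /= /bracket /dot /cross !vecE; ring. Qed.

(** The concurrencies read [q' r' = q r], [q' r = q r'] and [r' p' = r p]. Subtracting the first two
    gives [(q' + q) (r' - r) = 0], where [r' != r] by general position; the other two signs
    follow. *)
Lemma gen6_std p p' q q' r r' : p != 0 -> q != 0 -> r != 0 ->
  let v := gen6 p p' q q' r r' in
  general_position v -> concurrent v [:: (0, 1); (2, 4); (3, 5)]%N -> concurrent v [:: (0, 1); (2, 5); (3, 4)]%N ->
  concurrent v [:: (0, 4); (1, 5); (2, 3)]%N -> [/\ p' = - p, q' = - q & r' = - r].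
Proof.
move=> p0 q0 r0 v gp.
have [b1 b2 b3] := gen6_brs p p' q q' r r'; have [c1 c2 c3] := gen6_ccs p p' q q' r r'.
have : bracket (v 0%N) (v 1%N) (v 2%N) != 0 by apply: gp.
have : bracket (v 2%N) (v 3%N) (v 4%N) != 0 by apply: gp.
have : bracket (v 4%N) (v 5%N) (v 0%N) != 0 by apply: gp.
rewrite b1 b2 b3 !mulf_eq0 !negb_or => /andP [_ dr] /andP [_ dq] /andP [_ dp].
rewrite /concurrent -/(concurrency v (0, 1) (2, 4) (3, 5))%N -/(concurrency v (0, 1) (2, 5) (3, 4))%N -/(concurrency v (0, 4) (1, 5) (2, 3))%N.
rewrite c1 c2 c3 !mulf_eq0 (negPf dp) (negPf dq) /= => /eqP h1 /eqP h2 /eqP h3.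
have eq : q' = - q.
  apply: (mulIf dr); apply/eqP; rewrite -subr_eq0; apply/eqP.
  transitivity ((q' * r' - q * r) - (q' * r - q * r')); first by ring.
  by rewrite h1 h2 subrr.
have er : r' = - r.
  by apply: (mulfI q0); apply/eqP; rewrite -subr_eq0 -oppr_eq0 -h1 eq; apply/eqP; ring.
have ep : p' = - p.
  by apply: (mulfI r0); apply/eqP; rewrite -subr_eq0 -oppr_eq0 -h3 er; apply/eqP; ring.
by [].
Qed.

(** The syntheme [01 | 23 | 45] is not concurrent, so its lines bound a genuine triangle, whose
    vertices [X], [Y], [Z] are taken as the frame. *)
Lemma octa_frame v : general_position v -> (forall s, s \in synthemes -> concurrent v s = (s \in octa_synthemes)) ->
  exists M p q r, [/\ M \in unitmx, p != 0, q != 0, r != 0 & framed v (std_points p q r) M].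
Proof.
move=> gp hc.
have h := bracket_npt v.
set X := meet_point v (2, 3)%N (4, 5)%N in h; set Y := meet_point v (0, 1)%N (4, 5)%N in h; set Z := meet_point v (0, 1)%N (2, 3)%N in h.
have [X1 X2] : bracket (v 2%N) (v 3%N) X = 0 /\ bracket (v 4%N) (v 5%N) X = 0 := meet_point_on v (2, 3)%N (4, 5)%N.
have [Y1 Y2] : bracket (v 0%N) (v 1%N) Y = 0 /\ bracket (v 4%N) (v 5%N) Y = 0 := meet_point_on v (0, 1)%N (4, 5)%N.
have [Z1 Z2] : bracket (v 0%N) (v 1%N) Z = 0 /\ bracket (v 2%N) (v 3%N) Z = 0 := meet_point_on v (0, 1)%N (2, 3)%N.
have h0 : bracket X Y Z != 0.
  have h0 : bracket (v 4%N) (v 5%N) Z != 0.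
    by have /negbT := hc [:: (0, 1); (2, 3); (4, 5)]%N isT.
  by rewrite h oppr_eq0 expf_neq0.
have h1 : bracket Y Z X != 0 by rewrite -bracket_rot.
have h2 : bracket Z X Y != 0 by rewrite -bracket_rot.
have [k0 [p [k1 [p' [k00 p0 E0 [k10 p'0 E1]]]]]] :
  exists k p k' p', [/\ k != 0, p != 0, v 0%N = k *: (Y + p *: Z) &
    [/\ k' != 0, p' != 0 & v 1%N = k' *: (Y + p' *: Z)]].
  by apply: (side_pair h0 Y1 Z1 Z2 Y2); apply: gp.
have [k2 [q [k3 [q' [k20 q0 E2 [k30 q'0 E3]]]]]] :
  exists k p k' p', [/\ k != 0, p != 0, v 2%N = k *: (Z + p *: X) &
    [/\ k' != 0, p' != 0 & v 3%N = k' *: (Z + p' *: X)]].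
  by apply: (side_pair h1 Z2 X1 X2 Z1); apply: gp.
have [k4 [r [k5 [r' [k40 r0 E4 [k50 r'0 E5]]]]]] :
  exists k p k' p', [/\ k != 0, p != 0, v 4%N = k *: (X + p *: Y) &
    [/\ k' != 0, p' != 0 & v 5%N = k' *: (X + p' *: Y)]].
  by apply: (side_pair h2 X2 Y2 Y1 X1); apply: gp.
pose M := mx3 X Y Z.
have uM : M \in unitmx by rewrite unit3P dm_mx3.
have fr : framed v (gen6 p p' q q' r r') M.
  by apply: lt6P; [exists k0|exists k1|exists k2|exists k3|exists k4|exists k5] => //;
   rewrite /gen6 /nth_vector /= mul_mx3 !row3E ?scale0r ?scale1r ?add0r ?addr0 // addrC.
have gpc := (framed_general_position fr uM).1 gp.
have cc1 s : s \in synthemes -> s \in octa_synthemes -> concurrent (gen6 p p' q q' r r') s.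
  by move=> hs ho; rewrite -(framed_conc fr uM hs) hc.
have [||| ep eq er] := gen6_std p0 q0 r0 gpc; try by apply: cc1.
by exists M, p, q, r; split=> //; move: fr; rewrite ep eq er.
Qed.

(** For [e] a primitive cube root of unity, the nine lines joining the first three points to the
    last three form the Fermat arrangement [(x^3 - y^3) (y^3 - z^3) (z^3 - x^3) = 0]. The six points
    are half of its twelve triple points, and the other six are the concurrent synthemes. *)
Definition fermat_points (e : K) := nth_vector [:: e0 K; e1 K; e2 K; row3 1 1 1; row3 1 e (e ^+ 2); row3 1 (e ^+ 2) e].

Definition bip6 (a b c d : K) := nth_vector [:: e0 K; e1 K; e2 K; row3 1 1 1; row3 1 a b; row3 1 c d].

Lemma bip6_ccs (a b c d : K) : let v := bip6 a b c d in
  [/\ concurrency v (0, 3)%N (1, 4)%N (2, 5)%N = b - c, concurrency v (0, 3)%N (1, 5)%N (2, 4)%N = d - a,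
   concurrency v (0, 4)%N (1, 3)%N (2, 5)%N = a - b * c & concurrency v (0, 5)%N (1, 3)%N (2, 4)%N = c - d * a].
Proof. by split; rewrite concurrencyE /bip6 /nth_vector /e0 /e1 /e2 /= /bracket /dot /cross !vecE; ring. Qed.

(** Once four points are normalized, the remaining ones are [(1 : a : b)] and [(1 : c : d)]. Four
    concurrencies give [b = c], [d = a], [a = b c] and [c = d a], hence [a^4 = a]. *)
Lemma bip_frame v : general_position v -> (forall s, s \in synthemes -> concurrent v s = (s \in bip_synthemes)) ->
  exists M e, [/\ M \in unitmx, 1 + e + e ^+ 2 = 0 & framed v (fermat_points e) M].
Proof.
move=> gp hc.
have h : bracket (v 0%N) (v 1%N) (v 2%N) != 0 by apply: gp.
have coord w : w = (bracket w (v 1%N) (v 2%N) / bracket (v 0%N) (v 1%N) (v 2%N)) *: v 0%N +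
   (bracket (v 0%N) w (v 2%N) / bracket (v 0%N) (v 1%N) (v 2%N)) *: v 1%N + (bracket (v 0%N) (v 1%N) w / bracket (v 0%N) (v 1%N) (v 2%N)) *: v 2%N.
  apply: (scalerI h); rewrite cramer !scalerDr !scalerA.
  by rewrite ![bracket (v 0%N) (v 1%N) (v 2%N) * _]mulrC !divfK.
have nz i : (2 < i < 6)%N -> exists x y z, [/\ x != 0, y != 0, z != 0 & v i = x *: v 0%N + y *: v 1%N + z *: v 2%N].
  move=> /andP [hi1 hi]; do 3!eexists; split; last exact: coord;
   rewrite mulf_neq0 ?invr_neq0 //; apply: gp => //; by case: i hi1 hi => [|[|[|i]]].
have [x [y [z [x0 y0 z0 E3]]]] := nz 3%N isT.
have [x' [y' [z' [x'0 y'0 z'0 E4]]]] := nz 4%N isT.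
have [x'' [y'' [z'' [x''0 y''0 z''0 E5]]]] := nz 5%N isT.
(* The first three vectors are scaled so that the fourth point becomes [(1 : 1 : 1)]. *)
pose M := mx3 (x *: v 0%N) (y *: v 1%N) (z *: v 2%N).
have uM : M \in unitmx by rewrite unit3P dm_mx3 bracket_scale !mulf_neq0.
pose a := x * y' / (x' * y); pose b := x * z' / (x' * z).
pose c := x * y'' / (x'' * y); pose d := x * z'' / (x'' * z).
have fr : framed v (bip6 a b c d) M.
  apply: lt6P; [exists x^-1|exists y^-1|exists z^-1|exists 1|exists (x' / x)|exists (x'' / x)];
   rewrite ?oner_eq0 ?invr_eq0 ?mulf_neq0 ?invr_neq0 //;
   rewrite /bip6 /nth_vector /e0 /e1 /e2 /= mul_mx3 !row3E ?scale0r ?scale1r ?add0r ?addr0 ?scalerA ?mulVf ?scale1r //.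
  - rewrite E4 !scalerDr !scalerA /a /b; congr (_ *: _ + _ *: _ + _ *: _); field; by rewrite ?x0 ?y0 ?z0 ?x'0.
  - rewrite E5 !scalerDr !scalerA /c /d; congr (_ *: _ + _ *: _ + _ *: _); field; by rewrite ?x0 ?y0 ?z0 ?x''0.
have a0 : a != 0 by rewrite /a !mulf_neq0 ?invr_neq0 // mulf_neq0.
clearbody a b c d.
have gpc := (framed_general_position fr uM).1 gp.
have cc1 s : s \in synthemes -> s \in bip_synthemes -> concurrent (bip6 a b c d) s.
  by move=> hs ho; rewrite -(framed_conc fr uM hs) hc.
have [c1 c2 c3 c4] := bip6_ccs a b c d.
have /eqP := cc1 [:: (0, 3); (1, 4); (2, 5)]%N isT isT; rewrite -/(concurrency _ _ _ _) c1 => h1.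
have /eqP := cc1 [:: (0, 3); (1, 5); (2, 4)]%N isT isT; rewrite -/(concurrency _ _ _ _) c2 => h2.
have /eqP := cc1 [:: (0, 4); (1, 3); (2, 5)]%N isT isT; rewrite -/(concurrency _ _ _ _) c3 => h3.
have /eqP := cc1 [:: (0, 5); (1, 3); (2, 4)]%N isT isT; rewrite -/(concurrency _ _ _ _) c4 => h4.
have eb : b = c by apply/eqP; rewrite -subr_eq0 h1.
have ed : d = a by apply/eqP; rewrite -subr_eq0 h2.
have ea : a = c ^+ 2 by apply/eqP; rewrite -subr_eq0 -h3 eb; apply/eqP; ring.
have ec : c = a ^+ 2 by apply/eqP; rewrite -subr_eq0 -h4 ed; apply/eqP; ring.
(* For [a = 1] the fourth and fifth points would coincide. *)
have a1 : a != 1.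
  apply/eqP => a1; have : bracket (bip6 a b c d 0%N) (bip6 a b c d 3%N) (bip6 a b c d 4%N) != 0 by apply: gpc.
  rewrite eb ed ec a1 expr1n /bip6 /nth_vector /e0 /= (_ : bracket _ _ _ = 0) ?eqxx //.
  by rewrite /bracket /dot /cross !vecE; ring.
exists M, a; split=> //.
  have : a * (a - 1) * (1 + a + a ^+ 2) = 0.
    transitivity ((a ^+ 2) ^+ 2 - a); first by ring.
    by apply/eqP; rewrite subr_eq0 -ec -ea.
  by move/eqP; rewrite !mulf_eq0 subr_eq0 (negPf a0) (negPf a1) => /eqP.
by move: fr; rewrite eb ed ec.
Qed.
End Frames.

(** * The family in a triangle *)

Lemma synthemesE : synthemes =
  [:: [:: (0, 1); (2, 3); (4, 5)]; [:: (0, 1); (2, 4); (3, 5)];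
      [:: (0, 1); (2, 5); (3, 4)]; [:: (0, 2); (1, 3); (4, 5)];
      [:: (0, 2); (1, 4); (3, 5)]; [:: (0, 2); (1, 5); (3, 4)];
      [:: (0, 3); (1, 2); (4, 5)]; [:: (0, 3); (1, 4); (2, 5)];
      [:: (0, 3); (1, 5); (2, 4)]; [:: (0, 4); (1, 2); (3, 5)];
      [:: (0, 4); (1, 3); (2, 5)]; [:: (0, 4); (1, 5); (2, 3)];
      [:: (0, 5); (1, 2); (3, 4)]; [:: (0, 5); (1, 3); (2, 4)];
      [:: (0, 5); (1, 4); (2, 3)]]%N.
Proof. by vm_compute. Qed.

Section Standard.
Variable K : numFieldType.
Implicit Types (v w c : nat -> 'rV[K]_3) (M : 'M[K]_3) (p q r : K).

Lemma general_position_sorted v :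
  (forall i j k, (i < j)%N -> (j < k)%N -> (k < 6)%N -> bracket (v i) (v j) (v k) != 0) -> general_position v.
Proof.
move=> h i j k hi hj hk ij ik jk.
have s1 x y z : bracket (v y) (v x) (v z) != 0 -> bracket (v x) (v y) (v z) != 0 by rewrite bracket_swap oppr_eq0.
have sort_two x y z : bracket (v x) (v z) (v y) != 0 -> bracket (v x) (v y) (v z) != 0 by rewrite bracket_swap2 oppr_eq0.
case: (ltngtP i j) ij => // lij _; case: (ltngtP i k) ik => // lik _; case: (ltngtP j k) jk => // ljk _.
- exact: h.
- by apply: (sort_two); apply: h.
- by lia.
- by apply: (sort_two); apply: (s1); apply: h.
- by apply: (s1); apply: h.
- by lia.
- by apply: (s1); apply: (sort_two); apply: h.
- by apply: (s1); apply: (sort_two); apply: (s1); apply: h.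
Qed.

(** Determinants are compared with a known nonzero value up to sign only; the tactic [pm] lets
    [ring] try both signs. *)
Lemma neq0_pm (x c : K) : c != 0 -> (x == c) || (x == - c) -> x != 0.
Proof. by move=> c0 /orP [] /eqP ->; rewrite ?oppr_eq0. Qed.

Ltac pm c := apply: (@neq0_pm _ c) => //; apply/orP;
  first [by left; apply/eqP; ring | by right; apply/eqP; ring].

(** Up to sign, the twenty brackets are [2 p], [2 p q] and their analogues, [1 - p q r] and
    [1 + p q r]. *)
Lemma std_general_position p q r : p != 0 -> q != 0 -> r != 0 -> p * q * r != 1 -> p * q * r != -1 ->
  general_position (std_points p q r).
Proof.
move=> p0 q0 r0 t1 t2.
have n2 : (2 : K) != 0 by rewrite pnatr_eq0.
have n2p : 2 * p != 0 by rewrite mulf_neq0.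
have n2q : 2 * q != 0 by rewrite mulf_neq0.
have n2r : 2 * r != 0 by rewrite mulf_neq0.
have n2pq : 2 * p * q != 0 by rewrite !mulf_neq0.
have n2pr : 2 * p * r != 0 by rewrite !mulf_neq0.
have n2qr : 2 * q * r != 0 by rewrite !mulf_neq0.
have tm : 1 - p * q * r != 0 by rewrite subr_eq0 eq_sym.
have tp : 1 + p * q * r != 0 by rewrite addrC -[1]opprK subr_eq0.
apply: general_position_sorted => i j k ij jk hk.
move: i j k ij jk hk => [|[|[|[|[|[|i]]]]]] [|[|[|[|[|[|j]]]]]] [|[|[|[|[|[|k]]]]]] // _ _ _;
rewrite /std_points /gen6 /nth_vector /bracket /dot /cross !vecE;
first [pm (2 * p)|pm (2 * q)|pm (2 * r)|pm (2 * p * q)|pm (2 * p * r)|pm (2 * q * r)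
  |pm (1 - p * q * r)|pm (1 + p * q * r)].
Qed.

(** With [T = p q r], the nine synthemes outside the list have concurrency expressions [8 T],
    [1 - 4 T - T^2] or [1 + 4 T - T^2] up to sign. The quartic is the product of the last two, which
    explains the 18. *)
Lemma std_conc p q r : p != 0 -> q != 0 -> r != 0 ->
  (p * q * r) ^+ 4 - 18 * (p * q * r) ^+ 2 + 1 != 0 ->
  forall s, s \in synthemes -> concurrent (std_points p q r) s = (s \in octa_synthemes).
Proof.
move=> p0 q0 r0 t4.
have n8 : 8 * (p * q * r) != 0 by rewrite !mulf_neq0 // pnatr_eq0.
set T := p * q * r in t4.
have f4 : T ^+ 4 - 18 * T ^+ 2 + 1 = (1 - 4 * T - T ^+ 2) * (1 + 4 * T - T ^+ 2) by ring.
move: t4; rewrite f4 mulf_eq0 negb_or /T => /andP [tm tp] {f4 T}.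
have E d e f : concurrent (std_points p q r) [:: d; e; f] = (concurrency (std_points p q r) d e f == 0) by [].
move=> s; rewrite synthemesE !inE.
repeat (case/orP; last first); move=> /eqP ->; rewrite E concurrencyE /=;
rewrite /std_points /gen6 /nth_vector /bracket /dot /cross !vecE;
first [ apply/eqP; ring
  | apply: negbTE; first [pm (8 * (p * q * r)) | pm (1 - 4 * (p * q * r) - (p * q * r) ^+ 2)
     | pm (1 + 4 * (p * q * r) - (p * q * r) ^+ 2)]].
Qed.

Lemma Lambda_framed v c M : general_position v -> framed v c M -> M \in unitmx ->
  Lambda23 (arrangement v) = [set Ln (syntheme_point c s *m M) | s in [set` concurrent_synthemes c]].
Proof.
move=> gp fr uM; rewrite Lambda_arrangement //.
have -> : concurrent_synthemes v = concurrent_synthemes c by apply: eq_in_filter => s hs; apply: framed_conc fr uM hs.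
apply/seteqP; split=> l [s hs <-]; (have /(framed_spt fr uM) [k k0 e] : s \in synthemes
  by move: hs; rewrite /= mem_filter => /andP []); exists s => //.
  by rewrite e Ln_scale.
by rewrite e Ln_scale.
Qed.

(** The two synthemes that contain the duad of a side meet on that side, so the image again has two
    points on each side of the same triangle. *)
Lemma std_spt p q r : p != 0 -> q != 0 -> r != 0 -> let T := p * q * r in
  let w := std_points (p / T) (q / T) (r / T) in let u := syntheme_point (std_points p q r) in
  [/\ u [:: (0, 1); (2, 5); (3, 4)]%N = (- (2 * T)) *: w 0%N,
      u [:: (0, 1); (2, 4); (3, 5)]%N = (2 * T) *: w 1%N,
      u [:: (0, 5); (1, 4); (2, 3)]%N = (- (2 * r * p ^+ 2)) *: w 2%N &
   [/\ u [:: (0, 4); (1, 5); (2, 3)]%N = (2 * r * p ^+ 2) *: w 3%N,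
      u [:: (0, 3); (1, 2); (4, 5)]%N = (2 * p * q ^+ 2) *: w 4%N &
      u [:: (0, 2); (1, 3); (4, 5)]%N = (2 * p * q ^+ 2) *: w 5%N]].
Proof.
by move=> p0 q0 r0; do 2?split; rewrite /syntheme_point /meet_point /std_points /gen6 /nth_vector /=; apply: row3P;
  rewrite /bracket /dot /cross !vecE; field; rewrite ?p0 ?q0 ?r0.
Qed.

Lemma octa_mem s : (s \in octa_synthemes) = [|| s == [:: (0, 1); (2, 5); (3, 4)],
   s == [:: (0, 1); (2, 4); (3, 5)], s == [:: (0, 5); (1, 4); (2, 3)],
   s == [:: (0, 4); (1, 5); (2, 3)], s == [:: (0, 3); (1, 2); (4, 5)]
  | s == [:: (0, 2); (1, 3); (4, 5)]]%N.
Proof. by rewrite !inE; do !case: eqP => //. Qed.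

Lemma concs_octa c : (forall s, s \in synthemes -> concurrent c s = (s \in octa_synthemes)) ->
  concurrent_synthemes c =i octa_synthemes.
Proof.
move=> h s; rewrite mem_filter; case hs: (s \in synthemes); first by rewrite h // andbT.
rewrite andbF; apply/esym/negbTE/negP => ho.
have /allP/(_ s ho) : all (mem synthemes) octa_synthemes by vm_compute.
by rewrite inE hs.
Qed.

Lemma Lambda_std v p q r M : p != 0 -> q != 0 -> r != 0 -> general_position v -> framed v (std_points p q r) M ->
  M \in unitmx -> (forall s, s \in synthemes -> concurrent v s = (s \in octa_synthemes)) ->
  let T := p * q * r in
  Lambda23 (arrangement v) = arrangement (fun i => std_points (p / T) (q / T) (r / T) i *m M).
Proof.
move=> p0 q0 r0 gp fr uM hc T; rewrite (Lambda_framed gp fr uM).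
have hc' s : s \in synthemes -> concurrent (std_points p q r) s = (s \in octa_synthemes).
  by move=> hs; rewrite -hc // (framed_conc fr uM hs).
have [u0 u1 u2 [u3 u4 u5]] := std_spt p0 q0 r0; rewrite -/T in u0 u1 u2 u3 u4 u5.
have n2 : (2 : K) != 0 by rewrite pnatr_eq0.
have k1 : 2 * T != 0 by rewrite !mulf_neq0.
have k2 : 2 * r * p ^+ 2 != 0 by rewrite !mulf_neq0 ?expf_neq0.
have k3 : 2 * p * q ^+ 2 != 0 by rewrite !mulf_neq0 ?expf_neq0.
apply/seteqP; split=> l.
  case=> s; rewrite /= (concs_octa hc') octa_mem => hs <-.
  by move: hs; repeat case/orP; move/eqP ->; rewrite ?u0 ?u1 ?u2 ?u3 ?u4 ?u5 -scalemxAl Ln_scale ?oppr_eq0 //;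
   [exists 0%N|exists 1%N|exists 2%N|exists 3%N|exists 4%N|exists 5%N].
case=> i hi <-; move: i hi; apply: lt6P;
 [exists [:: (0, 1); (2, 5); (3, 4)]%N|exists [:: (0, 1); (2, 4); (3, 5)]%N
 |exists [:: (0, 5); (1, 4); (2, 3)]%N|exists [:: (0, 4); (1, 5); (2, 3)]%N
 |exists [:: (0, 3); (1, 2); (4, 5)]%N|exists [:: (0, 2); (1, 3); (4, 5)]%N];
 rewrite /= ?(concs_octa hc') ?u0 ?u1 ?u2 ?u3 ?u4 ?u5 -?scalemxAl ?Ln_scale ?oppr_eq0 //.
Qed.

(** In the frame, the values of the form at the two points of a side differ by a multiple of an
    off-diagonal entry, so the form is diagonal. The three remaining equations multiply the entry
    [P i0 i0] by [- (p q r)^2] after one turn around the triangle. *)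
Lemma std_no_conic v p q r M : p != 0 -> q != 0 -> r != 0 -> (p * q * r) ^+ 2 != -1 ->
  framed v (std_points p q r) M -> M \in unitmx -> (forall i, (i < 6)%N -> v i != 0) ->
  ~ on_a_conic [set Pt (v i) | i in `I_6].
Proof.
move=> p0 q0 r0 t1 fr uM v0 [Q [Q0 Qs hQ]].
(* The Gram matrix of the conic in the coordinates of the frame. *)
pose P := M *m Q *m M^T.
have Ps : P^T = P by rewrite /P !trmx_mul trmxK Qs mulmxA.
have Pij a b : P a b = P b a by rewrite -[in LHS]Ps mxE.
have n2 : (2 : K) != 0 by rewrite pnatr_eq0.
have h i : (i < 6)%N -> dot (std_points p q r i *m P) (std_points p q r i) = 0.
  move=> hi; apply/eqP; rewrite -dot_eq0; apply/eqP.
  have [k k0 e] := fr i hi.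
  have := hQ (Pt (v i)) (std_points p q r i *m M); rewrite val_Pt ?v0 // trmx_mul !mulmxA => -> //.
    by exists i.
  by apply/vlineP; exists k^-1; rewrite e scalerA mulVf // scale1r.
have h0 := h 0%N isT; have h1 := h 1%N isT; have h2 := h 2%N isT.
have h3 := h 3%N isT; have h4 := h 4%N isT; have h5 := h 5%N isT.
rewrite /std_points /gen6 /nth_vector /= /dot !vecE in h0 h1 h2 h3 h4 h5.
rewrite (Pij i1 i0) (Pij i2 i0) (Pij i2 i1) in h0 h1 h2 h3 h4 h5.
have z12 : P i1 i2 = 0.
  apply: (mulfI p0); apply: (mulfI n2); apply: (mulfI n2); rewrite !mulr0.
  by have d := congr2 (fun x y => x - y) h0 h1; rewrite /= subrr in d; rewrite -[RHS]d; ring.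
have z02 : P i0 i2 = 0.
  apply: (mulfI q0); apply: (mulfI n2); apply: (mulfI n2); rewrite !mulr0.
  by have d := congr2 (fun x y => x - y) h2 h3; rewrite /= subrr in d; rewrite -[RHS]d; ring.
have z01 : P i0 i1 = 0.
  apply: (mulfI r0); apply: (mulfI n2); apply: (mulfI n2); rewrite !mulr0.
  by have d := congr2 (fun x y => x - y) h4 h5; rewrite /= subrr in d; rewrite -[RHS]d; ring.
rewrite z12 z02 z01 in h0 h2 h4.
have e1 : P i1 i1 = - p ^+ 2 * P i2 i2 by apply/eqP; rewrite -subr_eq0 -h0; apply/eqP; ring.
have e2 : P i2 i2 = - q ^+ 2 * P i0 i0 by apply/eqP; rewrite -subr_eq0 -h2; apply/eqP; ring.
have e0 : P i0 i0 = - r ^+ 2 * P i1 i1 by apply/eqP; rewrite -subr_eq0 -h4; apply/eqP; ring.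
have e : ((p * q * r) ^+ 2 - (-1)) * P i0 i0 = 0.
  rewrite opprK mulrDl mul1r [X in _ + X]e0 e1 e2; ring.
have z00 : P i0 i0 = 0 by move/eqP: e; rewrite mulf_eq0 subr_eq0 (negPf t1) => /eqP.
have z22 : P i2 i2 = 0 by rewrite e2 z00 mulr0.
have z11 : P i1 i1 = 0 by rewrite e1 z22 mulr0.
have P0 : P = 0.
  apply/matrixP; apply: forall_I3; apply: forall_I3; rewrite [RHS]mxE //.
  - by rewrite Pij.
  - by rewrite Pij.
  - by rewrite Pij.
have uMT : M^T \in unitmx by rewrite unitmx_tr.
move/eqP: Q0; apply; rewrite -[Q](mulKmx uM) -[M *m Q](mulmxK uMT) -/P P0 mul0mx mulmx0 //.
Qed.

(** [T^2 = 1] breaks general position, [T^2 = -1] puts the six points on a conic, and a root of the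
    quartic makes further synthemes concurrent. *)
Definition nondeg p q r : bool := let T := p * q * r in
  [&& p != 0, q != 0, r != 0, (T ^+ 2 != 1) && (T ^+ 2 != -1) & T ^+ 4 - 18 * T ^+ 2 + 1 != 0].

Lemma sqr_neq1 (T : K) : T ^+ 2 != 1 <-> T != 1 /\ T != -1.
Proof. by rewrite sqrf_eq1 negb_or; split=> [/andP|] // [-> ->]. Qed.

Lemma std_framed p q r M : framed (fun i => std_points p q r i *m M) (std_points p q r) M.
Proof. by move=> i _; exists 1; rewrite ?oner_eq0 ?scale1r. Qed.

Lemma std_unassuming p q r M : nondeg p q r -> M \in unitmx -> let T := p * q * r in
  unassuming (arrangement (fun i => std_points p q r i *m M)) /\
  Lambda23 (arrangement (fun i => std_points p q r i *m M)) = arrangement (fun i => std_points (p / T) (q / T) (r / T) i *m M).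
Proof.
case/and5P => p0 q0 r0 /andP [/sqr_neq1 [t1 t1'] t2] t4 uM T.
have fr := std_framed p q r M.
have gp : general_position (fun i => std_points p q r i *m M) by apply/(framed_general_position fr uM)/std_general_position.
have hc s : s \in synthemes -> concurrent (fun i => std_points p q r i *m M) s = (s \in octa_synthemes).
  by move=> hs; rewrite (framed_conc fr uM hs) std_conc.
have ec : concurrent_synthemes (fun i => std_points p q r i *m M) = [seq s <- synthemes | s \in octa_synthemes].
  exact: eq_in_filter.
split; last exact: Lambda_std.
apply: unassuming_arrangement => //.
- by rewrite ec; vm_compute.
- by rewrite /node_pairs ec; vm_compute.
- by apply: (std_no_conic p0 q0 r0 t2 fr uM) => i hi; apply: (gp_neq0 gp hi).
Qed.

End Standard.

(** * Recovering the triangle *)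

Section Moves.
Variable K : numFieldType.
Implicit Types (v w : nat -> 'rV[K]_3) (M : 'M[K]_3) (X Y Z : 'rV[K]_3) (a b c p q r : K).

Definition std_arrangement p q r M : set (P2line K) := arrangement (fun i => std_points p q r i *m M).

Lemma arrangement_reindex v w (s : seq nat) : s \in perms6 ->
  (forall i, (i < 6)%N -> exists2 k, k != 0 & v i = k *: w (nth 0 s i)%N) -> arrangement v = arrangement w.
Proof.
move=> hs h; rewrite -(arrangement_perm w hs); apply/seteqP.
by split=> l [i hi <-]; have [k k0 e] := h i hi; exists i => //; rewrite e Ln_scale.
Qed.

Lemma mem_perms6 s : perm_eq s (iota 0 6) -> s \in perms6.
Proof. by rewrite mem_permutations. Qed.

Lemma std_rows p q r X Y Z : let v i := std_points p q r i *m mx3 X Y Z in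
  [/\ v 0%N = Y + p *: Z, v 1%N = Y - p *: Z, v 2%N = Z + q *: X &
   [/\ v 3%N = Z - q *: X, v 4%N = X + r *: Y & v 5%N = X - r *: Y]].
Proof.
by do 2?split; rewrite /std_points /gen6 /nth_vector /= mul_mx3 !row3E;
  apply/rowP => j; rewrite !vecE; ring.
Qed.

Ltac rows6 k0 k1 k2 k3 k4 k5 :=
  apply: lt6P; [exists k0|exists k1|exists k2|exists k3|exists k4|exists k5].

Lemma std_arrangement_cyc p q r X Y Z : std_arrangement p q r (mx3 X Y Z) = std_arrangement q r p (mx3 Y Z X).
Proof.
have [e0 e1 e2 [e3 e4 e5]] := std_rows p q r X Y Z.
have [f0 f1 f2 [f3 f4 f5]] := std_rows q r p Y Z X.
apply: (@arrangement_reindex _ _ [:: 4; 5; 0; 1; 2; 3]%N); first exact: mem_perms6.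
by apply: lt6P; exists 1; rewrite ?oner_eq0 //= scale1r ?e0 ?e1 ?e2 ?e3 ?e4 ?e5 ?f0 ?f1 ?f2 ?f3 ?f4 ?f5.
Qed.

Lemma std_arrangement_swap p q r X Y Z : p != 0 -> q != 0 -> r != 0 ->
  std_arrangement p q r (mx3 X Y Z) = std_arrangement p^-1 r^-1 q^-1 (mx3 X Z Y).
Proof.
move=> p0 q0 r0.
have [e0 e1 e2 [e3 e4 e5]] := std_rows p q r X Y Z.
have [f0 f1 f2 [f3 f4 f5]] := std_rows p^-1 r^-1 q^-1 X Z Y.
apply: (@arrangement_reindex _ _ [:: 0; 1; 4; 5; 2; 3]%N); first exact: mem_perms6.
by rows6 p (-p) q (-q) r (-r); rewrite ?oppr_eq0 //= ?e0 ?e1 ?e2 ?e3 ?e4 ?e5 ?f0 ?f1 ?f2 ?f3 ?f4 ?f5;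
  apply/rowP => j; rewrite !vecE; field.
Qed.

(** The product [p q r] is preserved here, while exchanging two vertices inverts it: up to sign and
    inversion, it is the modulus of the family. *)
Lemma std_arrangement_scale a b c p q r X Y Z : a != 0 -> b != 0 -> c != 0 ->
  std_arrangement p q r (mx3 (a *: X) (b *: Y) (c *: Z)) = std_arrangement (p * c / b) (q * a / c) (r * b / a) (mx3 X Y Z).
Proof.
move=> a0 b0 c0.
have [e0 e1 e2 [e3 e4 e5]] := std_rows p q r (a *: X) (b *: Y) (c *: Z).
have [f0 f1 f2 [f3 f4 f5]] := std_rows (p * c / b) (q * a / c) (r * b / a) X Y Z.
apply: (@arrangement_reindex _ _ [:: 0; 1; 2; 3; 4; 5]%N); first exact: mem_perms6.
by rows6 b b c c a a; rewrite //= ?e0 ?e1 ?e2 ?e3 ?e4 ?e5 ?f0 ?f1 ?f2 ?f3 ?f4 ?f5;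
  apply/rowP => j; rewrite !vecE; field.
Qed.

Lemma std_arrangement_sign p q r M : std_arrangement (- p) q r M = std_arrangement p q r M.
Proof.
apply: (@arrangement_reindex _ _ [:: 1; 0; 2; 3; 4; 5]%N); first exact: mem_perms6.
by apply: lt6P; exists 1; rewrite ?oner_eq0 //= scale1r /std_points /gen6 /nth_vector /= ?opprK.
Qed.

Lemma mx3_rowE M : M = mx3 (row i0 M) (row i1 M) (row i2 M).
Proof. by apply/matrixP; apply: forall_I3 => j; rewrite mx3E !mxE. Qed.

(** Changing the sign of one parameter exchanges the two points on one side, which the unordered
    arrangement does not see. *)
Lemma std_arrangement_sqr p q r p' q' r' M : p ^+ 2 = p' ^+ 2 -> q ^+ 2 = q' ^+ 2 -> r ^+ 2 = r' ^+ 2 ->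
  std_arrangement p q r M = std_arrangement p' q' r' M.
Proof.
have h (x y z x' : K) N : x ^+ 2 = x' ^+ 2 -> std_arrangement x y z N = std_arrangement x' y z N.
  by move/eqP; rewrite eqf_sqr => /orP [] /eqP -> //; rewrite std_arrangement_sign.
move=> hp hq hr; rewrite (h _ _ _ _ _ hp) [M]mx3_rowE std_arrangement_cyc (h _ _ _ _ _ hq) std_arrangement_cyc (h _ _ _ _ _ hr).
by rewrite std_arrangement_cyc.
Qed.

(* [B] has the parameters that [Lambda23 A] has in the frame [M]. *)
Definition image_in_frame (A B : set (P2line K)) M : Prop :=
  exists a b c, [/\ a != 0, b != 0, c != 0, A = std_arrangement a b c M & B = std_arrangement (b * c)^-1 (c * a)^-1 (a * b)^-1 M].

Lemma frame_cyc A B X Y Z : image_in_frame A B (mx3 X Y Z) -> image_in_frame A B (mx3 Y Z X).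
Proof. by case=> a [b [c [a0 b0 c0 -> ->]]]; exists b, c, a; split; rewrite // std_arrangement_cyc. Qed.

Lemma frame_swap A B X Y Z : image_in_frame A B (mx3 X Y Z) -> image_in_frame A B (mx3 X Z Y).
Proof.
case=> a [b [c [a0 b0 c0 -> ->]]]; exists a^-1, c^-1, b^-1; rewrite !invr_eq0.
split=> //; first exact: std_arrangement_swap.
rewrite std_arrangement_swap ?invr_eq0 ?mulf_neq0 // !invrK -!invfM !invrK.
by rewrite [c * b]mulrC [b * a]mulrC [a * c]mulrC.
Qed.

Lemma frame_scale A B n0 n1 n2 X Y Z : n0 != 0 -> n1 != 0 -> n2 != 0 ->
  image_in_frame A B (mx3 (n0 *: X) (n1 *: Y) (n2 *: Z)) -> image_in_frame A B (mx3 X Y Z).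
Proof.
move=> h0 h1 h2 [a [b [c [a0 b0 c0 -> ->]]]].
exists (a * n2 / n1), (b * n0 / n2), (c * n1 / n0).
split; try (by rewrite !mulf_neq0 ?invr_eq0); first exact: std_arrangement_scale.
rewrite std_arrangement_scale //; have [na nb nc] : [/\ a * n2 / n1 != 0, b * n0 / n2 != 0 & c * n1 / n0 != 0].
  by split; rewrite !mulf_neq0 ?invr_eq0.
have -> : (b * c)^-1 * n2 / n1 = (b * n0 / n2 * (c * n1 / n0))^-1.
  by field; rewrite h0 h1 h2 b0 c0.
have -> : (c * a)^-1 * n0 / n2 = (c * n1 / n0 * (a * n2 / n1))^-1.
  by field; rewrite h0 h1 h2 a0 c0.
have -> // : (a * b)^-1 * n1 / n0 = (a * n2 / n1 * (b * n0 / n2))^-1.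
by field; rewrite h0 h1 h2 a0 b0.
Qed.

Lemma dot_std p q r (m : 'rV[K]_3) : let d i := dot (std_points p q r i) m in
  [/\ d 0%N = m 0 i1 + p * m 0 i2, d 1%N = m 0 i1 - p * m 0 i2, d 2%N = m 0 i2 + q * m 0 i0 &
   [/\ d 3%N = m 0 i2 - q * m 0 i0, d 4%N = m 0 i0 + r * m 0 i1 & d 5%N = m 0 i0 - r * m 0 i1]].
Proof. by do 2?split; rewrite /std_points /gen6 /nth_vector /dot !vecE; ring. Qed.

(** Read as a linear form, [m] is zero or defines a side of the coordinate triangle. *)
Definition one_coord (m : 'rV[K]_3) : Prop :=
  [\/ m 0 i1 = 0 /\ m 0 i2 = 0, m 0 i0 = 0 /\ m 0 i2 = 0 | m 0 i0 = 0 /\ m 0 i1 = 0].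

(** Two points on the same side force the form to be that side. Points on different sides give two
    of three possible relations between squared coordinates. *)
Lemma kill_two p q r (m : 'rV[K]_3) i j : p != 0 -> q != 0 -> r != 0 -> (i < 6)%N -> (j < 6)%N -> i != j ->
  dot (std_points p q r i) m = 0 -> dot (std_points p q r j) m = 0 ->
  one_coord m \/
   [\/ (m 0 i1) ^+ 2 = p ^+ 2 * (m 0 i2) ^+ 2 /\ (m 0 i2) ^+ 2 = q ^+ 2 * (m 0 i0) ^+ 2,
       (m 0 i2) ^+ 2 = q ^+ 2 * (m 0 i0) ^+ 2 /\ (m 0 i0) ^+ 2 = r ^+ 2 * (m 0 i1) ^+ 2 |
       (m 0 i1) ^+ 2 = p ^+ 2 * (m 0 i2) ^+ 2 /\ (m 0 i0) ^+ 2 = r ^+ 2 * (m 0 i1) ^+ 2].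
Proof.
move=> p0 q0 r0.
have [e0 e1 e2 [e3 e4 e5]] := dot_std p q r m.
have n2 : (2 : K) != 0 by rewrite pnatr_eq0.
have sq (s x y : K) : x + s * y = 0 \/ x - s * y = 0 -> x ^+ 2 = s ^+ 2 * y ^+ 2.
  move=> h; apply/eqP; rewrite -exprMn eqf_sqr; case: h => /eqP; first by rewrite addr_eq0 => ->; rewrite orbT.
  by rewrite subr_eq0 => ->.
have both (s x y : K) : s != 0 -> x + s * y = 0 -> x - s * y = 0 -> x = 0 /\ y = 0.
  move=> s0 h1 h2; have x0 : x = 0.
    by apply: (mulfI n2); rewrite mulr0; have := congr2 +%R h1 h2; rewrite addr0 => h; rewrite -[RHS]h; ring.
  by split=> //; apply: (mulfI s0); rewrite mulr0 -[RHS]h1 x0 add0r.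
have P01 : m 0 i1 + p * m 0 i2 = 0 -> m 0 i1 - p * m 0 i2 = 0 -> one_coord m.
  by move=> h1 h2; constructor 1; apply: both h1 h2.
have P23 : m 0 i2 + q * m 0 i0 = 0 -> m 0 i2 - q * m 0 i0 = 0 -> one_coord m.
  by move=> h1 h2; constructor 2; have [] := both _ _ _ q0 h1 h2.
have P45 : m 0 i0 + r * m 0 i1 = 0 -> m 0 i0 - r * m 0 i1 = 0 -> one_coord m.
  by move=> h1 h2; constructor 3; apply: both h1 h2.
move: i j => [|[|[|[|[|[|i]]]]]] [|[|[|[|[|[|j]]]]]] // _ _ _;
 rewrite ?e0 ?e1 ?e2 ?e3 ?e4 ?e5 => h1 h2;
 first [ by left; apply: P01 | by left; apply: P23 | by left; apply: P45
  | by right; constructor 1; split; apply: sq; [left|left]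
  | by right; constructor 1; split; apply: sq; auto
  | by right; constructor 2; split; apply: sq; auto
  | by right; constructor 3; split; apply: sq; auto ].
Qed.

(** Each alternative of [kill_two] contains two of the three relations, so two alternatives share
    one. It then holds both as [x^2 = t^2 y^2] and as [x^2 = (t s)^2 y^2], and [s^2 != 1] kills both
    coordinates. *)
Lemma single_coord p q r s (m : 'rV[K]_3) i j k l :
  p != 0 -> q != 0 -> r != 0 -> s != 0 -> s ^+ 2 != 1 ->
  [&& (i < 6), (j < 6), (k < 6), (l < 6), i != j & k != l]%N ->
  dot (std_points p q r i) m = 0 -> dot (std_points p q r j) m = 0 ->
  dot (std_points (p * s) (q * s) (r * s) k) m = 0 -> dot (std_points (p * s) (q * s) (r * s) l) m = 0 ->
  one_coord m.
Proof.
move=> p0 q0 r0 s0 s1 /and5P [hi hj hk hl /andP [ij kl]] h1 h2 h3 h4.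
have [//|h] := kill_two p0 q0 r0 hi hj ij h1 h2.
have [//|h'] := kill_two (mulf_neq0 p0 s0) (mulf_neq0 q0 s0) (mulf_neq0 r0 s0) hk hl kl h3 h4.
have z (x y t : K) : t != 0 -> x ^+ 2 = t ^+ 2 * y ^+ 2 -> x ^+ 2 = (t * s) ^+ 2 * y ^+ 2 -> x = 0 /\ y = 0.
  move=> t0 e1 e2; have y0 : y = 0.
    have : t ^+ 2 * (y ^+ 2 * (s ^+ 2 - 1)) = 0.
      transitivity ((t * s) ^+ 2 * y ^+ 2 - t ^+ 2 * y ^+ 2); [by ring|by rewrite -e1 -e2 subrr].
    have sort_two : s ^+ 2 - 1 != 0 by rewrite subr_eq0.
    rewrite -[RHS](mulr0 (t ^+ 2)) => /(mulfI (expf_neq0 2 t0)).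
    rewrite -[RHS](mul0r (s ^+ 2 - 1)) => /(mulIf sort_two) /eqP.
    by rewrite expf_eq0 => /andP [_ /eqP].
  by split=> //; move/eqP: e1; rewrite y0 expr0n mulr0 expf_eq0 => /andP [_ /eqP].
case: h h' => [] [g1 g2] [] [g3 g4];
 first [ by constructor 1; apply: z g1 g3 | by constructor 1; apply: z g1 g4
  | by constructor 1; apply: z g2 g3 | by constructor 1; apply: z g2 g4
  | by constructor 2; have [] := z _ _ _ q0 g2 g4 | by constructor 2; have [] := z _ _ _ q0 g1 g3
  | by constructor 2; have [] := z _ _ _ q0 g2 g3 | by constructor 2; have [] := z _ _ _ q0 g1 g4
  | by constructor 3; have [] := z _ _ _ r0 g2 g4 | by constructor 3; have [] := z _ _ _ r0 g1 g3
  | by constructor 3; have [] := z _ _ _ r0 g2 g3 | by constructor 3; have [] := z _ _ _ r0 g1 g4 ].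
Qed.

Lemma std_arrangement_mem p q r M p2 q2 r2 M2 i : M \in unitmx -> M2 \in unitmx ->
  std_arrangement p2 q2 r2 M2 `<=` std_arrangement p q r M -> (i < 6)%N -> exists2 j, (j < 6)%N &
  exists2 k, k != 0 & std_points p2 q2 r2 i = k *: (std_points p q r j *m (M *m invmx M2)).
Proof.
move=> uM uM2 sub hi.
have nz a b c i' N : N \in unitmx -> (i' < 6)%N -> std_points a b c i' *m N != 0.
  move=> uN hi'; apply/eqP => e0.
  have : std_points a b c i' = 0 by rewrite -[LHS](mulmxK uN) e0 mul0mx.
  move: i' hi' {e0}; apply: lt6P; rewrite /std_points /gen6 /nth_vector /= => /rowP h;
   by [move: (h i1); rewrite !vecE => /eqP; rewrite oner_eq0
      |move: (h i2); rewrite !vecE => /eqP; rewrite oner_eq0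
      |move: (h i0); rewrite !vecE => /eqP; rewrite oner_eq0].
have [j hj] : std_arrangement p q r M (Ln (std_points p2 q2 r2 i *m M2)) by apply: sub; exists i.
move/esym/Ln_inj => [||k k0 e]; rewrite ?nz //.
exists j => //; exists k => //.
by rewrite mulmxA scalemxAl -e mulmxK.
Qed.

Lemma dot_col (x : 'rV[K]_3) (N : 'M[K]_3) k : dot x (row k N^T) = (x *m N) 0 k.
Proof. by rewrite mulmx3E /dot !mxE. Qed.

(** The columns of [M *m invmx M2] are the sides of the second triangle written in the first frame.
    Each side carries two points of the arrangement given in the second frame, and these are also
    points of the other one. *)
Lemma two_kills p q r M p2 q2 r2 M2 k : M \in unitmx -> M2 \in unitmx ->
  p2 != 0 -> q2 != 0 -> r2 != 0 -> std_arrangement p2 q2 r2 M2 `<=` std_arrangement p q r M ->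
  exists i j, [/\ (i < 6)%N, (j < 6)%N, i != j,
    dot (std_points p q r i) (row k (M *m invmx M2)^T) = 0 & dot (std_points p q r j) (row k (M *m invmx M2)^T) = 0].
Proof.
move=> uM uM2 p0 q0 r0 sub; set N := M *m invmx M2.
have n2 : (2 : K) != 0 by rewrite pnatr_eq0.
have key x y : (x < 6)%N -> (y < 6)%N -> std_points p2 q2 r2 x 0 k = 0 -> std_points p2 q2 r2 y 0 k = 0 ->
    cross (std_points p2 q2 r2 x) (std_points p2 q2 r2 y) != 0 ->
    exists i j, [/\ (i < 6)%N, (j < 6)%N, i != j,
    dot (std_points p q r i) (row k N^T) = 0 & dot (std_points p q r j) (row k N^T) = 0].
  move=> hx hy zx zy xy.
  have [i hi [a a0 ea]] := std_arrangement_mem uM uM2 sub hx; have [j hj [b b0 eb]] := std_arrangement_mem uM uM2 sub hy.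
  exists i, j; rewrite -/N in ea eb; split=> //.
  - apply: contra xy => /eqP ij; rewrite ea eb ij; apply/eqP; apply: row3P; rewrite /cross !vecE; ring.
  - by apply: (mulfI a0); rewrite dot_col mulr0 -zx ea [in RHS]scalevE.
  - by apply: (mulfI b0); rewrite dot_col mulr0 -zy eb [in RHS]scalevE.
move: k key; apply: forall_I3 => key.
- apply: (key 0%N 1%N) => //; rewrite /std_points /gen6 /nth_vector /= ?vecE //.
  apply/eqP => /rowP/(_ i0); rewrite /cross !vecE => /eqP; apply/negP.
  by rewrite (_ : _ - _ = - (2 * p2)) ?oppr_eq0 ?mulf_neq0 //; ring.
- apply: (key 2%N 3%N) => //; rewrite /std_points /gen6 /nth_vector /= ?vecE //.
  apply/eqP => /rowP/(_ i1); rewrite /cross !vecE => /eqP; apply/negP.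
  by rewrite (_ : _ - _ = - (2 * q2)) ?oppr_eq0 ?mulf_neq0 //; ring.
- apply: (key 4%N 5%N) => //; rewrite /std_points /gen6 /nth_vector /= ?vecE //.
  apply/eqP => /rowP/(_ i2); rewrite /cross !vecE => /eqP; apply/negP.
  by rewrite (_ : _ - _ = - (2 * r2)) ?oppr_eq0 ?mulf_neq0 //; ring.
Qed.

(** An invertible matrix with a single nonzero entry in each column permutes and rescales the
    vertices; the six permutations are generated by the cycle and the swap. *)
Lemma monomial_frame A B N M2 : N \in unitmx ->
  (forall k, one_coord (row k N^T)) -> image_in_frame A B (N *m M2) -> image_in_frame A B M2.
Proof.
rewrite unit3P [M2 in X in _ -> _ -> _ -> X]mx3_rowE => N0 h.
set X := row i0 M2; set Y := row i1 M2; set Z := row i2 M2.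
have -> : N *m M2 = mx3 (N i0 i0 *: X + N i0 i1 *: Y + N i0 i2 *: Z)
   (N i1 i0 *: X + N i1 i1 *: Y + N i1 i2 *: Z) (N i2 i0 *: X + N i2 i1 *: Y + N i2 i2 *: Z).
  apply/matrixP; apply: forall_I3 => j; rewrite mx3E mxE sum_I3 !vecE //.
have h' k : [\/ N i1 k = 0 /\ N i2 k = 0, N i0 k = 0 /\ N i2 k = 0 | N i0 k = 0 /\ N i1 k = 0].
  by have := h k; rewrite /one_coord !mxE.
move: N0; rewrite /row_bracket /bracket /dot /cross !vecE.
case: (h' i0) => -[-> ->]; case: (h' i1) => -[-> ->]; case: (h' i2) => -[-> ->];
  rewrite !(mulr0, mul0r, addr0, add0r, subr0, sub0r, oppr0, scale0r, eqxx) //.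
all: rewrite ?mulNr ?oppr_eq0 !mulf_eq0 !negb_or => /andP [/andP [n1 n2] n3] fr.
- by apply: frame_scale fr.
- by apply: frame_swap; apply: frame_scale fr.
- by apply: frame_cyc; apply: frame_cyc; apply: frame_swap; apply: frame_scale fr.
- by apply: frame_cyc; apply: frame_scale fr.
- by apply: frame_cyc; apply: frame_cyc; apply: frame_scale fr.
- by apply: frame_cyc; apply: frame_swap; apply: frame_scale fr.
Qed.


(** Points on different sides have different vanishing coordinates, so each point matches one on its
    own side, which fixes its parameter up to sign. *)
Lemma std_param p q r p2 q2 r2 M : M \in unitmx -> p2 != 0 -> q2 != 0 -> r2 != 0 ->
  p != 0 -> q != 0 -> r != 0 ->
  std_arrangement p q r M = std_arrangement p2 q2 r2 M -> [/\ p ^+ 2 = p2 ^+ 2, q ^+ 2 = q2 ^+ 2 & r ^+ 2 = r2 ^+ 2].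
Proof.
move=> uM p20 q20 r20 p0 q0 r0 e.
have sub : std_arrangement p q r M `<=` std_arrangement p2 q2 r2 M by rewrite e.
have key i : (i < 6)%N -> exists2 j, (j < 6)%N & exists2 k, k != 0 & std_points p q r i = k *: std_points p2 q2 r2 j.
  move=> hi; have [j hj [k k0 ej]] := std_arrangement_mem uM uM sub hi; exists j => //; exists k => //.
  by rewrite ej mulmxV // mulmx1.
have F (x y z : K) : x != 0 -> y != 0 -> x * y = z -> z != 0.
  by move=> x0 y0 <-; rewrite mulf_neq0.
split.
- have [j hj [k k0 E]] := key 0%N isT; have a0 := congr1 (fun x : 'rV[K]_3 => x 0 i0) E.
  have a1 := congr1 (fun x : 'rV[K]_3 => x 0 i1) E; have a2 := congr1 (fun x : 'rV[K]_3 => x 0 i2) E.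
  move: j hj {E} a0 a1 a2; apply: lt6P; rewrite /std_points /gen6 /nth_vector /= !vecE ?mulr1 ?mulr0 => a0 a1 a2;
    rewrite ?a2 -?a1 ?mul1r ?sqrrN //;
    by [move/eqP: a0; rewrite eq_sym ?mulrN ?oppr_eq0 ?mulf_eq0 ?(negPf k0) ?(negPf q20)
       |move/eqP: a1; rewrite ?oner_eq0].
- have [j hj [k k0 E]] := key 2%N isT; have a0 := congr1 (fun x : 'rV[K]_3 => x 0 i0) E.
  have a1 := congr1 (fun x : 'rV[K]_3 => x 0 i1) E; have a2 := congr1 (fun x : 'rV[K]_3 => x 0 i2) E.
  move: j hj {E} a0 a1 a2; apply: lt6P; rewrite /std_points /gen6 /nth_vector /= !vecE ?mulr1 ?mulr0 => a0 a1 a2;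
    rewrite ?a0 -?a2 ?mul1r ?sqrrN //;
    by [move/eqP: a1; rewrite eq_sym ?mulrN ?oppr_eq0 ?mulf_eq0 ?(negPf k0) ?(negPf r20)
       |move/eqP: a2; rewrite ?oner_eq0].
- have [j hj [k k0 E]] := key 4%N isT; have a0 := congr1 (fun x : 'rV[K]_3 => x 0 i0) E.
  have a1 := congr1 (fun x : 'rV[K]_3 => x 0 i1) E; have a2 := congr1 (fun x : 'rV[K]_3 => x 0 i2) E.
  move: j hj {E} a0 a1 a2; apply: lt6P; rewrite /std_points /gen6 /nth_vector /= !vecE ?mulr1 ?mulr0 => a0 a1 a2;
    rewrite ?a1 -?a0 ?mul1r ?sqrrN //;
    by [move/eqP: a2; rewrite eq_sym ?mulrN ?oppr_eq0 ?mulf_eq0 ?(negPf k0) ?(negPf p20)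
       |move/eqP: a0; rewrite ?oner_eq0].
Qed.

(** In the frame of [A], the last equation describes the image of [B], whose parameters are those of
    [B] times [(a b c)^2]. The sides of the second triangle contain two points of both arrangements,
    so [single_coord] identifies the two triangles. *)
Lemma preimage_params A B a b c M p q r M2 : M \in unitmx -> M2 \in unitmx ->
  a != 0 -> b != 0 -> c != 0 -> p != 0 -> q != 0 -> r != 0 -> (a * b * c) ^+ 4 != 1 ->
  A = std_arrangement a b c M -> B = std_arrangement (b * c)^-1 (c * a)^-1 (a * b)^-1 M -> B = std_arrangement p q r M2 ->
  std_arrangement (a * (a * b * c)) (b * (a * b * c)) (c * (a * b * c)) M = std_arrangement (q * r)^-1 (r * p)^-1 (p * q)^-1 M2 ->
  exists t, [/\ t != 0, t ^+ 4 * (p * q * r) ^+ 2 = 1 & A = std_arrangement (p * t) (q * t) (r * t) M2].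
Proof.
move=> uM uM2 a0 b0 c0 p0 q0 r0 t1 eA eB eB2 eL.
set T := a * b * c in t1 eL.
have T0 : T != 0 by rewrite !mulf_neq0.
have T2 : (T ^+ 2) ^+ 2 != 1 by rewrite -exprM.
have uN : M *m invmx M2 \in unitmx by rewrite unitmx_mul uM unitmx_inv.
have [a' [b' [c' [a'0 b'0 c'0 eA' eB']]]] : image_in_frame A B M2.
  apply: (@monomial_frame _ _ (M *m invmx M2)) => //; last by rewrite mulmxKV //; exists a, b, c.
  move=> k.
  have sub1 : std_arrangement p q r M2 `<=` std_arrangement (b * c)^-1 (c * a)^-1 (a * b)^-1 M by rewrite -eB2 -eB.
  have sub2 : std_arrangement (q * r)^-1 (r * p)^-1 (p * q)^-1 M2 `<=` std_arrangement (a * T) (b * T) (c * T) M by rewrite eL.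
  have [i [j [hi hj ij h1 h2]]] := two_kills k uM uM2 p0 q0 r0 sub1.
  have d0 (x y : K) : x != 0 -> y != 0 -> (x * y)^-1 != 0 by move=> x0 y0; rewrite invr_eq0 mulf_neq0.
  have [i' [j' [hi' hj' ij' h1' h2']]] := two_kills k uM uM2 (d0 _ _ q0 r0) (d0 _ _ r0 p0) (d0 _ _ p0 q0) sub2.
  have ea : a * T = (b * c)^-1 * T ^+ 2 by rewrite /T; field; rewrite b0 c0.
  have eb : b * T = (c * a)^-1 * T ^+ 2 by rewrite /T; field; rewrite a0 c0.
  have ec : c * T = (a * b)^-1 * T ^+ 2 by rewrite /T; field; rewrite a0 b0.
  rewrite ea eb ec in h1' h2'.
  apply: (single_coord (d0 _ _ b0 c0) (d0 _ _ c0 a0) (d0 _ _ a0 b0) (expf_neq0 2 T0) T2 _ h1 h2 h1' h2').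
  by rewrite hi hj hi' hj' ij.
have d0 (x y : K) : x != 0 -> y != 0 -> (x * y)^-1 != 0 by move=> x0 y0; rewrite invr_eq0 mulf_neq0.
have e : std_arrangement p q r M2 = std_arrangement (b' * c')^-1 (c' * a')^-1 (a' * b')^-1 M2 by rewrite -eB2.
have [|||||| e1 e2 e3] := std_param uM2 _ _ _ _ _ _ e; rewrite ?d0 //.
(* In the second frame [p = +-1 / (b' c')] and cyclically, so multiplying by [a' b' c'] turns [p]
   into [+-a']. *)
exists (a' * b' * c'); split; first by rewrite !mulf_neq0.
  rewrite !exprMn e1 e2 e3; field; by rewrite a'0 b'0 c'0.
rewrite eA'; apply: std_arrangement_sqr; rewrite exprMn ?e1 ?e2 ?e3; field; by rewrite ?a'0 ?b'0 ?c'0.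
Qed.

Lemma unit_swap M : M \in unitmx -> mx3 (row i0 M) (row i2 M) (row i1 M) \in unitmx.
Proof. by rewrite !unit3P dm_mx3 bracket_swap2 oppr_eq0. Qed.

Lemma std_arrangement_norm p q r M : M \in unitmx -> p != 0 -> q != 0 -> r != 0 ->
  exists2 M', M' \in unitmx & std_arrangement p q r M = std_arrangement 1 1 (p * q * r) M'.
Proof.
move=> uM p0 q0 r0.
exists (mx3 ((p * q) *: row i0 M) (row i1 M) (p *: row i2 M)).
  by rewrite unit3P dm_mx3 -[row i1 M]scale1r bracket_scale !mulf_neq0 ?oner_eq0 // -/(row_bracket M) -unit3P.
rewrite [M in LHS]mx3_rowE -[row i1 M in RHS]scale1r std_arrangement_scale ?mulf_neq0 ?oner_eq0 //.
have -> : 1 * p / 1 = p by rewrite mul1r divr1.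
have -> : 1 * (p * q) / p = q by rewrite mul1r mulrC mulKf.
by have -> : p * q * r * 1 / (p * q) = r by field; rewrite p0 q0.
Qed.

Lemma std_arrangement_norm_inv p q r M : M \in unitmx -> p != 0 -> q != 0 -> r != 0 ->
  exists2 M', M' \in unitmx & std_arrangement p q r M = std_arrangement 1 1 (p * q * r)^-1 M'.
Proof.
move=> uM p0 q0 r0; rewrite [M]mx3_rowE std_arrangement_swap //.
have [|||M' uM' ->] := @std_arrangement_norm p^-1 r^-1 q^-1 _ (unit_swap uM); rewrite ?invr_eq0 //.
exists M' => //.
by have -> : p^-1 * r^-1 * q^-1 = (p * q * r)^-1 by field; rewrite p0 q0 r0.
Qed.

Lemma std_arrangement_norm_sign p q r M s : M \in unitmx -> p != 0 -> q != 0 -> r != 0 ->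
  s ^+ 2 = (p * q * r) ^+ 2 \/ s ^+ 2 = (p * q * r) ^- 2 ->
  exists2 M', M' \in unitmx & std_arrangement p q r M = std_arrangement 1 1 s M'.
Proof.
move=> uM p0 q0 r0 [] hs.
  by have [M' uM' ->] := std_arrangement_norm uM p0 q0 r0; exists M' => //; apply: std_arrangement_sqr.
have [M' uM' ->] := std_arrangement_norm_inv uM p0 q0 r0; exists M' => //; apply: std_arrangement_sqr => //.
by rewrite exprVn.
Qed.

End Moves.

(** * Projective classes *)

Section Unassuming.
Variable K : numFieldType.
Implicit Types (v w : nat -> 'rV[K]_3) (M : 'M[K]_3) (X Y Z : 'rV[K]_3) (a b c p q r : K).

Lemma std_octa p q r s : s \in octa_synthemes -> concurrent (std_points p q r) s.
Proof.
have E d e f : concurrent (std_points p q r) [:: d; e; f] = (concurrency (std_points p q r) d e f == 0) by [].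
rewrite !inE; repeat (case/orP; last first); move=> /eqP ->; rewrite E concurrencyE /=;
rewrite /std_points /gen6 /nth_vector /bracket /dot /cross !vecE; apply/eqP; ring.
Qed.

Lemma mulmx_unit_neq0 (x : 'rV[K]_3) M : M \in unitmx -> x != 0 -> x *m M != 0.
Proof. by move=> uM; apply: contra => /eqP e0; rewrite -[x](mulmxK uM) e0 mul0mx. Qed.

Lemma std_neq0 p q r i : (i < 6)%N -> std_points p q r i != 0.
Proof.
move=> hi; apply/eqP; move: i hi; apply: lt6P; rewrite /std_points /gen6 /nth_vector /= => /rowP h;
   by [move: (h i1); rewrite !vecE => /eqP; rewrite oner_eq0
      |move: (h i2); rewrite !vecE => /eqP; rewrite oner_eq0
      |move: (h i0); rewrite !vecE => /eqP; rewrite oner_eq0].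
Qed.

(** The enumeration [v] known to be in general position need not be [w]; nonzero cross products
    ensure that the three lines correspond to distinct indices of [v]. *)
Lemma arrangement_general_position_br v w i j k : general_position v -> (forall i, (i < 6)%N -> w i != 0) -> arrangement w `<=` arrangement v ->
  (i < 6)%N -> (j < 6)%N -> (k < 6)%N -> cross (w i) (w j) != 0 -> cross (w i) (w k) != 0 ->
  cross (w j) (w k) != 0 -> bracket (w i) (w j) (w k) != 0.
Proof.
move=> gp w0 sub hi hj hk.
have key x : (x < 6)%N -> exists2 y, (y < 6)%N & exists2 k, k != 0 & w x = k *: v y.
  move=> hx; have [y hy e] : arrangement v (Ln (w x)) by apply: sub; exists x.
  by exists y => //; apply: Ln_inj; rewrite ?w0 ?(gp_neq0 gp).
have [x hx [a a0 ->]] := key i hi; have [y hy [b b0 ->]] := key j hj.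
have [z hz [c c0 ->]] := key k hk => xy xz yz.
have ne s t m n : cross (s *: v m) (t *: v n) != 0 -> m != n.
  by apply: contra => /eqP ->; apply/eqP; apply: row3P; rewrite /cross !vecE; ring.
rewrite bracket_scale !mulf_neq0 //; apply: gp => //; [exact: ne xy|exact: ne xz|exact: ne yz].
Qed.

(** The six prescribed synthemes concur for all parameters, and an unassuming arrangement has
    exactly six concurrent ones. These are therefore all, which determines [Lambda23]. *)
Lemma std_arrangement_unassuming p q r M : M \in unitmx -> p != 0 -> q != 0 -> r != 0 ->
  unassuming (std_arrangement p q r M) ->
  (p * q * r) ^+ 2 != 1 /\ Lambda23 (std_arrangement p q r M) = std_arrangement (q * r)^-1 (r * p)^-1 (p * q)^-1 M.
Proof.
move=> uM p0 q0 r0 un; have [v [eA gpv _]] := unassumingP un.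
pose u i := std_points p q r i *m M.
have fr : framed u (std_points p q r) M by apply: std_framed.
have u0 i : (i < 6)%N -> u i != 0 by move=> hi; rewrite mulmx_unit_neq0 ?std_neq0.
have sub : arrangement u `<=` arrangement v by rewrite -eA.
have cx x y : cross (std_points p q r x) (std_points p q r y) != 0 -> cross (u x) (u y) != 0.
  apply: contra => /eqP e; apply/eqP.
  have B0 n : bracket (std_points p q r x) (std_points p q r y) n = 0.
    apply: (mulIf (x := row_bracket M)); first by rewrite -unit3P.
    by rewrite -bracket_mul -/(u x) -/(u y) /bracket e /dot !vecE !mul0r !addr0.
  apply: row3P; rewrite zerovE.
  - by rewrite -(B0 (e0 K)) /bracket /dot /e0 !row3E; ring.
  - by rewrite -(B0 (e1 K)) /bracket /dot /e1 !row3E; ring.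
  - by rewrite -(B0 (e2 K)) /bracket /dot /e2 !row3E; ring.
have c02 : cross (std_points p q r 0%N) (std_points p q r 2%N) != 0.
  by apply/eqP => /rowP/(_ i0)/eqP; rewrite /std_points /gen6 /nth_vector /cross !vecE mulr0 subr0 mulr1 oner_eq0.
have c04 : cross (std_points p q r 0%N) (std_points p q r 4%N) != 0.
  by apply/eqP => /rowP/(_ i2)/eqP; rewrite /std_points /gen6 /nth_vector /cross !vecE mul0r sub0r mulr1 oppr_eq0 oner_eq0.
have c05 : cross (std_points p q r 0%N) (std_points p q r 5%N) != 0.
  by apply/eqP => /rowP/(_ i2)/eqP; rewrite /std_points /gen6 /nth_vector /cross !vecE mul0r sub0r mulr1 oppr_eq0 oner_eq0.
have c24 : cross (std_points p q r 2%N) (std_points p q r 4%N) != 0.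
  by apply/eqP => /rowP/(_ i1)/eqP; rewrite /std_points /gen6 /nth_vector /cross !vecE mulr1 mulr0 subr0 oner_eq0.
have c25 : cross (std_points p q r 2%N) (std_points p q r 5%N) != 0.
  by apply/eqP => /rowP/(_ i1)/eqP; rewrite /std_points /gen6 /nth_vector /cross !vecE mulr1 mulr0 subr0 oner_eq0.
(* In the frame, these two brackets are [1 + p q r] and [1 - p q r]. *)
have b4 := arrangement_general_position_br gpv u0 sub (isT : 0 < 6)%N (isT : 2 < 6)%N (isT : 4 < 6)%N (cx _ _ c02) (cx _ _ c04) (cx _ _ c24).
have b5 := arrangement_general_position_br gpv u0 sub (isT : 0 < 6)%N (isT : 2 < 6)%N (isT : 5 < 6)%N (cx _ _ c02) (cx _ _ c05) (cx _ _ c25).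
rewrite (framed_br fr uM) // in b4; rewrite (framed_br fr uM) // in b5.
have [t1 t2] : p * q * r != 1 /\ p * q * r != -1.
  rewrite /std_points /gen6 /nth_vector /bracket /dot /cross !vecE in b4 b5; split.
    apply: contra b5 => /eqP e; apply/eqP; transitivity (1 - p * q * r); [ring|by rewrite e subrr].
  apply: contra b4 => /eqP e; apply/eqP; transitivity (1 + p * q * r); [ring|by rewrite e subrr].
split; first exact/sqr_neq1.
have gpu : general_position u by apply/(framed_general_position fr uM)/std_general_position.
have sz : size (concurrent_synthemes u) = 6%N.
  apply/eqP; rewrite -(card_triple gpu).
  by case: un => _ _ _ [_ h _ _ _].
have subo : {subset octa_synthemes <= concurrent_synthemes u}.
  move=> s hs; have hs' : s \in synthemes.
    have /allP/(_ s hs) : all (mem synthemes) octa_synthemes by vm_compute.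
    by [].
  by rewrite mem_filter hs' (framed_conc fr uM hs') std_octa.
have [|_ eqc] := uniq_min_size (isT : uniq octa_synthemes) subo; first by rewrite sz.
have hc s : s \in synthemes -> concurrent u s = (s \in octa_synthemes).
  by move=> hs; rewrite eqc mem_filter hs andbT.
rewrite /std_arrangement (Lambda_std p0 q0 r0 gpu fr uM hc) /std_arrangement.
have -> : p / (p * q * r) = (q * r)^-1 by field; rewrite p0 q0 r0.
have -> : q / (p * q * r) = (r * p)^-1 by field; rewrite p0 q0 r0.
by have -> : r / (p * q * r) = (p * q)^-1 by field; rewrite p0 q0 r0.
Qed.

Lemma octa_or_bip (A : set (P2line K)) : unassuming A ->
  (exists M p q r, [/\ M \in unitmx, p != 0, q != 0, r != 0 & A = std_arrangement p q r M]) \/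
  (exists M e, [/\ M \in unitmx, 1 + e + e ^+ 2 = 0, general_position (fermat_points e) &
     A = arrangement (fun i => fermat_points e i *m M)]).
Proof.
move/unassumingP => [v [-> gp sz]]; have [w [<- gpw]] := classify gp sz.
case=> [/(octa_frame gpw) [M [p [q [r [uM p0 q0 r0 fr]]]]]|/(bip_frame gpw) [M [e [uM he fr]]]].
  by left; exists M, p, q, r; split=> //; apply: framed_arrangement.
right; exists M, e; split=> //; first exact/(framed_general_position fr uM).
exact: framed_arrangement.
Qed.

(** With [T = p q r], the new product is [T t^3], whose square is [t^2] because [t^4 T^2 = 1]. Its
    square differs from 1 and -1 since [t^4 != 1], which amounts to [T^2 != 1]. *)
Lemma preimage_unassuming p q r M t : M \in unitmx -> p != 0 -> q != 0 -> r != 0 ->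
  (p * q * r) ^+ 2 != 1 -> t ^+ 4 * (p * q * r) ^+ 2 = 1 -> t ^+ 4 - 18 * t ^+ 2 + 1 != 0 ->
  unassuming (std_arrangement (p * t) (q * t) (r * t) M) /\ Lambda23 (std_arrangement (p * t) (q * t) (r * t) M) = std_arrangement p q r M.
Proof.
move=> uM p0 q0 r0 T1 ht t18.
have t0 : t != 0 by apply: contra_eq_neq ht => ->; rewrite expr0n mul0r eq_sym oner_eq0.
have eT : (p * t * (q * t) * (r * t)) ^+ 2 = t ^+ 2.
  by transitivity (t ^+ 2 * (t ^+ 4 * (p * q * r) ^+ 2)); [ring|rewrite ht mulr1].
have t4 : t ^+ 4 != 1 by apply: contra T1 => /eqP e; rewrite -ht e mul1r.
have sort_duad : nondeg (p * t) (q * t) (r * t).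
  rewrite /nondeg !mulf_neq0 //= (_ : 4 = 2 * 2)%N // !exprM eT -exprM t18 !andbT.
  by rewrite -negb_or -sqrf_eq1 -exprM.
have [h1 h2] := std_unassuming sort_duad uM; split; first exact: h1.
rewrite [LHS]h2; apply: std_arrangement_sqr.
- by rewrite exprMn exprVn eT exprMn mulfK ?expf_neq0.
- by rewrite exprMn exprVn eT exprMn mulfK ?expf_neq0.
- by rewrite exprMn exprVn eT exprMn mulfK ?expf_neq0.
Qed.

(** Normals transform by the inverse transpose of the map on points, whence the matrix
    [(invmx M)^T]. *)
Lemma projectively_equivalent_image (T : Type) (S : set T) (f : T -> 'rV[K]_3) M : M \in unitmx ->
  (forall s, S s -> f s != 0) ->
  projectively_equivalent [set Ln (f s) | s in S] [set Ln (f s *m M) | s in S].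
Proof.
move=> uM f0; have uM' : (invmx M)^T \in unitmx by rewrite unitmx_tr unitmx_inv.
exists (invmx M)^T => //.
have E (x a : 'rV[K]_3) : a != 0 -> (x \in val (Ln a)) = (x *m (invmx M)^T \in val (Ln (a *m M))).
  move=> a0; rewrite !val_Ln ?mulmx_unit_neq0 // !mem_orth -!dot_eq0.
  by rewrite trmx_mul -trmx_mul -!mulmxA -[(invmx M)^T *m _]trmx_mul mulmxK.
apply/seteqP; split=> l.
  by case=> s hs <-; exists (Ln (f s)); [exists s|move=> x; apply: E; apply: f0].
case=> _ [s hs <-] h; exists s => //; apply: val_inj; apply/vspaceP => x.
by rewrite -[x](mulmxKV uM') -E ?f0 // h.
Qed.

Lemma projectively_equivalent_common (A : set (P2line K)) v w : (forall i, (i < 6)%N -> v i != 0) ->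
  (forall i, (i < 6)%N -> w i != 0) ->
  projectively_equivalent A (arrangement v) -> projectively_equivalent A (arrangement w) ->
  exists2 M, M \in unitmx & forall i, (i < 6)%N -> exists2 j, (j < 6)%N &
    exists2 k, k != 0 & v i = k *: (w j *m M).
Proof.
move=> v0 w0 [g ug eg] [h uh eh].
have ug' : g^T \in unitmx by rewrite unitmx_tr.
have uh' : h^T \in unitmx by rewrite unitmx_tr.
exists (h^T *m invmx g^T); first by rewrite unitmx_mul uh' unitmx_inv.
move=> i hi.
have [l Al hl] : [set l' : P2line K | exists2 l : P2line K, A l & forall x : 'rV[K]_3, (x \in val l) = (x *m g \in val l')] (Ln (v i)).
  by rewrite -eg; exists i.
have [a a0 el] := LnP l.
have uhi : invmx h^T \in unitmx by rewrite unitmx_inv.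
have [j hj ej] : arrangement w (Ln (a *m invmx h^T)).
  rewrite eh; exists l => // x; rewrite el !val_Ln ?mulmx_unit_neq0 // !mem_orth -!dot_eq0.
  rewrite -[a in LHS](mulmxKV uh') [in LHS]trmx_mul trmxK mulmxA.
  by rewrite trmx_mul.
have e1 : Ln (v i *m g^T) = l.
  apply: val_inj; apply/vspaceP => x; rewrite hl !val_Ln ?mulmx_unit_neq0 ?v0 // !mem_orth -!dot_eq0.
  by rewrite trmx_mul trmxK mulmxA.
have [|||k k0 e2] := @Ln_inj K (v i *m g^T) a; rewrite ?mulmx_unit_neq0 ?v0 //; first by rewrite e1.
have [|||k' k'0 e3] := @Ln_inj K (w j) (a *m invmx h^T); rewrite ?mulmx_unit_neq0 ?w0 //.
exists j => //; exists (k / k'); first by rewrite mulf_neq0 ?invr_eq0.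
rewrite e3 -scalemxAl scalerA divfK // mulmxA mulmxKV // scalemxAl -e2 mulmxK //.
Qed.

(** Every index occurs once above and once below, so the scalars and the determinant of a coordinate
    change cancel: this is a projective invariant of ordered six-tuples. *)
Definition inv6 v : K := bracket (v 0%N) (v 2%N) (v 4%N) * bracket (v 1%N) (v 3%N) (v 5%N) /
  (bracket (v 0%N) (v 1%N) (v 2%N) * bracket (v 3%N) (v 4%N) (v 5%N)).

Lemma inv6_framed v w M : M \in unitmx -> framed v w M -> inv6 v = inv6 w.
Proof.
rewrite unit3P => M0 fr; rewrite /inv6.
have [k0 h0 ->] := fr 0%N isT; have [k1 h1 ->] := fr 1%N isT; have [k2 h2 ->] := fr 2%N isT.
have [k3 h3 ->] := fr 3%N isT; have [k4 h4 ->] := fr 4%N isT; have [k5 h5 ->] := fr 5%N isT.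
rewrite !bracket_scale !bracket_mul.
set a := bracket _ _ _; set b := bracket _ _ _; set c := bracket _ _ _; set d := bracket _ _ _.
have k : k0 * k1 * k2 * k3 * k4 * k5 * row_bracket M ^+ 2 != 0 by rewrite !mulf_neq0 ?expf_neq0.
transitivity ((a * b * (k0 * k1 * k2 * k3 * k4 * k5 * row_bracket M ^+ 2)) / (c * d * (k0 * k1 * k2 * k3 * k4 * k5 * row_bracket M ^+ 2))).
  by congr (_ / _); ring.
by rewrite -mulf_div mulfV // mulr1.
Qed.

(** Up to scalars and a coordinate change, every such [v] is a relabelling of one fixed [w], and
    there are finitely many maps from ['I_6] to itself. *)
Lemma finite_inv6 (A : set (P2line K)) :
  finite_set [set inv6 v | v in [set v | (forall i, (i < 6)%N -> v i != 0) /\ projectively_equivalent A (arrangement v)]].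
Proof.
have [[w [w0 hw]]|no] := pselect (exists v, (forall i, (i < 6)%N -> v i != 0) /\ projectively_equivalent A (arrangement v)); last first.
  by rewrite (_ : [set _ | _ in _] = set0) //; apply/seteqP; split=> // x [v hv _]; case: no; exists v.
apply: (@sub_finite_set _ _ [set inv6 (fun i => w (f (inord i))) | f in [set: {ffun 'I_6 -> 'I_6}]]); last first.
  by apply: finite_image; apply: finite_finset.
move=> _ [v [v0 hv] <-]; have [M uM h] := projectively_equivalent_common v0 w0 hv hw.
have h' (i : 'I_6) : exists j : 'I_6, exists2 k, k != 0 & v i = k *: (w j *m M).
  by have [j hj hk] := h i (ltn_ord i); exists (Ordinal hj).
have [f hf] := choice h'.
exists (finfun f) => //; symmetry; apply: (inv6_framed uM) => i hi.
by have := hf (Ordinal hi); rewrite ffunE (_ : inord i = Ordinal hi) //; apply: val_inj; rewrite /= inordK.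
Qed.

Lemma inv6_std p q r : p != 0 -> q != 0 -> r != 0 ->
  inv6 (std_points p q r) = (1 - (p * q * r) ^+ 2) / (4 * (p * q * r)).
Proof.
move=> p0 q0 r0.
rewrite /inv6 /std_points /gen6 /nth_vector /bracket /dot /cross !vecE.
by congr (_ / _); ring.
Qed.

End Unassuming.

(** * Change of field *)

Section Map.
Variables (F K : numFieldType) (f : {rmorphism F -> K}).
Implicit Types (v w : nat -> 'rV[F]_3) (M : 'M[F]_3).

Lemma map_cross (a b : 'rV[F]_3) : cross (map_mx f a) (map_mx f b) = map_mx f (cross a b).
Proof. by apply: row3P; rewrite /cross !(row3E, mxE) /= !(rmorphB, rmorphM). Qed.

Lemma map_br (a b c : 'rV[F]_3) : bracket (map_mx f a) (map_mx f b) (map_mx f c) = f (bracket a b c).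
Proof. by rewrite /bracket map_cross /dot !rmorphD !rmorphM ![map_mx f _ _ _]mxE. Qed.

Lemma map_neq0 (a : 'rV[F]_3) : (map_mx f a != 0) = (a != 0).
Proof. by rewrite map_mx_eq0. Qed.

Lemma map_unit M : (map_mx f M \in unitmx) = (M \in unitmx).
Proof. by rewrite map_unitmx. Qed.

Lemma map_std p q r M i : (i < 6)%N ->
  map_mx f (std_points p q r i *m M) = std_points (f p) (f q) (f r) i *m map_mx f M.
Proof.
move=> hi; rewrite map_mxM; congr (_ *m _); move: i hi; apply: lt6P;
  by apply: row3P; rewrite /std_points /gen6 /nth_vector /= !(row3E, mxE) /= ?rmorphN ?rmorph0 ?rmorph1.
Qed.

Lemma map_conc v s : s \in synthemes -> concurrent (fun i => map_mx f (v i)) s = concurrent v s.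
Proof.
case/synthemeP => d [e [g [-> _ _ _ _]]]; rewrite /concurrent -!/(concurrency _ _ _ _) !concurrencyE !map_br.
by rewrite -!rmorphM -rmorphB fmorph_eq0.
Qed.

(** Proportionality is the vanishing of a cross product, a condition that descends along a field
    morphism. *)
Lemma map_Ln (a b : 'rV[F]_3) : a != 0 -> b != 0 ->
  (Ln (map_mx f a) = Ln (map_mx f b)) <-> (Ln a = Ln b).
Proof.
move=> a0 b0; split.
  case/Ln_inj; rewrite ?map_neq0 // => c c0 e.
  have e1 : map_mx f (cross b a) = 0.
    by rewrite -map_cross e; apply: row3P; rewrite /cross !vecE; ring.
  have /(cross_eq0 b0) [k ek] : cross b a = 0.
    by apply/eqP; rewrite -(map_mx_eq0 f) e1.
  have k0 : k != 0 by apply: contra a0 => /eqP k0; rewrite ek k0 scale0r.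
  by rewrite ek Ln_scale.
case/Ln_inj => // c c0 ->.
by rewrite map_mxZ Ln_scale // fmorph_eq0.
Qed.

Lemma map_arrangement v w : (forall i, (i < 6)%N -> v i != 0) -> (forall i, (i < 6)%N -> w i != 0) ->
  (arrangement (fun i => map_mx f (v i)) = arrangement (fun i => map_mx f (w i))) <-> (arrangement v = arrangement w).
Proof.
move=> v0 w0.
have sub x y : (forall i, (i < 6)%N -> x i != 0) -> (forall i, (i < 6)%N -> y i != 0) ->
   (arrangement (fun i => map_mx f (x i)) `<=` arrangement (fun i => map_mx f (y i))) <-> (arrangement x `<=` arrangement y).
  move=> x0 y0; split=> h _ [i hi <-].
    have [j hj e] : arrangement (fun i => map_mx f (y i)) (Ln (map_mx f (x i))) by apply: h; exists i.
    by exists j => //; apply/map_Ln; rewrite ?x0 ?y0.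
  have [j hj e] : arrangement y (Ln (x i)) by apply: h; exists i.
  by exists j => //; apply/map_Ln; rewrite ?x0 ?y0.
split=> e; apply/seteqP; split.
- by apply/sub => //; rewrite e.
- by apply/sub => //; rewrite e.
- by apply/(sub v w v0 w0); rewrite e.
- by apply/(sub w v w0 v0); rewrite e.
Qed.

Lemma map_std_arrangement p q r M : arrangement (fun i => map_mx f (std_points p q r i *m M)) = std_arrangement (f p) (f q) (f r) (map_mx f M).
Proof. by apply/seteqP; split=> l [i hi <-]; exists i; rewrite ?map_std. Qed.

Lemma map_std_arrangement_inj p q r M p' q' r' M' : M \in unitmx -> M' \in unitmx ->
  std_arrangement (f p) (f q) (f r) (map_mx f M) = std_arrangement (f p') (f q') (f r') (map_mx f M') ->
  std_arrangement p q r M = std_arrangement p' q' r' M'.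
Proof.
move=> uM uM'; rewrite -!map_std_arrangement => /map_arrangement; apply=> i hi; exact: mulmx_unit_neq0 (std_neq0 _ _ _ hi).
Qed.

Lemma mem_Ln (b x : 'rV[K]_3) : b != 0 -> (x \in val (Ln b)) = (x *m b^T == 0).
Proof. by move=> b0; rewrite val_Ln // mem_orth dot_eq0. Qed.

Lemma Ln_of_real (b : 'rV[K]_3) (a : 'rV[F]_3) : b != 0 ->
  (forall x, (x \in val (Ln b)) = (x *m (map_mx f a)^T == 0)) ->
  a != 0 /\ Ln b = Ln (map_mx f a).
Proof.
move=> b0 ha; have a0 : a != 0.
  apply: contra (b0) => /eqP a0.
  have h x : dot x b = 0.
    have := etrans (esym (mem_Ln x b0)) (ha x).
    by rewrite dot_eq0 a0 map_mx0 trmx0 mulmx0 eqxx => /eqP.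
  apply/eqP; apply: row3P; rewrite zerovE.
  - by rewrite -(h (e0 _)) /dot !row3E; ring.
  - by rewrite -(h (e1 _)) /dot !row3E; ring.
  - by rewrite -(h (e2 _)) /dot !row3E; ring.
split=> //; apply: val_inj; apply/vspaceP => x.
by apply: etrans (ha x) _; rewrite mem_Ln ?map_neq0.
Qed.
(** The normals are first replaced by vectors over [F] and the classification is applied there, so
    the frame and the parameters lie in [F]. The bipartite type would produce a root of
    [1 + e + e^2] in [F]. *)
Lemma frame_over (B : set (P2line K)) : (forall e : F, 1 + e + e ^+ 2 != 0) -> unassuming B ->
  (forall b, b != 0 -> B (Ln b) -> exists a : 'rV[F]_3, a != 0 /\ Ln b = Ln (map_mx f a)) ->
  exists M p q r, [/\ M \in unitmx, p != 0, q != 0, r != 0 & B = std_arrangement (f p) (f q) (f r) (map_mx f M)].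
Proof.
move=> nocube uB reB; have [v [eB gp sz]] := unassumingP uB.
have v0 i : (i < 6)%N -> v i != 0 by move=> hi; apply: gp_neq0 gp _ hi.
have ex i : exists a : 'rV[F]_3, (i < 6)%N -> a != 0 /\ Ln (v i) = Ln (map_mx f a).
  have [hi|hi] := ltnP i 6; last by exists 0.
  have [|a ha] := reB _ (v0 i hi); last by exists a.
  by rewrite eB; exists i.
have [u hu] := choice ex.
have u0 i : (i < 6)%N -> u i != 0 by move=> hi; have [] := hu i hi.
have u1 : 1%:M \in @unitmx K 3 by rewrite unitmx1.
have fr : framed v (fun i => map_mx f (u i)) 1%:M.
  move=> i hi; have [a0 /Ln_inj [||k k0 ->]] := hu i hi; rewrite ?v0 ?map_neq0 //.
  by exists k => //; rewrite mulmx1.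
have gpu : general_position u.
  move=> i j k hi hj hk ij ik jk; have := (framed_general_position fr u1).1 gp i j k hi hj hk ij ik jk.
  by rewrite map_br fmorph_eq0.
have szu : size (concurrent_synthemes u) = 6%N.
  rewrite -sz; congr size; apply: eq_in_filter => s hs.
  by rewrite (framed_conc fr u1 hs) map_conc.
have eBu : B = arrangement (fun i => map_mx f (u i)).
  rewrite eB (framed_arrangement fr); apply/seteqP.
  by split=> l [i hi <-]; exists i; rewrite // mulmx1.
have [w [ew gpw]] := classify gpu szu.
case=> [/(octa_frame gpw) [M [p [q [r [uM p0 q0 r0 frw]]]]]|/(bip_frame gpw) [M [e [_ he _]]]]; last first.
  by have := nocube e; rewrite he eqxx.
exists M, p, q, r; split=> //; rewrite eBu -map_std_arrangement.
apply/map_arrangement => //; first by move=> i hi; exact: mulmx_unit_neq0 (std_neq0 _ _ _ hi).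
by rewrite -ew (framed_arrangement frw).
Qed.
(** Equalities between arrangements that come from [F] descend to [F]. Hence [preimage_params]
    applies over [F] and yields [t] in [F]. *)
Lemma preimage_over p q r M a b c N : M \in unitmx -> N \in unitmx ->
  p != 0 -> q != 0 -> r != 0 -> a != 0 -> b != 0 -> c != 0 ->
  let B := std_arrangement (f p) (f q) (f r) (map_mx f M) in let A := std_arrangement (f a) (f b) (f c) (map_mx f N) in
  unassuming A -> unassuming B -> Lambda23 A = B ->
  exists2 t, t ^+ 4 * (p * q * r) ^+ 2 = 1 & A = std_arrangement (f (p * t)) (f (q * t)) (f (r * t)) (map_mx f M).
Proof.
move=> uM uN p0 q0 r0 a0 b0 c0 B A uA uB lA.
have d0 (x y : F) : x != 0 -> y != 0 -> (x * y)^-1 != 0 by move=> x0 y0; rewrite invr_eq0 mulf_neq0.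
have f0 (x : F) : x != 0 -> f x != 0 by rewrite fmorph_eq0.
have uN' : map_mx f N \in unitmx by rewrite map_unit.
have uM' : map_mx f M \in unitmx by rewrite map_unit.
have [_ lA'] := std_arrangement_unassuming uN' (f0 _ a0) (f0 _ b0) (f0 _ c0) uA.
have [T1 lB] := std_arrangement_unassuming uM' (f0 _ p0) (f0 _ q0) (f0 _ r0) uB.
rewrite -!rmorphM -!fmorphV in lA' lB.
have eB : B = std_arrangement (f (b * c)^-1) (f (c * a)^-1) (f (a * b)^-1) (map_mx f N) by rewrite -lA.
have e1 : std_arrangement p q r M = std_arrangement (b * c)^-1 (c * a)^-1 (a * b)^-1 N.
  exact: (map_std_arrangement_inj uM uN).
have uB' := uB; rewrite eB in uB'.
have [T2 lB'] := std_arrangement_unassuming uN' (f0 _ (d0 _ _ b0 c0)) (f0 _ (d0 _ _ c0 a0)) (f0 _ (d0 _ _ a0 b0)) uB'.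
rewrite -!rmorphM -!fmorphV in lB'.
have e2 : std_arrangement (a * (a * b * c)) (b * (a * b * c)) (c * (a * b * c)) N = std_arrangement (q * r)^-1 (r * p)^-1 (p * q)^-1 M.
  have -> : a * (a * b * c) = ((c * a)^-1 * (a * b)^-1)^-1 by field; rewrite a0 b0 c0.
  have -> : b * (a * b * c) = ((a * b)^-1 * (b * c)^-1)^-1 by field; rewrite a0 b0 c0.
  have -> : c * (a * b * c) = ((b * c)^-1 * (c * a)^-1)^-1 by field; rewrite a0 b0 c0.
  by apply: (map_std_arrangement_inj uN uM); rewrite -lB -lB' -eB.
have [|t [t0 ht et]] := preimage_params uN uM a0 b0 c0 p0 q0 r0 _ erefl e1 erefl e2.
  move: T2; rewrite -!rmorphM -rmorphXn fmorph_eq1; apply: contra => /eqP e; apply/eqP.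
  transitivity ((a * b * c) ^- 4); last by rewrite e invr1.
  by field; rewrite a0 b0 c0.
exists t => //; rewrite /A -!map_std_arrangement; apply/map_arrangement => //.
- by move=> i hi; exact: mulmx_unit_neq0 (std_neq0 _ _ _ hi).
- by move=> i hi; exact: mulmx_unit_neq0 (std_neq0 _ _ _ hi).
Qed.

Lemma map_std_arrangement_sqr p q r M t t' : t ^+ 2 = t' ^+ 2 ->
  std_arrangement (f (p * t)) (f (q * t)) (f (r * t)) (map_mx f M) =
  std_arrangement (f (p * t')) (f (q * t')) (f (r * t')) (map_mx f M).
Proof. by move=> e; apply: std_arrangement_sqr; rewrite -!rmorphXn !exprMn e. Qed.

Lemma rmorph18 x y : f (x - 18 * y + 1) = f x - 18 * f y + 1.
Proof. by rewrite rmorphD rmorphB rmorphM rmorph1 rmorph_nat. Qed.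

Lemma map_root18 x : x ^+ 2 - 18 * x + 1 = 0 -> f x ^+ 2 - 18 * f x + 1 = 0.
Proof. by move=> e; rewrite -rmorphXn -rmorph18 e rmorph0. Qed.

Lemma image_over p q r M t : M \in unitmx -> p != 0 -> q != 0 -> r != 0 ->
  let B := std_arrangement (f p) (f q) (f r) (map_mx f M) in
  let A := std_arrangement (f (p * t)) (f (q * t)) (f (r * t)) (map_mx f M) in
  unassuming B -> t ^+ 4 * (p * q * r) ^+ 2 = 1 -> t ^+ 4 - 18 * t ^+ 2 + 1 != 0 ->
  unassuming A /\ Lambda23 A = B.
Proof.
move=> uM p0 q0 r0 B A uB ht t18.
have uM' : map_mx f M \in unitmx by rewrite map_unit.
have f0 (x : F) : x != 0 -> f x != 0 by rewrite fmorph_eq0.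
have [T1 lB] := std_arrangement_unassuming uM' (f0 _ p0) (f0 _ q0) (f0 _ r0) uB.
rewrite /A !rmorphM; apply: preimage_unassuming; rewrite ?f0 //.
  by rewrite -!rmorphM -!rmorphXn -rmorphM ht rmorph1.
by rewrite -!rmorphXn -rmorph18 fmorph_eq0.
Qed.
End Map.

(** * Small fibers and the exceptional class *)

Section Generic.
Variable K : numFieldType.
Implicit Types (M : 'M[K]_3).

Lemma card_le_I1 (T : Type) (A : set T) : (forall x y, A x -> A y -> x = y) -> A #<= `I_1.
Proof.
move=> h; have [[x Ax]|no] := pselect (exists x, A x).
  have e : forall y, A y <-> exists2 i : unit, i \in [:: tt] & y = x.
    by move=> y; split=> [Ay|[_ _ ->] //]; exists tt => //; apply: h.
  have h1 := (@card_seq _ _ [:: tt] (fun=> x) A 1 isT (fun a b _ _ _ => match a, b with tt, tt => erefl end) e).1.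
  have : A #= `I_1 by rewrite h1.
  by rewrite card_eq_le => /andP [].
rewrite (_ : A = set0) ?card_ge0 //; apply/seteqP; split=> x // Ax; case: no; by exists x.
Qed.

Lemma card_eq_I1 (T : Type) (A : set T) x : A x -> (forall y, A y -> y = x) -> A #= `I_1.
Proof.
move=> Ax h; have e : forall y, A y <-> exists2 i : unit, i \in [:: tt] & y = x.
  by move=> y; split=> [Ay|[_ _ ->] //]; exists tt => //; apply: h.
by rewrite (@card_seq _ _ [:: tt] (fun=> x) A 1 isT (fun a b _ _ _ => match a, b with tt, tt => erefl end) e).1.
Qed.

Lemma card_eq_I2 (T : Type) (A : set T) x y : A x -> A y -> x <> y ->
  (forall z, A z -> z = x \/ z = y) -> A #= `I_2.
Proof.
move=> Ax Ay xy h.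
have [||-> _] // := @card_seq _ _ [:: true; false] (fun b : bool => if b then x else y) A 2 isT.
  by move=> [] [] _ _ //= e; case: xy.
move=> z; split; first by case/h => ->; [exists true|exists false].
by case=> -[] _ ->.
Qed.

(** The roots of [x^2 - 18 x + 1] are [T0] and its inverse, so [t^2] is one of them. Then
    [(p q r)^2 = t^-4] is the square of [T0] or of its inverse, and both give the class with
    parameters [(1, 1, T0)]. *)
Lemma exceptional p q r M t T0 : M \in unitmx -> p != 0 -> q != 0 -> r != 0 ->
  t ^+ 4 * (p * q * r) ^+ 2 = 1 -> t ^+ 4 - 18 * t ^+ 2 + 1 = 0 -> T0 ^+ 2 - 18 * T0 + 1 = 0 ->
  projectively_equivalent (std_arrangement 1 1 T0 1%:M) (std_arrangement p q r M).
Proof.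
move=> uM p0 q0 r0 ht t18 hT0.
set T := p * q * r in ht.
have T00 : T0 != 0.
  by apply: contra_eq_neq hT0 => ->; rewrite expr0n mulr0 subr0 add0r oner_eq0.
have T_0 : T != 0 by rewrite !mulf_neq0.
have h : (t ^+ 2 - T0) * (t ^+ 2 - T0^-1) = 0.
  have -> : T0^-1 = 18 - T0.
    apply: (mulfI T00); rewrite mulfV //; apply/esym/eqP; rewrite -subr_eq0 -oppr_eq0 -hT0.
    by apply/eqP; ring.
  transitivity ((t ^+ 4 - 18 * t ^+ 2 + 1) - (T0 ^+ 2 - 18 * T0 + 1)); first by ring.
  by rewrite t18 hT0 subrr.
have [|M' uM' ->] := @std_arrangement_norm_sign _ p q r M T0 uM p0 q0 r0.
  have e4 : T ^+ 2 = t ^- 4.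
    have t4 : t ^+ 4 != 0 by apply: contra_eq_neq ht => ->; rewrite mul0r eq_sym oner_eq0.
    by apply: (mulfI t4); rewrite ht mulfV.
  rewrite -/T e4 invrK.
  move/eqP: h; rewrite mulf_eq0 !subr_eq0 => /orP [] /eqP e; [right|left].
    by rewrite -e -exprM.
  by rewrite -[T0]invrK -e exprVn -exprM.
rewrite /std_arrangement.
have -> : arrangement (fun i => std_points 1 1 T0 i *m 1%:M) = arrangement (std_points 1 1 T0).
  by congr arrangement; apply: funext => i; rewrite mulmx1.
by apply: projectively_equivalent_image => // i hi; apply: std_neq0.
Qed.

Lemma preimage_std_arrangement A p q r M : M \in unitmx -> p != 0 -> q != 0 -> r != 0 ->
  unassuming A -> unassuming (std_arrangement p q r M) -> Lambda23 A = std_arrangement p q r M ->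
  (exists M' e, [/\ M' \in unitmx, 1 + e + e ^+ 2 = 0, general_position (fermat_points e) &
     A = arrangement (fun i => fermat_points e i *m M')]) \/
  exists t, [/\ t != 0, t ^+ 4 * (p * q * r) ^+ 2 = 1 & A = std_arrangement (p * t) (q * t) (r * t) M].
Proof.
move=> uM p0 q0 r0 uA uB eB.
case: (octa_or_bip uA) => [[N [a [b [c [uN a0 b0 c0 eA]]]]]|]; last by left.
right.
have d0 (x y : K) : x != 0 -> y != 0 -> (x * y)^-1 != 0 by move=> x0 y0; rewrite invr_eq0 mulf_neq0.
rewrite eA in uA; have [_ lA] := std_arrangement_unassuming uN a0 b0 c0 uA.
have [T1 lB] := std_arrangement_unassuming uM p0 q0 r0 uB.
have eB' : std_arrangement p q r M = std_arrangement (b * c)^-1 (c * a)^-1 (a * b)^-1 N by rewrite -lA -eA eB.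
have uB' := uB; rewrite eB' in uB'.
have [T2 lB'] := std_arrangement_unassuming uN (d0 _ _ b0 c0) (d0 _ _ c0 a0) (d0 _ _ a0 b0) uB'.
apply: (preimage_params uN uM a0 b0 c0 p0 q0 r0 _ eA eB' erefl).
  apply: contra T2 => /eqP e; apply/eqP.
  transitivity ((a * b * c) ^- 4); last by rewrite e invr1.
  by field; rewrite a0 b0 c0.
have -> : a * (a * b * c) = ((c * a)^-1 * (a * b)^-1)^-1 by field; rewrite a0 b0 c0.
have -> : b * (a * b * c) = ((a * b)^-1 * (b * c)^-1)^-1 by field; rewrite a0 b0 c0.
have -> : c * (a * b * c) = ((b * c)^-1 * (c * a)^-1)^-1 by field; rewrite a0 b0 c0.
by rewrite -lB eB' lB'.
Qed.

End Generic.

Lemma exceptional_over (F K : numFieldType) (f : {rmorphism F -> K}) (p q r t T0 : F) (M : 'M[F]_3) :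
  M \in unitmx -> p != 0 -> q != 0 -> r != 0 -> t ^+ 4 * (p * q * r) ^+ 2 = 1 ->
  t ^+ 4 - 18 * t ^+ 2 + 1 = 0 -> T0 ^+ 2 - 18 * T0 + 1 = 0 ->
  projectively_equivalent (std_arrangement 1 1 (f T0) 1%:M) (std_arrangement (f p) (f q) (f r) (map_mx f M)).
Proof.
move=> uM p0 q0 r0 ht t18 hT0.
apply: (@exceptional _ _ _ _ _ (f t)); rewrite ?map_unit ?fmorph_eq0 //.
- by rewrite -!rmorphM -!rmorphXn -rmorphM ht rmorph1.
- by rewrite -!rmorphXn -rmorph18 t18 rmorph0.
- by rewrite -!rmorphXn -rmorph18 hT0 rmorph0.
Qed.

(** * Fibers of Lambda *)

Section Infinite.
Variable K : numFieldType.

Lemma bip_class (e : K) M : M \in unitmx -> general_position (fermat_points e) ->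
  projectively_equivalent (Lambda23 (arrangement (fermat_points e))) (Lambda23 (arrangement (fun i => fermat_points e i *m M))).
Proof.
move=> uM gp.
have fr : framed (fun i => fermat_points e i *m M) (fermat_points e) M.
  by move=> i _; exists 1; rewrite ?oner_eq0 ?scale1r.
have gp' : general_position (fun i => fermat_points e i *m M) by apply/(framed_general_position fr uM).
rewrite (Lambda_framed gp' fr uM) Lambda_arrangement //.
apply: projectively_equivalent_image => // s; rewrite /= mem_filter => /andP [_ hs].
exact: syntheme_point_neq0.
Qed.

(** Both roots [9 +- 4 sqrt 5] of the quadratic lie below 18; the bound 25 is the first square
    [m ^ 2] used in the family. *)
Lemma large_generic k : (25 <= k)%N ->
  [/\ (k%:R : K) != 0, (k%:R : K) != 1, (k%:R : K) != -1 & (k%:R : K) ^+ 2 - 18 * k%:R + 1 != 0].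
Proof.
move=> hk; split.
- by rewrite pnatr_eq0; lia.
- by rewrite (_ : 1 = 1%:R) // eqr_nat; lia.
- by rewrite -addr_eq0 natr1 pnatr_eq0.
- rewrite addrAC subr_eq0 -natrX natr1 -natrM eqr_nat; nia.
Qed.

Lemma nondeg_sqr (p q r y : K) : p != 0 -> q != 0 -> r != 0 -> (p * q * r) ^+ 2 = y ->
  y != 1 -> y != -1 -> y ^+ 2 - 18 * y + 1 != 0 -> nondeg p q r.
Proof.
move=> p0 q0 r0 e y1 y2 y3; rewrite /nondeg p0 q0 r0 (_ : 4 = 2 * 2)%N // exprM e y1 y2.
exact: y3.
Qed.

(** The second triple gives the image of the first; their squared products are [m^2] and [m^-4]. *)
Lemma family_nondeg m : (5 <= m)%N ->
  nondeg 1 1 (m%:R : K) /\ nondeg (m%:R^-1) (m%:R^-1) (1 : K).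
Proof.
move=> hm; have h2 : (25 <= m ^ 2)%N by nia.
have h4 : (25 <= m ^ 4)%N by rewrite (expnM m 2 2); nia.
have m0 : (m%:R : K) != 0 by rewrite pnatr_eq0; lia.
have [y0 y1 y2 y3] := large_generic h2; have [z0 z1 z2 z3] := large_generic h4.
split.
  by apply: (@nondeg_sqr _ _ _ (m ^ 2)%:R); rewrite ?oner_eq0 // !mul1r natrX.
(* The quadratic is reciprocal, so its value at the inverse is controlled by the value at
   [m ^ 4]. *)
have e3 : ((m ^ 4)%:R^-1 : K) ^+ 2 - 18 * (m ^ 4)%:R^-1 + 1 =
   ((m ^ 4)%:R ^+ 2 - 18 * (m ^ 4)%:R + 1) / (m ^ 4)%:R ^+ 2 by field.
apply: (@nondeg_sqr _ _ _ (m ^ 4)%:R^-1); rewrite ?oner_eq0 ?invr_eq0 //.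
- by rewrite mulr1 -expr2 -exprM natrX exprVn.
- by rewrite invr_eq1.
- by apply: contra z2 => /eqP e; rewrite -[_%:R]invrK e invrN invr1.
- by rewrite e3 mulf_neq0 // invr_eq0 expf_neq0.
Qed.

Lemma family_inv6 m : (5 <= m)%N ->
  inv6 (std_points (m%:R^-1) (m%:R^-1) (1 : K)) = ((m ^ 2)%:R - (m ^ 2)%:R^-1) / 4.
Proof.
move=> hm; have m0 : (m%:R : K) != 0 by rewrite pnatr_eq0; lia.
have n4 : (4 : K) != 0 by rewrite pnatr_eq0.
rewrite inv6_std ?invr_eq0 ?oner_eq0 // natrX; field; by rewrite m0.
Qed.

Lemma infinite_image :
  ~ finitely_many_classes (@unassuming K `&` (@Lambda23 K @` @unassuming K)).
Proof.
case=> S finS cov.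
have fin : finite_set (\bigcup_(A in S) [set inv6 v | v in
   [set v | (forall i, (i < 6)%N -> v i != 0) /\ projectively_equivalent A (arrangement v)]]).
  by apply: bigcup_finite => // A _; apply: finite_inv6.
(* The shift by 5 keeps the family away from the degenerate parameters. *)
pose g (n : nat) : K := ((n + 5) ^ 2)%:R.
pose F n := inv6 (std_points ((n + 5)%:R^-1) ((n + 5)%:R^-1) (1 : K)).
have sub : range F `<=` \bigcup_(A in S) [set inv6 v | v in
   [set v | (forall i, (i < 6)%N -> v i != 0) /\ projectively_equivalent A (arrangement v)]].
  move=> _ [n _ <-]; have h5 : (5 <= n + 5)%N by rewrite leq_addl.
  have [nd1 nd2] := family_nondeg h5.
  have m0 : ((n + 5)%:R : K) != 0 by rewrite pnatr_eq0; lia.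
  have u1 : 1%:M \in @unitmx K 3 by rewrite unitmx1.
  have [uA lA] := std_unassuming nd1 u1; have [uB _] := std_unassuming nd2 u1.
  have [|A SA' hA] := cov (arrangement (fun i => std_points ((n + 5)%:R^-1) ((n + 5)%:R^-1) (1 : K) i *m 1%:M)).
    split; first exact: uB.
    exists (arrangement (fun i => std_points 1 1 ((n + 5)%:R : K) i *m 1%:M)); first exact: uA.
    by rewrite lA !mul1r mulfV.
  exists A => //; exists (std_points ((n + 5)%:R^-1) ((n + 5)%:R^-1) (1 : K)) => //; split.
    by move=> i hi; apply: std_neq0.
  move: hA; congr projectively_equivalent.
  by congr arrangement; apply: funext => i; rewrite mulmx1.
have Finj : injective F.
  move=> x y; rewrite /F !family_inv6 ?leq_addl // => e.
  have n4 : (4 : K) != 0 by rewrite pnatr_eq0.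
  have e' : g x - (g x)^-1 = g y - (g y)^-1 by apply: (mulIf (x := 4^-1)); rewrite ?invr_eq0.
  have gx : 0 < g x by rewrite ltr0n expn_gt0 addnS.
  have gy : 0 < g y by rewrite ltr0n expn_gt0 addnS.
  (* The function [x - 1/x] is injective on positive numbers, because the second factor is
     positive. *)
  have : (g x - g y) * (1 + (g x)^-1 * (g y)^-1) = 0.
    transitivity ((g x - (g x)^-1) - (g y - (g y)^-1)); last by rewrite e' subrr.
    by move: (lt0r_neq0 gx) (lt0r_neq0 gy); move: (g x) (g y) => X Y X0 Y0; field; rewrite X0 Y0.
  have pos : 0 < 1 + (g x)^-1 * (g y)^-1 by rewrite addr_gt0 ?mulr_gt0 ?invr_gt0.
  move/eqP; rewrite mulf_eq0 (gt_eqF pos) orbF subr_eq0 eqr_nat => /eqP; nia.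
have e : range F #= [set: nat] by apply: inj_card_eq => x y _ _; apply: Finj.
by have := sub_finite_set sub fin; rewrite (eq_finite_set e) => /infinite_nat.
Qed.
End Infinite.

(** * Fibers over an algebraically closed field *)

Section Closed.
Variables (K : numClosedFieldType) (T0 : K).
Hypothesis T0_eq : T0 ^+ 2 - 18 * T0 + 1 = 0.

(** Besides the class where the quartic vanishes, the images of the Fermat points are set aside,
    since they may have a preimage outside the triangle family. At most two values of [e] occur. *)
Definition exceptional_classes : set (set (P2line K)) :=
  [set std_arrangement 1 1 T0 1%:M] `|` [set Lambda23 (arrangement (fermat_points e)) | e in [set e : K | 1 + e + e ^+ 2 = 0]].

Lemma finite_exceptional : finite_set exceptional_classes.
Proof.
rewrite finite_setU; split; first exact: finite_set1.
apply: finite_image.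
have [[x hx]|no] := pselect (exists e : K, 1 + e + e ^+ 2 = 0); last first.
  by rewrite (_ : mkset _ = set0) //; apply/seteqP; split=> e // he; case: no; exists e.
apply: (@sub_finite_set _ _ ([set x] `|` [set - 1 - x])); last first.
  by rewrite finite_setU; split; apply: finite_set1.
move=> y hy; have : (y - x) * (y - (- 1 - x)) = 0.
  by transitivity ((1 + y + y ^+ 2) - (1 + x + x ^+ 2)); [ring|rewrite hy hx subrr].
by move/eqP; rewrite mulf_eq0 !subr_eq0 => /orP [] /eqP ->; [left|right].
Qed.

Lemma two_preimages (B : set (P2line K)) : unassuming B -> (@Lambda23 K @` @unassuming K) B ->
  ~ (exists2 A, exceptional_classes A & projectively_equivalent A B) ->
  @unassuming K `&` (@Lambda23 K @^-1` [set B]) #= `I_2.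
Proof.
move=> uB [A uA lA] nex.
have nbip A' M e : M \in unitmx -> 1 + e + e ^+ 2 = 0 -> general_position (fermat_points e) ->
    A' = arrangement (fun i => fermat_points e i *m M) -> Lambda23 A' = B -> False.
  move=> uM he gp -> eB; apply: nex; exists (Lambda23 (arrangement (fermat_points e))); first by right; exists e.
  by rewrite -eB; apply: bip_class.
case: (octa_or_bip uA) => [[M [a [b [c [uM a0 b0 c0 eA]]]]]|[M [e [uM he gp eA]]]]; last first.
  by case: (nbip _ _ _ uM he gp eA lA).
rewrite eA in uA lA; have [_ lA'] := std_arrangement_unassuming uM a0 b0 c0 uA.
set p := (b * c)^-1 in lA'; set q := (c * a)^-1 in lA'; set r := (a * b)^-1 in lA'.
have p0 : p != 0 by rewrite invr_eq0 mulf_neq0.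
have q0 : q != 0 by rewrite invr_eq0 mulf_neq0.
have r0 : r != 0 by rewrite invr_eq0 mulf_neq0.
clearbody p q r; have eB : B = std_arrangement p q r M by rewrite -lA lA'.
rewrite eB in uB; have [T1 _] := std_arrangement_unassuming uM p0 q0 r0 uB.
have T_0 : p * q * r != 0 by rewrite !mulf_neq0.
have ok t : t ^+ 4 * (p * q * r) ^+ 2 = 1 -> unassuming (std_arrangement (p * t) (q * t) (r * t) M) /\
    Lambda23 (std_arrangement (p * t) (q * t) (r * t) M) = B.
  move=> ht; rewrite eB; apply: preimage_unassuming => //.
  apply/eqP => t18; apply: nex; exists (std_arrangement 1 1 T0 1%:M); first by left.
  rewrite eB; exact: (exceptional uM p0 q0 r0 ht t18 T0_eq).
(* With [T = p q r], the equation [t^4 T^2 = 1] means [t^2 = 1/T] or [t^2 = -1/T]. One square root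
   of each is chosen, as [t] and [-t] give the same arrangement. *)
pose t1 : K := sqrtC (p * q * r)^-1; pose t2 : K := sqrtC (- (p * q * r)^-1).
have s1 : t1 ^+ 2 = (p * q * r)^-1 by rewrite sqrtCK.
have sort_two : t2 ^+ 2 = - (p * q * r)^-1 by rewrite sqrtCK.
have h1 : t1 ^+ 4 * (p * q * r) ^+ 2 = 1 by rewrite (exprM t1 2 2) s1 -exprMn mulVf ?expr1n.
have h2 : t2 ^+ 4 * (p * q * r) ^+ 2 = 1 by rewrite (exprM t2 2 2) sort_two sqrrN -exprMn mulVf ?expr1n.
have t0 t : t ^+ 4 * (p * q * r) ^+ 2 = 1 -> t != 0.
  by move=> ht; apply: contra_eq_neq ht => ->; rewrite expr0n mul0r eq_sym oner_eq0.
apply: (@card_eq_I2 _ _ (std_arrangement (p * t1) (q * t1) (r * t1) M) (std_arrangement (p * t2) (q * t2) (r * t2) M)).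
- exact: ok h1.
- exact: ok h2.
- have [z1 z2] := (t0 _ h1, t0 _ h2).
  case/std_param; rewrite ?mulf_neq0 // !exprMn => /(mulfI (expf_neq0 2 p0)) e _ _.
  move: e; rewrite s1 sort_two => /eqP; rewrite -subr_eq0 opprK -mulr2n mulrn_eq0 /= invr_eq0.
  by rewrite (negPf T_0).
- move=> A' [uA' lA2].
  case: (preimage_std_arrangement uM p0 q0 r0 uA' uB); first by rewrite lA2 eB.
    by case=> M' [e [uM' he gp eA']]; case: (nbip _ _ _ uM' he gp eA' lA2).
  case=> t [tn0 ht eA'].
  have : t ^+ 2 = t1 ^+ 2 \/ t ^+ 2 = t2 ^+ 2.
    have : (t ^+ 2) ^+ 2 = ((p * q * r)^-1) ^+ 2.
      apply: (mulIf (expf_neq0 2 T_0)); rewrite -exprM ht -exprMn mulVf ?expr1n //.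
    by move/eqP; rewrite eqf_sqr s1 sort_two => /orP [] /eqP ->; [left|right].
  by case=> e; [left|right]; rewrite eA'; apply: std_arrangement_sqr; rewrite !exprMn e.
Qed.

End Closed.

(** * Fibers over the reals *)

Section Final.
Variable R : realType.
Let rc : {rmorphism R -> R[i]} := real_complex R.
Notation real_std p q r M := (std_arrangement (rc p) (rc q) (rc r) (map_mx rc M)).

Lemma real_line_Ln (a : 'rV[R]_3) : a != 0 -> real_line (Ln (map_mx rc a)).
Proof.
move=> a0; exists a => x; apply: mem_Ln.
by rewrite (map_neq0 rc).
Qed.

Lemma real_lineP (b : 'rV[R[i]]_3) : b != 0 -> real_line (Ln b) ->
  exists a : 'rV[R]_3, a != 0 /\ Ln b = Ln (map_mx rc a).
Proof. by move=> b0 [a ha]; exists a; apply: (Ln_of_real (f := rc) b0 ha). Qed.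

Lemma no_real_cube_root (e : R) : 1 + e + e ^+ 2 != 0.
Proof.
apply/eqP => h; have : 0 < 1 + e + e ^+ 2; last by rewrite h ltxx.
have := sqr_ge0 (e + 1 / 2); nra.
Qed.

Lemma real_frame (B : set (P2line R[i])) : real_unassuming B ->
  exists M p q r, [/\ M \in unitmx, p != 0, q != 0, r != 0 & B = real_std p q r M].
Proof.
case=> uB reB; apply: (frame_over (f := rc) no_real_cube_root uB) => b b0 /reB.
exact: real_lineP.
Qed.

Lemma CA_real p q r (M : 'M[R]_3) : M \in unitmx -> forall l, real_std p q r M l -> real_line l.
Proof.
move=> uM l; rewrite -map_std_arrangement => -[i hi <-]; apply: real_line_Ln.
exact: mulmx_unit_neq0 (std_neq0 _ _ _ hi).
Qed.

(** Both preimages come from real [t] and [t'] with the same fourth power. Their squares are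
    nonnegative, hence equal, and the arrangement depends on squares only. *)
Lemma real_inj (B A1 A2 : set (P2line R[i])) : real_unassuming B -> real_unassuming A1 ->
  real_unassuming A2 -> Lambda23 A1 = B -> Lambda23 A2 = B -> A1 = A2.
Proof.
move=> rB r1 r2 l1 l2; case: (rB) => uB _; case: (r1) => u1 _; case: (r2) => u2 _.
have [M [p [q [r [uM p0 q0 r0 eB]]]]] := real_frame rB.
have key A : real_unassuming A -> Lambda23 A = B ->
    exists t : R, t ^+ 4 * (p * q * r) ^+ 2 = 1 /\ A = real_std (p * t) (q * t) (r * t) M.
  move=> rA lA; have uA := rA.1; have [N [a [b [c [uN a0 b0 c0 eA]]]]] := real_frame rA.
  rewrite eA in uA lA; have uB' := uB; rewrite eB in uB' lA.
  have [t ht et] := preimage_over uM uN p0 q0 r0 a0 b0 c0 uA uB' lA.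
  by exists t; split; [exact: ht|exact: (etrans eA et)].
have [t [ht eA1]] := key A1 r1 l1; have [t' [ht' eA2]] := key A2 r2 l2.
have T2 : (p * q * r) ^+ 2 != 0 by rewrite expf_neq0 // !mulf_neq0.
have : t ^+ 2 = t' ^+ 2.
  apply/eqP; rewrite -(@eqrXn2 _ 2) ?sqr_ge0 // -!exprM; apply/eqP.
  by apply: (mulIf T2); rewrite ht ht'.
by move=> e; apply: etrans eA1 (etrans _ (esym eA2)); apply: (map_std_arrangement_sqr rc).
Qed.

(** The larger root of [x^2 - 18 x + 1], since [sqrt 80 = 4 sqrt 5]. *)
Definition T0 : R := 9 + Num.sqrt 80.
Definition B0 : set (P2line R[i]) := std_arrangement 1 1 (rc T0) 1%:M.

Lemma T0_eq : T0 ^+ 2 - 18 * T0 + 1 = 0.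
Proof.
have h : Num.sqrt 80 ^+ 2 = 80 :> R by rewrite sqr_sqrtr.
transitivity (Num.sqrt 80 ^+ 2 - 80 : R); last by rewrite h subrr.
by rewrite /T0; ring.
Qed.

Lemma rcT0_eq : rc T0 ^+ 2 - 18 * rc T0 + 1 = 0.
Proof.
exact: (map_root18 rc T0_eq).
Qed.

Lemma real_surj (B : set (P2line R[i])) : real_unassuming B -> ~ projectively_equivalent B0 B ->
  exists2 A, real_unassuming A & Lambda23 A = B.
Proof.
move=> rB nB; have [M [p [q [r [uM p0 q0 r0 eB]]]]] := real_frame rB.
have uB := rB.1; rewrite eB in uB nB *.
have T_0 : p * q * r != 0 by rewrite !mulf_neq0.
(* Of the two candidates [1/T] and [-1/T] for [t^2], with [T = p q r], the positive one is
   [|1/T|]. *)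
pose t := Num.sqrt `|(p * q * r)^-1|.
have ht : t ^+ 4 * (p * q * r) ^+ 2 = 1.
  rewrite (exprM t 2 2) sqr_sqrtr ?normr_ge0 // real_normK ?num_real //.
  by rewrite exprVn mulVf ?expf_neq0.
have [t18|t18] := eqVneq (t ^+ 4 - 18 * t ^+ 2 + 1) 0.
  by case: nB; apply: (exceptional_over rc uM p0 q0 r0 ht t18 T0_eq).
have [uA lA] := image_over uM p0 q0 r0 uB ht t18.
by exists (real_std (p * t) (q * t) (r * t) M) => //; split=> //; exact: CA_real.
Qed.

End Final.

Theorem theorem3p1 (R : realType) :
  generically
    (@unassuming R[i] `&` (@Lambda23 R[i] @` @unassuming R[i]))
    [set B : set (P2line R[i]) |
       @unassuming R[i] `&` (@Lambda23 R[i] @^-1` [set B]) #= `I_2]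
  /\ (forall B : set (P2line R[i]), @real_unassuming R B ->
        @real_unassuming R `&` (@Lambda23 R[i] @^-1` [set B]) #<= `I_1)
  /\ (exists B0 : set (P2line R[i]),
        forall B : set (P2line R[i]), @real_unassuming R B ->
          ~ projectively_equivalent B0 B ->
          @real_unassuming R `&` (@Lambda23 R[i] @^-1` [set B]) #= `I_1).
Proof.
split; last split.
- split; first exact: infinite_image.
  exists (exceptional_classes (real_complex R (T0 R))); first exact: finite_exceptional.
  move=> B [[uB iB] nB]; apply: contrapT => nex; apply: nB.
  exact: (two_preimages (rcT0_eq R)).
- move=> B rB; apply: card_le_I1 => A1 A2 [r1 l1] [r2 l2].
  exact: (real_inj rB r1 r2 l1 l2).
- exists (@B0 R) => B rB nB; have [A rA lA] := real_surj rB nB.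
  apply: (@card_eq_I1 _ _ A) => // A' [rA' lA'].
  exact: (real_inj rB rA' rA lA' lA).
Qed.
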